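(* Let $H\in[1/2,1)$, $\alpha\ge 0$, $\gamma>0$. Let $B^{H}(t)$ be a (real-valued) fractional Brownian motion on $\mathbb{S}^{2}$ with Hurst index $H$ and variances $\mathcal{A}_\ell$, with associated real fractional Brownian motions $\beta^{1}_{\ell m},\beta^{2}_{\ell m}$. Let $T_0$ be a centered, $2$-weakly isotropic Gaussian random field on $\mathbb{S}^2$ and let $$u(t,\mathbf{x})=\sum_{\ell=0}^{\infty}\sum_{m=-\ell}^{\ell}e^{-\psi(\lambda_\ell)t}\,\widehat{(T_0)}_{\ell m}Y_{\ell,m}(\mathbf{x})$$ be the solution of the fractional stochastic Cauchy problem $\frac{\partial u}{\partial t}+\psi(-\Delta^{*})u=0$, $u(0,\cdot)=T_0$. Then, for $t_0\ge 0$, the solution of the equation $$dX(t,\mathbf{x})+\psi(-\Delta^{*})X(t,\mathbf{x})\,dt=dB^{H}(t,\mathbf{x}),\qquad t\ge0,\ \mathbf{x}\in\mathbb{S}^2,$$ under the random initial condition $X(0)=u(t_0)$ is, for $t\ge0$, $$X(t)=\sum_{\ell=0}^{\infty}\Bigl(\sum_{m=-\ell}^{\ell}e^{-\psi(\lambda_\ell)(t+t_0)}\widehat{(T_0)}_{\ell m}Y_{\ell,m}+\sqrt{\mathcal{A}_\ell}\Bigl(\int_0^t e^{-\psi(\lambda_\ell)(t-s)}d\beta^{1}_{\ell 0}(s)\,Y_{\ell,0}+\sqrt2\sum_{m=1}^{\ell}\Bigl(\int_0^t e^{-\psi(\lambda_\ell)(t-s)}d\beta^{1}_{\ell m}(s)\,\mathrm{Re}\,Y_{\ell,m}+\int_0^t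 e^{-\psi(\lambda_\ell)(t-s)}d\beta^{2}_{\ell m}(s)\,\mathrm{Im}\,Y_{\ell,m}\Bigr)\Bigr)\Bigr).$$
   Context: $\mathbb{S}^2\subset\mathbb{R}^3$ is the unit sphere with normalized surface measure $\mu$ ($\mu(\mathbb{S}^2)=1$), and $(\Omega,\mathcal F,P)$ is a probability space. $\{Y_{\ell,m}:\ell\ge0,\ -\ell\le m\le\ell\}$ is the complex orthonormal basis of spherical harmonics (orthonormal with respect to $\mu$), $Y_{\ell,m}=\sqrt{(2\ell+1)\frac{(\ell-m)!}{(\ell+m)!}}\,P_\ell^{m}(\cos\theta)e^{im\varphi}$, with $Y_{\ell,m}=(-1)^m\overline{Y_{\ell,-m}}$. For $f\in L_2(\mathbb{S}^2)$, $\widehat f_{\ell m}$ denotes the Fourier coefficient $\int f\,\overline{Y_{\ell,m}}\,d\mu$, so $f=\sum_{\ell,m}\widehat f_{\ell m}Y_{\ell,m}$ in $L_2(\mathbb{S}^2)$; the same notation is used for random fields. $\Delta^{*}$ is the Laplace-Beltrami operator on $\mathbb{S}^2$, with $-\Delta^{*}Y_{\ell,m}=\lambda_\ell Y_{\ell,m}$, $\lambda_\ell=\ell(\ell+1)$. For $\alpha\ge0,\gamma>0$, $\psi(t)=t^{\alpha/2}(1+t)^{\gamma/2}$, and $\psi(-\Delta^{*})=(-\Delta^{*})^{\alpha/2}(I-\Delta^{*})^{\gamma/2}$ is the operator with eigenvalue $\psi(\lambda_\ell)=\lambda_\ell^{\alpha/2}(1+\lambda_\ell)^{\gamma/2}$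 on $Y_{\ell,m}$. A real-valued random field $T$ on $\mathbb{S}^2$ (jointly measurable in $(\omega,\mathbf{x})$) is centered if $E[T(\mathbf{x})]=0$ for all $\mathbf{x}$; it is $2$-weakly isotropic if $E|T(\mathbf{x})|^2<\infty$ and the first moment and the covariance $E[T(\mathbf{x})T(\mathbf{y})]$ are invariant under all rotations of $\mathbb{S}^2$; it is Gaussian if all its finite-dimensional distributions are Gaussian. A real fractional Brownian motion (fBm) with Hurst index $H$ and variance $\sigma^2$ at $t=1$ is a centered Gaussian process $\beta$ on $[0,\infty)$ with $\beta(0)=0$ and $E|\beta(t)-\beta(s)|^2=|t-s|^{2H}\sigma^2$; for $H=1/2$ it is Brownian motion. The real-valued fBm on $\mathbb{S}^2$ with Hurst index $H$ and variances $\mathcal{A}_\ell>0$, where $\sum_{\ell}(2\ell+1)\mathcal{A}_\ell<\infty$, is, in $L_2(\Omega\times\mathbb{S}^2)$, $$B^{H}(t)=\sum_{\ell=0}^{\infty}\sqrt{\mathcal{A}_\ell}\Bigl(\beta^1_{\ell0}(t)Y_{\ell,0}+\sqrt2\sum_{m=1}^{\ell}\bigl(\beta^1_{\ell m}(t)\,\mathrm{Re}\,Y_{\ell,m}+\beta^2_{\ell m}(t)\,\mathrm{Im}\,Y_{\ell,m}\bigr)\Bigr),$$ where $\beta^1_{\ell m}$ ($0\le m\le\ell$) and $\beta^2_{\ell m}$ ($1\le m\le\ell$), $\ell\ge0$, are independent real fBms with Hurst index $H$ and variance $1$ at $t=1$. Integrals of deterministic functions against $\beta^i_{\ell m}$ are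 (pathwise) Riemann-Stieltjes integrals. The equation with initial condition $X(0)=u(t_0)$ means $X(t)=u(t_0)-\int_0^t\psi(-\Delta^{*})X(s)\,ds+B^{H}(t)$, understood coefficientwise in the spherical harmonic expansion: for all $\ell,m$ and $t\ge0$, $\widehat{X(t)}_{\ell m}=\widehat{u(t_0)}_{\ell m}-\psi(\lambda_\ell)\int_0^t\widehat{X(s)}_{\ell m}\,ds+\widehat{B^H(t)}_{\ell m}$. *)

(* Defs.v *)
From HB Require Import structures.
From mathcomp Require Import all_boot all_order all_algebra.
From mathcomp Require Import all_classical all_reals all_analysis.
From mathcomp Require Import measurable_realfun.
From mathcomp Require Export complex.
From mathcomp Require Import ring lra.

Set Implicit Arguments.
Unset Strict Implicit.
Unset Printing Implicit Defensive.
Import Order.TTheory GRing.Theory Num.Theory.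
Import numFieldNormedType.Exports.

Local Open Scope classical_set_scope.
Local Open Scope ring_scope.
Local Open Scope complex_scope.

Section sphere.
Variable R : realType.

Record sphere := Sphere {
  sphere_val :> 'rV[R]_3 ;
  _ : \sum_(i < 3) sphere_val 0 i ^+ 2 == 1 }.

HB.instance Definition _ := [isSub for sphere_val].
HB.instance Definition _ := [Choice of sphere by <:].

Definition sphere_coord (i : 'I_3) (x : sphere) : R := x 0 i.

Definition spherical_row (p : R * R) : 'rV[R]_3 :=
  \row_i [:: sin p.1 * cos p.2; sin p.1 * sin p.2; cos p.1]`_i.

Lemma spherical_row_norm p : \sum_(i < 3) spherical_row p 0 i ^+ 2 == 1.
Proof.
rewrite !big_ord_recr big_ord0/= !mxE/= add0r !exprMn -mulrDr.
by rewrite (cos2Dsin2 p.2) mulr1 addrC cos2Dsin2.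
Qed.

Definition spherical (p : R * R) : sphere := Sphere (spherical_row_norm p).

HB.instance Definition _ := isPointed.Build sphere (spherical (0, 0)).

End sphere.
Arguments sphere_coord {R}.

(* The sigma-algebra on the sphere is the one generated by the coordinates,
   that is, the trace of the Borel sigma-algebra of R^3. *)
Definition sphere_display : measure_display. Proof. exact. Qed.

Section sphere_measurable.
Variable R : realType.

Let sphere_set0 : g_sigma_preimage (@sphere_coord R) set0.
Proof. exact: sigma_algebra0. Qed.

Let sphere_setC A :
  g_sigma_preimage (@sphere_coord R) A ->
  g_sigma_preimage (@sphere_coord R) (~` A).
Proof. exact: sigma_algebraC. Qed.

Let sphere_bigcup (F : (set (sphere R))^nat) :
  (forall i, g_sigma_preimage (@sphere_coord R) (F i)) ->
  g_sigma_preimage (@sphere_coord R) (\bigcup_i (F i)).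
Proof. exact: sigma_algebra_bigcup. Qed.

HB.instance Definition _ := @isMeasurable.Build sphere_display
  (sphere R) (g_sigma_preimage (@sphere_coord R)) sphere_set0 sphere_setC
  sphere_bigcup.

End sphere_measurable.

Section sphere_measure.
Variable R : realType.
Local Notation leb := (@lebesgue_measure R).

Definition angles : set (R * R) := `[0, pi] `*` `[0, pi *+ 2].

(* d mu = (4 pi)^-1 sin(theta) d theta d phi. *)
Definition sphere_measure (A : set (sphere R)) : \bar R :=
  (\int[leb \x leb]_(p in angles `&` @spherical R @^-1` A)
     (sin p.1 / (pi *+ 4))%:E)%E.

Lemma measurable_angles : measurable angles.
Proof. exact: measurableX. Qed.

Lemma measurable_spherical : measurable_fun setT (@spherical R).
Proof.
apply: (@measurability _ _ _ _ setT (@spherical R)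
  (\big[setU/set0]_(i < 3)
     preimage_set_system setT (@sphere_coord R i) measurable)).
  by [].
move=> _ [B + <-]; rewrite -bigcup_mkord_ord => -[i /= i3 [C mC <-]].
rewrite !setTI -comp_preimage -[X in measurable X]setTI.
suff mi : measurable_fun setT (sphere_coord (inord i) \o @spherical R)
  by exact: mi.
have -> : sphere_coord (inord i) \o @spherical R =
    fun p : R * R => [:: sin p.1 * cos p.2; sin p.1 * sin p.2; cos p.1]`_i.
  by apply/funext => p; rewrite /sphere_coord/= mxE inordK.
have mcos : measurable_fun setT (@cos R).
  by apply: continuous_measurable_fun; exact: continuous_cos.
have msin : measurable_fun setT (@sin R).
  by apply: continuous_measurable_fun; exact: continuous_sin.
case: i i3 => [|[|[|//]]] _ /=.
- by apply: measurable_funM; exact: measurableT_comp.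
- by apply: measurable_funM; exact: measurableT_comp.
- exact: measurableT_comp.
Qed.

Let density_ge0 (p : R * R) : angles p -> 0 <= sin p.1 / (pi *+ 4).
Proof.
case=> /=; rewrite !in_itv/= => p1 _.
by rewrite divr_ge0 ?sin_ge0_pi// mulrn_wge0// pi_ge0.
Qed.

Let measurable_density (D : set (R * R)) :
  measurable_fun D (EFin \o (fun p : R * R => sin p.1 / (pi *+ 4) : R)).
Proof.
apply: measurable_funTS; apply: measurableT_comp => //.
apply: measurable_funM => //; apply: measurableT_comp => //.
by apply: continuous_measurable_fun; exact: continuous_sin.
Qed.

Let sphere_measure0 : sphere_measure set0 = 0%E.
Proof. by rewrite /sphere_measure preimage_set0 setI0 integral_set0. Qed.

Let sphere_measure_ge0 A : (0 <= sphere_measure A)%E.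
Proof. by apply: integral_ge0 => p [/density_ge0 p0 _]; rewrite lee_fin. Qed.

Let mangles A : measurable A -> measurable (angles `&` @spherical R @^-1` A).
Proof.
move=> mA; apply: measurableI; first exact: measurable_angles.
by rewrite -[X in measurable X]setTI; exact: measurable_spherical.
Qed.

Let sphere_measure_sigma_additive : semi_sigma_additive sphere_measure.
Proof.
move=> F mF tF mUF; rewrite /sphere_measure; apply: cvg_toP.
  apply: ereal_nondecreasing_is_cvgn => m n mn.
  by apply: lee_sum_nneg_natr => // k _ _; exact: sphere_measure_ge0.
rewrite preimage_bigcup setI_bigcupr ge0_integral_bigcup//=.
- by move=> n; exact: mangles.
- exact: measurable_density.
- by move=> p [n _ [/density_ge0 p0 _]]; rewrite lee_fin.
- apply/trivIsetP => i j _ _ ij; rewrite setIACA setIid -preimage_setI.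
  by move/trivIsetP : tF => /(_ i j Logic.I Logic.I ij) ->;
    rewrite preimage_set0 setI0.
Qed.

HB.instance Definition _ := isMeasure.Build _ _ _ sphere_measure
  sphere_measure0 sphere_measure_ge0 sphere_measure_sigma_additive.

Let sphere_measureT : sphere_measure setT = 1%E.
Proof.
rewrite /sphere_measure preimage_setT setIT integral_mkcond.
rewrite fubini_tonelli1//=; last 2 first.
- apply/(measurable_restrictT _ measurable_angles).
  exact: measurable_density.
- move=> p; rewrite patchE; case: ifPn => // /set_mem/density_ge0.
  by rewrite lee_fin.
have pi2 : 0 < pi *+ 2 :> R by rewrite mulrn_wgt0// pi_gt0.
transitivity (\int[leb]_(x in `[0%R, pi]) (sin x / 2)%:E)%E; last first.
  have dF (x : R) : is_derive x 1 (fun x => - cos x / 2 : R) (sin x / 2).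
    apply: is_derive_eq; rewrite /GRing.scale/=; lra.
  have cF : continuous (fun x => - cos x / 2 : R).
    by move=> x; apply/differentiable_continuous/derivable1_diffP.
  rewrite (@continuous_FTC2 _ _ (fun x => - cos x / 2 : R)).
  - by rewrite -EFinB cospi cos0; congr EFin; lra.
  - exact: pi_gt0.
  - apply: continuous_subspaceT => x; apply: cvgMr_tmp; exact: continuous_sin.
  - split; first by move=> x _.
    + exact/cvg_at_right_filter/cF.
    + exact/cvg_at_left_filter/cF.
  - by move=> x _; rewrite derive1E derive_val.
rewrite [RHS]integral_mkcond; apply: eq_integral => x _.
rewrite /fubini_F [RHS]patchE; case: ifPn => [/set_mem x0|/negP x0].
  transitivity (\int[leb]_(y in `[0%R, (pi *+ 2)%R]) (sin x / (pi *+ 4))%:E)%E.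
    rewrite [RHS]integral_mkcond; apply: eq_integral => y _.
    rewrite !patchE; congr (if _ then _ else _).
    by rewrite in_setX (mem_set x0).
  rewrite integral_cst//= lebesgue_measure_itv/= lte_fin pi2.
  rewrite sube0 -EFinM; congr EFin.
  have : pi != 0 :> R by rewrite gt_eqF// pi_gt0.
  by move: (@pi R) => q q0; field.
apply: integral0_eq => y _; rewrite patchE; case: ifPn => // /set_mem [/= x1 _].
by case: x0; apply/mem_set.
Qed.

HB.instance Definition _ :=
  Measure_isProbability.Build _ _ _ sphere_measure sphere_measureT.

End sphere_measure.

Section spherical_harmonics.
Variable R : realType.
Implicit Types (x : sphere R) (l : nat) (m : int).

Definition colatitude x : R := acos (sphere_coord (inord 2) x).

(* The longitude in [0, 2 pi[ (its value at the two poles is immaterial). *)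
Definition longitude x : R :=
  let x0 := sphere_coord (inord 0) x in
  let x1 := sphere_coord (inord 1) x in
  let a := acos (x0 / Num.sqrt (x0 ^+ 2 + x1 ^+ 2)) in
  if 0 <= x1 then a else pi *+ 2 - a.

(* Rodrigues' formula. *)
Definition legendre l : {poly R} :=
  (2 ^+ l * l`!%:R)^-1 *: (('X^2 - 1) ^+ l)^`(l).

Definition assoc_legendre_nat l (m : nat) (z : R) : R :=
  (-1) ^+ m * Num.sqrt (1 - z ^+ 2) ^+ m * (legendre l)^`(m).[z].

(* P_l^m for - l <= m <= l, with the Condon-Shortley phase;
   P_l^{-k} = (-1)^k (l - k)! / (l + k)! P_l^k. *)
Definition assoc_legendre l m (z : R) : R :=
  match m with
  | Posz k => assoc_legendre_nat l k z
  | Negz k => (-1) ^+ k.+1 * ((l - k.+1)%N`!%:R / (l + k.+1)%N`!%:R)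
              * assoc_legendre_nat l k.+1 z
  end.

Definition sph_harm l m x : R[i] :=
  (Num.sqrt (l.*2.+1%:R * ((absz (l%:Z - m))`!%:R / (absz (l%:Z + m))`!%:R))
   * assoc_legendre l m (cos (colatitude x)))%:C
  * (cos (m%:~R * longitude x) +i* sin (m%:~R * longitude x)).

Definition sum_m (V : nmodType) l (F : int -> V) : V :=
  \sum_(k < l.*2.+1) F (k%:Z - l%:Z).

Definition Cintegral d (T : measurableType d) (nu : set T -> \bar R)
    (D : set T) (f : T -> R[i]) : R[i] :=
  fine (\int[nu]_(y in D) (complex.Re (f y))%:E)
  +i* fine (\int[nu]_(y in D) (complex.Im (f y))%:E).

Definition Cintegrable d (T : measurableType d)
    (nu : {measure set T -> \bar R}) (D : set T) (f : T -> R[i]) : Prop :=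
  nu.-integrable D (fun y => (complex.Re (f y))%:E) /\
  nu.-integrable D (fun y => (complex.Im (f y))%:E).

Definition fourier_coef (f : sphere R -> R) l m : R[i] :=
  Cintegral (@sphere_measure R) setT
    (fun x => (f x)%:C * conjc (sph_harm l m x)).

Definition lambda l : R := (l * l.+1)%N%:R.

(* Here 0 `^ 0 = 1, so that (- Delta)^0 = I. *)
Definition psi (alpha gamma t : R) : R :=
  t `^ (alpha / 2) * (1 + t) `^ (gamma / 2).

End spherical_harmonics.

Section riemann_stieltjes.
Variable R : realType.

Definition is_RS_integral (f g : R -> R) (a b I : R) : Prop :=
  forall e : R, 0 < e -> exists2 delta : R, 0 < delta &
    forall (s : seq R) (xi : nat -> R),
      let x := nth b (a :: s) in
      itv_partition a b s ->
      (forall k, (k < size s)%N ->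
         x k <= xi k <= x k.+1 /\ x k.+1 - x k < delta) ->
      `| \sum_(k < size s) f (xi k) * (g (x k.+1) - g (x k)) - I | < e.

Definition RS_integral (f g : R -> R) (a b : R) : R :=
  get [set I | is_RS_integral f g a b I].

End riemann_stieltjes.

Section random_fields.
Context d (Omega : measurableType d) (R : realType) (P : probability Omega R).
Local Notation S2 := (sphere R).
Local Notation mu := (@sphere_measure R).
Local Notation leb := (@lebesgue_measure R).

(* Constant random variables are degenerate Gaussians. *)
Definition gaussian_rv (X : Omega -> R) : Prop :=
  measurable_fun setT X /\
  exists m s : R, forall B : set R, measurable B ->
    P (X @^-1` B) = if s == 0 then \d_m B else normal_prob m s B.

(* The finite-dimensional distributions of X on D are Gaussian: every linear
   combination of finitely many of the X i is Gaussian. *)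
Definition gaussian_family (I : Type) (D : set I) (X : I -> Omega -> R) :
    Prop :=
  forall (n : nat) (i : 'I_n -> I) (c : 'I_n -> R), (forall k, D (i k)) ->
    gaussian_rv (fun w => \sum_(k < n) c k * X (i k) w).

Definition half_line : set R := [set t | 0 <= t].

(* The paths are almost surely continuous, as is needed for pathwise
   Riemann-Stieltjes integrals against them. *)
Definition is_fbm (H sigma2 : R) (beta : R -> Omega -> R) : Prop :=
  [/\ gaussian_family half_line beta,
      forall t, 0 <= t -> ('E_P[beta t] = 0)%E,
      {ae P, forall w, beta 0 w = 0},
      forall s t : R, 0 <= s -> 0 <= t ->
        ('E_P[(fun w => `|beta t w - beta s w| ^+ 2)%R] =
          (`|t - s| `^ (2 * H) * sigma2)%:E)%E
    & {ae P, forall w, {within half_line, continuous (beta ^~ w)}}].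

Definition sigma_of (X : R -> Omega -> R) : set (set Omega) :=
  <<s [set E | exists t B, [/\ 0 <= t, measurable B & E = X t @^-1` B] ]>>.

Definition independent_processes (I : eqType) (D : set I)
    (X : I -> R -> Omega -> R) : Prop :=
  forall (s : seq I) (E : I -> set Omega), uniq s ->
    (forall i, i \in s -> D i /\ sigma_of (X i) (E i)) ->
    P (\bigcap_(i in [set` s]) E i) = (\prod_(i <- s) fine (P (E i)))%:E.

Definition random_field (T : Omega -> S2 -> R) : Prop :=
  measurable_fun setT (fun p : Omega * S2 => T p.1 p.2).

Definition centered (T : Omega -> S2 -> R) : Prop :=
  forall x, ('E_P[T ^~ x] = 0)%E.

Definition is_rotation (g : 'M[R]_3) : Prop := g *m g^T = 1%:M /\ \det g = 1.

Definition weakly_isotropic2 (T : Omega -> S2 -> R) : Prop :=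
  (forall x, 'E_P[(fun w => `|T w x| ^+ 2)%R] < +oo)%E /\
  forall (g : 'M[R]_3) (x y gx gy : S2), is_rotation g ->
    sphere_val gx = sphere_val x *m g -> sphere_val gy = sphere_val y *m g ->
    ('E_P[T ^~ gx] = 'E_P[T ^~ x])%E /\
    ('E_P[(fun w => T w gx * T w gy)%R] = 'E_P[(fun w => T w x * T w y)%R])%E.

Definition gaussian_field (T : Omega -> S2 -> R) : Prop :=
  gaussian_family setT (fun x w => T w x).

Definition L2_field (f : Omega -> S2 -> R) : Prop :=
  random_field f /\
  (\int[P \x mu]_p (`|f p.1 p.2| ^+ 2)%:E < +oo)%E.

Definition L2_sum (F : nat -> Omega -> S2 -> R[i]) (f : Omega -> S2 -> R) :
    Prop :=
  L2_field f /\
  (\int[P \x mu]_p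
     (ComplexField.Normc.normc
        (\sum_(l < n) F l p.1 p.2 - (f p.1 p.2)%:C)%R ^+ 2)%:E
     @[n --> \oo] --> 0)%E.

Definition fourier (T : Omega -> S2 -> R) (l : nat) (m : int) (w : Omega) :
  R[i] := fourier_coef (T w) l m.

Definition real_harmonics (A : nat -> R) (c1 c2 : nat -> nat -> Omega -> R)
    (l : nat) (w : Omega) (x : S2) : R[i] :=
  (Num.sqrt (A l))%:C *
  ((c1 l 0 w)%:C * sph_harm l 0 x +
   (Num.sqrt 2)%:C *
   \sum_(1 <= m < l.+1) ((c1 l m w)%:C * (complex.Re (sph_harm l m x))%:C
                       + (c2 l m w)%:C * (complex.Im (sph_harm l m x))%:C)).

(* (false, l, m) indexes beta^1_{l m} (0 <= m <= l) and
   (true, l, m) indexes beta^2_{l m} (1 <= m <= l). *)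
Definition fbm_index : set (bool * nat * nat) :=
  [set i : bool * nat * nat | (i.1.1 <= i.2 <= i.1.2)%N].

Definition is_sphere_fbm (H : R) (A : nat -> R)
    (beta1 beta2 : nat -> nat -> R -> Omega -> R) (B : R -> Omega -> S2 -> R) :
    Prop :=
  let beta (i : bool * nat * nat) :=
    (if i.1.1 then beta2 else beta1) i.1.2 i.2 in
  [/\ forall l, 0 < A l,
      cvgn (series (fun l => l.*2.+1%:R * A l)),
      forall i, fbm_index i -> is_fbm H 1 (beta i),
      independent_processes fbm_index beta
    & forall t, 0 <= t ->
        L2_sum (real_harmonics A (fun l m => beta1 l m t)
                                 (fun l m => beta2 l m t)) (B t)].

Definition cauchy_term (alpha gamma : R) (T0 : Omega -> S2 -> R) (t : R)
    (l : nat) (w : Omega) (x : S2) : R[i] :=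
  sum_m l (fun m => (expR (- psi alpha gamma (lambda R l) * t))%:C
                    * fourier T0 l m w * sph_harm l m x).

Definition is_cauchy_solution (alpha gamma : R) (T0 : Omega -> S2 -> R)
    (u : R -> Omega -> S2 -> R) : Prop :=
  forall t, 0 <= t -> L2_sum (cauchy_term alpha gamma T0 t) (u t).

Definition L2_process (X : R -> Omega -> S2 -> R) : Prop :=
  measurable_fun [set p : R * Omega * S2 | 0 <= p.1.1]
    (fun p : R * Omega * S2 => X p.1.1 p.1.2 p.2) /\
  forall t, 0 <= t -> L2_field (X t).

(* X(t) = X0 - \int_0^t psi(- Delta) X(s) ds + B(t), read off on Fourier
   coefficients; fields are only defined in L_2(Omega * S^2), so the null set
   may depend on l, m and t, and the path integral has to exist. *)
Definition is_solution (alpha gamma : R) (X0 : Omega -> S2 -> R)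
    (B : R -> Omega -> S2 -> R) (X : R -> Omega -> S2 -> R) : Prop :=
  forall (l : nat) (m : int) (t : R), (absz m <= l)%N -> 0 <= t ->
    {ae P, forall w,
      Cintegrable leb `[0, t] (fun s => fourier (X s) l m w) /\
      fourier (X t) l m w =
        fourier X0 l m w
        - (psi alpha gamma (lambda R l))%:C
          * Cintegral leb `[0, t] (fun s => fourier (X s) l m w)
        + fourier (B t) l m w}.

Definition ou_integral (alpha gamma : R) (l : nat) (beta : R -> Omega -> R)
    (t : R) (w : Omega) : R :=
  RS_integral (fun s => expR (- psi alpha gamma (lambda R l) * (t - s)))
    (beta ^~ w) 0 t.

Definition solution_term (alpha gamma : R) (A : nat -> R)
    (beta1 beta2 : nat -> nat -> R -> Omega -> R) (T0 : Omega -> S2 -> R)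
    (t0 t : R) (l : nat) (w : Omega) (x : S2) : R[i] :=
  sum_m l (fun m => (expR (- psi alpha gamma (lambda R l) * (t + t0)))%:C
                    * fourier T0 l m w * sph_harm l m x)
  + real_harmonics A
      (fun l m => ou_integral alpha gamma l (beta1 l m) t)
      (fun l m => ou_integral alpha gamma l (beta2 l m) t) l w x.

End random_fields.

(* Main.v *)
(* Everything is read off on coefficients in a real orthonormal basis of spherical
   harmonics, indexed by (b, l, m).  There the equation decouples into the scalar
   equations x(t) = x(0) - a int_0^t x + r beta(t) with a = psi(lambda_l), whose
   solution exp(-a t) x(0) + r (beta(t) - a int_0^t exp(-a (t - s)) beta(s) ds) is,
   after an integration by parts, the Riemann-Stieltjes formula.
   Existence: E beta(s)^2 = s^{2H} and Jensen's inequality bound the second moment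
   of the stochastic convolution by 4 t^{2H}, so that the coefficients are square
   summable; partial sums along a subsequence that does not depend on t then
   converge almost everywhere, which makes the limit jointly measurable.
   Uniqueness: for each t the difference D of two coefficients satisfies
   D(t) = - a int_0^t D almost surely; by Fubini this holds almost surely for
   almost every t, hence int_0^t D = 0 and D(t) = 0.  Completeness of the spherical
   harmonics turns equality of coefficients into equality in L_2. *)
From HB Require Import structures.
Require Import Defs.
From mathcomp Require Import all_boot all_order all_algebra.
From mathcomp Require Import all_classical all_reals all_analysis.
From mathcomp Require Import measurable_realfun complex ring lra zify.
Set Implicit Arguments.
Unset Strict Implicit.
Unset Printing Implicit Defensive.
Import Order.TTheory GRing.Theory Num.Theory.
Import numFieldNormedType.Exports.
Local Open Scope classical_set_scope.
Local Open Scope ring_scope.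
Local Open Scope complex_scope.

(** * Legendre polynomials *)

(** Three obstacles shape the development. The series formula contains Riemann-Stieltjes integrals
    chosen by [get], about whose measurability nothing is known where the paths are irregular.
    Comparisons are therefore made off one measurable null set, through an identity of integrals
    that asks for no measurability ([ge0_integral_eq_off]), and the fBms are replaced by
    modifications with continuous paths. The null set in [is_solution] may depend on [t], so the
    equation need not hold along a fixed path for all times, and an ODE argument does not apply path
    by path. The joint measurability in [L2_process] is what lets null sets be exchanged between
    time and chance ([ae_swap]). The harmonics are given by Rodrigues' formula only. Orthogonality
    comes from formal integration of polynomials over [-1, 1]. For completeness, a function with
    vanishing coefficients is tested against a class stable under multiplication by coordinates and
    bounded limits; polynomial approximations of the sign function bring the indicators of all
    measurable sets into that class. *)

Section poly_integral.
Variable R : realFieldType.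
Implicit Types p q : {poly R}.

Lemma size_deriv_char0 p : size p^`() = (size p).-1.
Proof.
have [->|p0] := eqVneq p 0; first by rewrite deriv0 size_poly0.
have [p1|p1] := leqP (size p) 1.
  by rewrite (size1_polyC p1) derivC size_poly0 size_polyC; case: (_ == _).
rewrite /deriv; apply: size_poly_eq.
have sp : (size p).-2.+1 = (size p).-1 by lia.
rewrite sp -mulr_natr mulf_neq0 ?pnatr_eq0//; last by lia.
by rewrite -lead_coefE lead_coef_eq0.
Qed.

Lemma size_derivn_char0 p n : size p^`(n) = (size p - n)%N.
Proof.
elim: n => [|n IH]; first by rewrite derivn0 subn0.
by rewrite derivnS size_deriv_char0 IH subnS.
Qed.

Lemma derivn_derivn p m n : p^`(m)^`(n) = p^`(m + n).
Proof.
by elim: n => [|n IH]; rewrite ?addn0// addnS derivnS IH.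
Qed.

Definition primp p : {poly R} := \poly_(i < (size p).+1) (p`_i.-1 / i%:R).

Lemma deriv_primp p : (primp p)^`() = p.
Proof.
apply/polyP => i; rewrite coef_deriv coef_poly ltnS.
case: ltnP => [ip|ip]; last by rewrite mul0rn nth_default.
by rewrite -[i.+1.-1]/i -[LHS]mulr_natr divfK// pnatr_eq0.
Qed.

(** The integral of [p] over [-1, 1], taken through the formal antiderivative so that the Legendre
    relations stay pure algebra; [Rintegral_colatitude] links it to the Lebesgue integral. *)
Definition intp p : R := (primp p).[1] - (primp p).[-1].

(** In characteristic 0 a polynomial with zero derivative is constant, so [q] and the formal
    antiderivative of its derivative differ by a constant. *)
Lemma intp_deriv q : intp (q^`()) = q.[1] - q.[-1].
Proof.
have /size1_polyC e : (size (primp (q^`()) - q)%R <= 1)%N.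
  by rewrite -subn_eq0 subn1 -size_deriv_char0 derivB deriv_primp subrr size_poly0.
have /eqP : (primp (q^`()) - q).[1] = (primp (q^`()) - q).[-1] by rewrite e !hornerC.
by rewrite /intp !hornerD !hornerN => /eqP; lra.
Qed.

Lemma intpD p q : intp (p + q) = intp p + intp q.
Proof.
rewrite -{1}(deriv_primp p) -{1}(deriv_primp q) -derivD intp_deriv /intp !hornerD.
lra.
Qed.

Lemma intpZ c p : intp (c *: p) = c * intp p.
Proof. by rewrite -{1}(deriv_primp p) -derivZ intp_deriv /intp !hornerZ mulrBr. Qed.

Lemma intpB p q : intp (p - q) = intp p - intp q.
Proof. by rewrite intpD -scaleN1r intpZ mulN1r. Qed.

Lemma intp_parts p q : p.[1] * q.[1] = 0 -> p.[-1] * q.[-1] = 0 ->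
  intp (p^`() * q) = - intp (p * q^`()).
Proof.
move=> e1 e2; apply/eqP; rewrite -addr_eq0 -intpD -derivM intp_deriv !hornerM.
by rewrite e1 e2 subrr.
Qed.

End poly_integral.

Section legendre.
Variable R : realType.
Local Notation w l := (('X^2 - 1 : {poly R}) ^+ l).
Local Notation leg l m := ((legendre R l)^`(m)).

(** Differentiate [(X^2 - 1) w' = 2 l X w] exactly [k + 1] times. *)
Lemma deriv_w_ode l k : ('X^2 - 1) * (w l)^`(k.+2) =
  ((l.*2)%:R - (k.+1.*2)%:R) *: ('X * (w l)^`(k.+1))
  + ((l.*2 * k.+1)%:R - (k * k.+1)%:R) *: (w l)^`(k).
Proof.
elim: k => [|k IH].
  have H : ('X^2 - 1) * (w l)^`(1) = (l.*2)%:R *: ('X * w l).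
    rewrite derivn1 deriv_exp derivB derivXn derivC subr0 expr1.
    case: l => [|l]; first by rewrite !mulr0n scale0r mulr0.
    rewrite [l.+1.-1]/= [_ ^+ l.+1]exprS -mul_polyC polyC_natr -muln2.
    by move: (_ ^+ l) => a; ring.
  have := congr1 (@deriv R) H.
  rewrite derivM derivZ derivM derivB derivXn derivX derivC subr0 -!derivnS derivn1.
  move/(canRL (addKr _)) => ->; rewrite derivn0 -!mul_polyC /=.
  rewrite !polyCB !polyC_natr; move: ((w l)^`()) (w l) => a b.
  rewrite mul0n muln1 -!muln2; ring.
have := congr1 (@deriv R) IH.
rewrite derivM [(_ *: _ + _)^`()]derivD !derivZ derivM derivB derivXn derivX.
rewrite derivC subr0 -!derivnS.
move/(canRL (addKr _)) => ->; rewrite -!mul_polyC.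
rewrite !polyCB !polyC_natr; move: ((w l)^`(k.+2)) ((w l)^`(k.+1)) => a b.
rewrite -!muln2; ring.
Qed.

(** This is [deriv_w_ode] at [k = l + m], by Rodrigues' formula. *)
Lemma leg_ode l m : ('X^2 - 1) * leg l m.+2 =
  - (m.+1.*2)%:R *: ('X * leg l m.+1)
  + ((l + m.+1)%:R * (l%:R - m%:R)) *: leg l m.
Proof.
rewrite /legendre !derivnZ !derivn_derivn !addnS.
rewrite -scalerAr deriv_w_ode scalerDr -!scalerAr !scalerA.
congr (_ + _).
  by congr (_ *: _); rewrite mulrC; congr (_ * _); rewrite -!muln2; ring.
by congr (_ *: _); rewrite mulrC; congr (_ * _); rewrite -!muln2; ring.
Qed.

(** Legendre's equation in Sturm-Liouville form. It makes an integration by parts lower [m] by one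
    in [legipS], where the weight [(1 - X^2)^(m+1)] kills the boundary terms. *)
Lemma deriv_weighted_leg l m :
  ((1 - 'X^2) ^+ m.+1 * leg l m.+1)^`() =
  - ((l + m.+1)%:R * (l%:R - m%:R)) *: ((1 - 'X^2) ^+ m * leg l m).
Proof.
rewrite derivM deriv_exp derivB derivXn derivC sub0r expr1 [m.+1.-1]/= -derivnS.
rewrite [_ ^+ m.+1]exprS.
have H : (1 - 'X^2) * leg l m.+2 = (m.+1.*2)%:R *: ('X * leg l m.+1)
    - ((l + m.+1)%:R * (l%:R - m%:R)) *: leg l m.
  by rewrite -opprB mulNr leg_ode scaleNr; ring.
rewrite [(1 - 'X^2) * _ ^+ _]mulrC -[_ * (1 - 'X^2) * _]mulrA H.
move: (_ * (l%:R - m%:R)) => c; rewrite -!mul_polyC.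
rewrite polyCN polyC_natr -muln2.
by move: (_ ^+ m) (leg l m) (leg l m.+1) => a b e; ring.
Qed.

(** The inner product on [-1, 1] of the associated Legendre functions of order [m] and degrees [k]
    and [l]: their factors [(1 - z^2)^(m/2)] multiply to a polynomial and their signs cancel. *)
Definition legip m k l := intp ((1 - 'X^2) ^+ m * leg k m * leg l m).

Lemma legipS m k l :
  legip m.+1 k l = (k + m.+1)%:R * (k%:R - m%:R) * legip m k l.
Proof.
have := @intp_parts R ((1 - 'X^2) ^+ m.+1 * leg k m.+1) (leg l m).
rewrite deriv_weighted_leg -derivnS -scalerAl intpZ /legip !mulNr => H.
have /= := H _ _; move/(_ _ _)/esym/eqP; rewrite eqr_opp => /(_ _ _)/eqP -> //.
  by rewrite !hornerE expr1n subrr expr0n/= !mul0r.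
by rewrite !hornerE sqrrN expr1n subrr expr0n/= !mul0r.
Qed.

Lemma legipC m k l : legip m k l = legip m l k.
Proof. by rewrite /legip mulrAC. Qed.

(** Each derivative removes only one factor [X^2 - 1]. This makes all boundary terms vanish in
    [intp_w_parts]. *)
Lemma w_deriv_root l k (z : R) : (k < l)%N -> z ^+ 2 = 1 -> ((w l)^`(k)).[z] = 0.
Proof.
move=> kl z2; suff [q ->] : exists q : {poly R}, (w l)^`(k) = (w (l - k)) * q.
  rewrite hornerM horner_exp !hornerE z2 subrr expr0n.
  by rewrite subn_eq0 leqNgt kl mul0r.
elim: k kl => [|k IH] kl; first by exists 1; rewrite subn0 mulr1.
have [|q Hq] := IH; first exact: ltnW.
rewrite derivnS Hq derivM deriv_exp.
have -> : (l - k = (l - k.+1).+1)%N by lia.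
rewrite [_.+1.-1]/= [_ ^+ (l - k.+1).+1]exprS -mulr_natr.
exists (('X^2 - 1)^`() * (l - k.+1).+1%:R * q + ('X^2 - 1) * q^`()).
by move: (_ ^+ (l - _)) => a; ring.
Qed.

Lemma intp_w_parts l q k : (k <= l)%N ->
  intp ((w l)^`(l) * q) = (-1) ^+ k * intp ((w l)^`(l - k) * q^`(k)).
Proof.
elim: k => [|k IH] kl; first by rewrite subn0 derivn0 mul1r.
rewrite IH ?(ltnW kl)//.
have -> : (l - k = (l - k.+1).+1)%N by lia.
rewrite derivnS intp_parts -?derivnS.
- by rewrite mulrN [in RHS]exprS mulN1r mulNr.
- by rewrite w_deriv_root ?mul0r ?expr1n//; lia.
- by rewrite w_deriv_root ?mul0r ?sqrrN ?expr1n//; lia.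
Qed.

Lemma monic_X21 : ('X^2 - 1 : {poly R}) \is monic.
Proof. by rewrite -polyC1 monicXnsubC. Qed.

Lemma monic_w l : w l \is monic.
Proof. exact/monic_exp/monic_X21. Qed.

Lemma size_w l : size (w l) = l.*2.+1.
Proof.
have e : size ('X^2 - 1 : {poly R}) = 3 by rewrite -polyC1 size_XnsubC.
by rewrite polySpred ?monic_neq0 ?monic_w// size_exp e mul2n.
Qed.

Lemma deriv_w_top l : (w l)^`(l.*2) = (l.*2)`!%:R%:P.
Proof.
have s1 : (size ((w l)^`(l.*2))%R <= 1)%N.
  by rewrite size_derivn_char0 size_w subSnn.
rewrite (size1_polyC s1) coef_derivn addn0 ffactnn.
have := monicP (monic_w l); rewrite lead_coefE size_w /= => ->.
by [].
Qed.

Definition beta_w l : R := intp ((1 - 'X^2) ^+ l).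

(** A Wallis recursion: integrate [1 = X'] against [(1 - X^2)^(l+1)] by parts. *)
Lemma beta_wS l : (l.*2.+3)%:R * beta_w l.+1 = (l.*2.+2)%:R * beta_w l.
Proof.
have := @intp_parts R ('X) ((1 - 'X^2) ^+ l.+1).
rewrite !horner_exp !hornerE sqrrN expr1n subrr expr0n/= mulr0 => /(_ erefl erefl).
rewrite derivX mul1r -/(beta_w l.+1).
have -> : 'X * ((1 - 'X^2) ^+ l.+1)^`() =
    (l.*2.+2)%:R *: (((1 - 'X^2) ^+ l.+1) - ((1 - 'X^2) ^+ l)) :> {poly R}.
  rewrite deriv_exp derivB derivXn derivC sub0r expr1 [l.+1.-1]/=.
  rewrite [_ ^+ l.+1]exprS -mul_polyC polyC_natr -muln2.
  by move: (_ ^+ l) => a; ring.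
by rewrite intpZ intpB -!/(beta_w _) -!muln2; lra.
Qed.

Lemma beta_w0 : beta_w 0 = 2.
Proof.
by rewrite /beta_w expr0 -[1 in LHS]derivX intp_deriv !hornerX; lra.
Qed.

Lemma beta_wE l : beta_w l * (l.*2.+1)`!%:R = (2 ^+ l * l`!%:R) ^+ 2 * 2.
Proof.
elim: l => [|l IH]; first by rewrite beta_w0 (_ : (0.*2.+1)`! = 1%N)// fact0 expr0; lra.
have -> : (l.+1.*2.+1)`! = (l.*2.+3 * (l.*2.+2 * (l.*2.+1)`!))%N by rewrite !factS.
rewrite [l.+1`!]factS [in LHS]natrM [in LHS]natrM [in RHS]natrM [2 ^+ l.+1]exprS.
move: IH; move: ((l.*2.+1)`!%:R : R) (l`!%:R : R) => F G IH.
transitivity (l.*2.+3%:R * beta_w l.+1 * l.*2.+2%:R * F); first ring.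
rewrite beta_wS.
transitivity (l.*2.+2%:R ^+ 2 * (beta_w l * F)); first ring.
by rewrite IH; move: (_ ^+ l) => a; rewrite -muln2; ring.
Qed.

(** Moving the [l] derivatives of Rodrigues' formula onto a polynomial of degree [k < l] annihilates
    it. *)
Lemma legip0_lt k l : (k < l)%N -> legip 0 k l = 0.
Proof.
move=> kl; rewrite legipC /legip mul1r /legendre !derivn0 -scalerAl intpZ.
rewrite (intp_w_parts _ (leqnn l)) subnn.
rewrite derivnZ derivn_derivn (_ : (_)^`(k + l) = 0) ?scaler0 ?mulr0.
  by rewrite -[X in intp X](scale0r 0) intpZ mul0r !mulr0.
by apply/eqP; rewrite -size_poly_eq0 size_derivn_char0 size_w; apply/eqP; lia.
Qed.

Lemma legip0_diag l : legip 0 l l = 2 / l.*2.+1%:R.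
Proof.
rewrite /legip mul1r /legendre !derivn0 -scalerAl intpZ.
rewrite (intp_w_parts _ (leqnn l)) subnn derivnZ derivn_derivn addnn deriv_w_top.
have -> (a b : R) : (w l)^`(0) * (a *: b%:P) = (a * b) *: w l.
  by rewrite derivn0 -mul_polyC -polyCM mulrC mul_polyC.
rewrite intpZ.
have -> : w l = (-1) ^+ l *: ((1 - 'X^2) ^+ l) :> {poly R}.
  by rewrite -[_ - 1]opprB -scaleN1r exprZn.
rewrite intpZ -/(beta_w l).
have : (l.*2.+1)`!%:R != 0 :> R by rewrite pnatr_eq0 -lt0n fact_gt0.
have := beta_wE l; rewrite factS natrM mulf_eq0 negb_or => bE /andP[h1 h2].
have -> : beta_w l = (2 ^+ l * l`!%:R) ^+ 2 * 2 / (l.*2.+1%:R * (l.*2)`!%:R).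
  by rewrite -bE mulfK// mulf_neq0.
have s1 : (-1) ^+ l * (-1) ^+ l = 1 :> R by rewrite -expr2 sqrr_sign.
have c0 : 2 ^+ l * l`!%:R != 0 :> R.
  by rewrite mulf_neq0 ?expf_neq0 ?pnatr_eq0// -lt0n fact_gt0.
transitivity ((-1) ^+ l * (-1) ^+ l * (2 / (l.*2.+1%:R)) : R); last by rewrite s1 mul1r.
move: c0 h1 h2; move: (2 ^+ l * _) (l.*2.+1%:R : R) ((l.*2)`!%:R : R)
  ((-1) ^+ l : R) => a b c e a0 b0 c0.
by field; rewrite a0 b0 c0.
Qed.

(** On the diagonal [legipS] multiplies by [(l + m + 1) (l - m)], which builds up the quotient of
    factorials. *)
Lemma legip_diag m l : (m <= l)%N ->
  legip m l l = 2 / l.*2.+1%:R * ((l + m)`!%:R / (l - m)`!%:R).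
Proof.
have f0 n : n`!%:R != 0 :> R by rewrite pnatr_eq0 -lt0n fact_gt0.
elim: m => [|m IH] ml; first by rewrite addn0 subn0 divff// mulr1 legip0_diag.
rewrite legipS IH ?(ltnW ml)// addnS factS.
have -> : (l - m = (l - m.+1).+1)%N by lia.
rewrite factS -natrB ?(ltnW ml)//.
have -> : (l - m = (l - m.+1).+1)%N by lia.
rewrite !natrM; move: (f0 (l - m.+1)%N) => h.
have h2 : (l - m.+1).+1%:R != 0 :> R by rewrite pnatr_eq0.
have h3 : l.*2.+1%:R != 0 :> R by rewrite pnatr_eq0.
move: h h2 h3; move: (_`!%:R) (_`!%:R) (_.+1%:R) (_.+1%:R) => a b c e a0 b0 c0.
by field; rewrite a0 b0 c0.
Qed.

Lemma legip_neq m k l : k <> l -> legip m k l = 0.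
Proof.
move=> kl; elim: m => [|m IH]; last by rewrite legipS IH mulr0.
have [?|?|//] := ltngtP k l; first exact: legip0_lt.
by rewrite legipC; exact: legip0_lt.
Qed.

Lemma size_leg l m : size (leg l m) = (l.+1 - m)%N.
Proof.
rewrite /legendre derivnZ size_scale; last first.
  by rewrite invr_neq0// mulf_neq0 ?expf_neq0 ?pnatr_eq0// -lt0n fact_gt0.
by rewrite derivn_derivn size_derivn_char0 size_w; lia.
Qed.

(** For [l = m, m + 1, ...] the derivatives of order [m] have degrees 0, 1, 2, and so on;
    subtracting a multiple of the one with the degree of [p] cancels the leading term. Used for
    completeness at a fixed order [m]. *)
Lemma leg_span m (F : {poly R} -> Prop) :
  F 0 -> (forall p q, F p -> F q -> F (p + q)) ->
  (forall c p, F p -> F (c *: p)) ->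
  (forall l, (m <= l)%N -> F (leg l m)) -> forall p, F p.
Proof.
move=> F0 FD FZ Fl p; have [n] := ubnP (size p); elim: n p => // n IH p pn.
have [->//|p0] := eqVneq p 0.
have sp : (0 < size p)%N by rewrite lt0n size_poly_eq0.
pose q := leg (m + (size p).-1) m.
have sq : size q = size p by rewrite size_leg; lia.
have q0 : lead_coef q != 0 by rewrite lead_coef_eq0 -size_poly_eq0 sq -lt0n.
pose c := lead_coef p / lead_coef q.
rewrite -(subrK (c *: q) p); apply: FD; last by apply/FZ/Fl; rewrite leq_addr.
apply: IH; rewrite -ltnS (leq_trans _ pn)// ltnS.
have sB : (size (p - c *: q)%R <= size p)%N.
  by rewrite (leq_trans (size_polyD _ _))// size_polyN geq_max leqnn/= -sq size_scale_leq.
rewrite ltn_neqAle sB andbT; apply/eqP => e.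
have : lead_coef (p - c *: q) = 0.
  rewrite lead_coefE e coefB coefZ -lead_coefE -sq -lead_coefE.
  by rewrite /c divfK ?subrr.
by move/eqP; rewrite lead_coef_eq0 -size_poly_eq0 e size_poly_eq0 (negbTE p0).
Qed.

End legendre.

(** * Real spherical harmonics *)

Section bounded_measurable.
Context d (T : measurableType d) (R : realType).
Implicit Types f g : T -> R.

Definition bmfun f :=
  measurable_fun setT f /\ exists M, forall x, `|f x| <= M.

Lemma bmfun_cst c : bmfun (fun=> c).
Proof. by split => //; exists `|c|. Qed.

Lemma bmfunD f g : bmfun f -> bmfun g -> bmfun (fun x => f x + g x).
Proof.
move=> [mf [M fM]] [mg [N gN]]; split; first exact: measurable_funD.
by exists (M + N) => x; rewrite (le_trans (ler_normD _ _))// lerD.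
Qed.

Lemma bmfunM f g : bmfun f -> bmfun g -> bmfun (fun x => f x * g x).
Proof.
move=> [mf [M fM]] [mg [N gN]]; split; first exact: measurable_funM.
by exists (M * N) => x; rewrite normrM ler_pM.
Qed.

Lemma bmfunZ c f : bmfun f -> bmfun (fun x => c * f x).
Proof. by move=> ?; apply: bmfunM => //; exact: bmfun_cst. Qed.

Lemma bmfunN f : bmfun f -> bmfun (fun x => - f x).
Proof. by move=> /(bmfunZ (-1)); under eq_fun do rewrite mulN1r. Qed.

Lemma bmfunX f n : bmfun f -> bmfun (fun x => f x ^+ n).
Proof.
move=> bf; elim: n => [|n IH]; first exact: bmfun_cst.
by under eq_fun do rewrite exprS; exact: bmfunM.
Qed.

Lemma bmfun_horner (p : {poly R}) f : bmfun f -> bmfun (fun x => p.[f x]).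
Proof.
move=> bf; elim/poly_ind: p => [|p c IH].
  by under eq_fun do rewrite horner0; exact: bmfun_cst.
under eq_fun do rewrite hornerMXaddC.
by apply: bmfunD; [exact: bmfunM|exact: bmfun_cst].
Qed.

Lemma bmfun_sum (I : Type) (s : seq I) (F : I -> T -> R) :
  (forall i, bmfun (F i)) -> bmfun (fun x => \sum_(i <- s) F i x).
Proof.
move=> bF; elim: s => [|i s IH].
  by under eq_fun do rewrite big_nil; exact: bmfun_cst.
by under eq_fun do rewrite big_cons; exact: bmfunD.
Qed.

Lemma bmfun_indic (A : set T) : measurable A -> bmfun (\1_A : T -> R).
Proof.
move=> mA; split; first exact: measurable_indic.
by exists 1 => x; rewrite indicE; case: (_ \in _); rewrite ?normr1 ?normr0.
Qed.

Lemma bmfun_integrable (mu : {finite_measure set T -> \bar R}) f :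
  bmfun f -> mu.-integrable setT (EFin \o f).
Proof.
move=> [mf [M fM]]; apply: measurable_bounded_integrable => //.
- exact: fin_num_fun_lty.
- exists M; split; first by rewrite num_real.
  by move=> N MN x _ /=; rewrite (le_trans (fM x))// ltW.
Qed.

Lemma bmfun_integrableM (mu : {measure set T -> \bar R}) f g :
  mu.-integrable setT (EFin \o f) -> bmfun g ->
  mu.-integrable setT (EFin \o (fun x => f x * g x)).
Proof.
move=> fi [mg [M gM]].
have := @integrableMl _ _ _ mu _ measurableT (EFin \o f) g fi mg.
apply; exists M; split; first by rewrite num_real.
by move=> N MN x _ /=; rewrite (le_trans (gM x))// ltW.
Qed.

End bounded_measurable.

Lemma continuous_bmfun_itv (R : realType) (f : R -> R) a b :
  continuous f -> exists M, forall x, x \in `[a, b] -> `|f x| <= M.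
Proof.
move=> cf; have [ab|ab] := leP a b; last first.
  by exists 0 => x; rewrite in_itv/= => /andP[ax xb]; move: (le_trans ax xb); rewrite leNgt ab.
have cn : {within `[a, b], continuous (fun x => `|f x|)}.
  apply: continuous_subspaceT => x.
  exact: (continuous_comp (cf x) (@norm_continuous _ _ _)).
by have [c _ H] := EVT_max ab cn; exists `|f c|.
Qed.

Section sphere_functions.
Variable R : realType.
Local Notation S2 := (sphere R).
Implicit Types x : S2.

Definition sc (i : nat) x : R := sphere_coord (inord i) x.

Lemma sc_norm x : sc 0 x ^+ 2 + sc 1 x ^+ 2 + sc 2 x ^+ 2 = 1.
Proof.
have /eqP : \sum_(i < 3) sphere_val x 0 i ^+ 2 == 1 by case: x.
rewrite !big_ord_recr big_ord0/= add0r => <-; rewrite /sc /sphere_coord.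
by congr (x 0 _ ^+ 2 + x 0 _ ^+ 2 + x 0 _ ^+ 2); apply/val_inj; rewrite /= inordK.
Qed.

Lemma sc2_norm x : sc 0 x ^+ 2 + sc 1 x ^+ 2 = 1 - sc 2 x ^+ 2.
Proof. by rewrite -(sc_norm x) addrK. Qed.

Lemma sc_le1 i x : (i < 3)%N -> `|sc i x| <= 1.
Proof.
move=> i3; rewrite -(@ler_pXn2r _ 2) ?nnegrE// expr1n -normrX ger0_norm ?sqr_ge0//.
have := sc_norm x; have := sqr_ge0 (sc 0 x); have := sqr_ge0 (sc 1 x).
have := sqr_ge0 (sc 2 x); case: i i3 => [|[|[|//]]] _; lra.
Qed.

Lemma measurable_sc i : (i < 3)%N -> measurable_fun setT (sc i).
Proof.
move=> i3 _ B mB; rewrite setTI; apply: sub_gen_smallest.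
by rewrite -bigcup_mkord_ord; exists i => //=; exists B => //; rewrite setTI.
Qed.

Lemma bmfun_sc i : (i < 3)%N -> bmfun (sc i).
Proof.
by move=> i3; split; [exact: measurable_sc|exists 1 => x; exact: sc_le1].
Qed.

(** [r^n cos (n phi)] and [r^n sin (n phi)] with [r = sin theta], written as polynomials in the
    coordinates, so that measurability and products with coordinates avoid the longitude. *)
Definition tharm (b : bool) n x : R :=
  let z := (sc 0 x +i* sc 1 x) ^+ n in
  if b then complex.Im z else complex.Re z.
Arguments tharm : simpl never.

Lemma tharm0 b x : tharm b 0 x = (~~ b)%:R.
Proof. by rewrite /tharm expr0; case: b. Qed.

Lemma tharmS b n x : tharm b n.+1 x =
  sc 0 x * tharm b n x + (-1) ^+ (~~ b) * sc 1 x * tharm (~~ b) n x.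
Proof.
rewrite /tharm exprS; case: (_ ^+ n) => u v; case: b => /=.
  by rewrite expr0 mul1r.
by rewrite expr1 mulN1r mulNr.
Qed.

(** A product-to-sum formula: a horizontal coordinate moves the frequency one step up and one step
    down, and [x^2 + y^2 = 1 - z^2] absorbs the surplus power of [r]. This is what makes the test
    class of the completeness proof stable. *)
Lemma tharm_step0 b n x : sc 0 x * tharm b n.+1 x =
  2^-1 * tharm b n.+2 x + 2^-1 * ((1 - sc 2 x ^+ 2) * tharm b n x).
Proof.
rewrite -sc2_norm !tharmS negbK; case: b; rewrite ?expr0 ?expr1/=; by field.
Qed.

Lemma tharm_step1 b n x : sc 1 x * tharm b n.+1 x =
  (-1) ^+ b * (2^-1 * tharm (~~ b) n.+2 x
               - 2^-1 * ((1 - sc 2 x ^+ 2) * tharm (~~ b) n x)).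
Proof.
rewrite -sc2_norm !tharmS !negbK; case: b; rewrite ?expr0 ?expr1/=; by field.
Qed.

Lemma bmfun_tharm b n : bmfun (tharm b n).
Proof.
elim: n b => [|n IH] b.
  by rewrite (_ : tharm b 0 = fun=> (~~ b)%:R); [exact: bmfun_cst|
    apply/funext => x; exact: tharm0].
rewrite (_ : tharm b n.+1 = fun x => sc 0 x * tharm b n x +
    (-1) ^+ (~~ b) * sc 1 x * tharm (~~ b) n x); last first.
  by apply/funext => x; exact: tharmS.
apply: bmfunD; apply: bmfunM => //; first exact: bmfun_sc.
by apply: bmfunZ; exact: bmfun_sc.
Qed.

Definition trig (b : bool) (t : R) := if b then sin t else cos t.

Lemma trig_pow (r t : R) x n b : sc 0 x = r * cos t -> sc 1 x = r * sin t ->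
  tharm b n x = r ^+ n * trig b (n%:R * t).
Proof.
move=> e0 e1; elim: n b => [|n IH] b.
  by rewrite tharm0 mul0r expr0 mul1r /trig cos0 sin0; case: b.
rewrite tharmS !IH e0 e1 -natr1 mulrDl mul1r exprS /trig.
by case: b => /=; rewrite ?sinD ?cosD ?expr0 ?expr1; ring.
Qed.

Lemma cos_colatitude x : cos (colatitude x) = sc 2 x.
Proof.
rewrite /colatitude acosK// in_itv/= -ler_norml.
exact: (@sc_le1 2 x).
Qed.

Lemma longitudeP x : exists r, [/\ r = Num.sqrt (1 - sc 2 x ^+ 2),
  sc 0 x = r * cos (longitude x) & sc 1 x = r * sin (longitude x)].
Proof.
exists (Num.sqrt (1 - sc 2 x ^+ 2)); rewrite -sc2_norm.
set s := Num.sqrt _; rewrite /longitude -/(sc 0 x) -/(sc 1 x) -/s.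
have q0 := sqr_ge0 (sc 0 x); have q1 := sqr_ge0 (sc 1 x).
have s2 : s ^+ 2 = sc 0 x ^+ 2 + sc 1 x ^+ 2 by rewrite sqr_sqrtr// addr_ge0.
(* At the poles both horizontal coordinates vanish, so any longitude satisfies the equations. *)
have [s0|s0] := eqVneq s 0.
  move: s2; rewrite s0 expr0n/= => /esym/eqP; rewrite paddr_eq0// !sqrf_eq0.
  by move=> /andP[/eqP -> /eqP ->]; rewrite !mul0r.
have sgt0 : 0 < s by rewrite lt0r s0 sqrtr_ge0.
have y1 : -1 <= sc 0 x / s <= 1.
  rewrite -ler_norml normrM normfV (gtr0_norm sgt0) ler_pdivrMr// mul1r.
  by rewrite -(@ler_pXn2r _ 2) ?nnegrE ?(ltW sgt0)// real_normK ?num_real// s2 lerDl.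
have c : cos (acos (sc 0 x / s)) = sc 0 x / s by rewrite acosK// in_itv.
have sn : sin (acos (sc 0 x / s)) = `|sc 1 x| / s.
  have -> : `|sc 1 x| / s = `|sc 1 x / s| by rewrite normrM normfV (gtr0_norm sgt0).
  rewrite sin_acos// -sqrtr_sqr.
  congr Num.sqrt; rewrite !exprMn exprVn s2; field.
  by rewrite -s2 expf_neq0.
(* [acos] returns an angle with nonnegative sine; the reflection [2 pi - a] in the definition of the
   longitude restores the other sign. *)
split => //; case: ifPn => x10.
- by rewrite c mulrC divfK.
- by rewrite cosB cos2pi sin2pi c; field.
- by rewrite sn ger0_norm// mulrC divfK.
- by rewrite sinB cos2pi sin2pi sn c ltr0_norm ?ltNge//; field.
Qed.

(** The sign is the Condon-Shortley phase, moved here out of [assoc_legendre_nat]. *)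
Definition harm_cst l m : R := (-1) ^+ m *
  Num.sqrt (l.*2.+1%:R * ((l - m)`!%:R / (l + m)`!%:R)).

Definition leg_at l m x : R := ((legendre R l)^`(m)).[sc 2 x].

(* The index (b, l, m) stands for the real harmonic of degree l in cos (m phi)
   (b = false) or sin (m phi) (b = true); it is meaningful for b <= m <= l. *)
Definition basis (i : bool * nat * nat) x : R :=
  (if i.2 == 0%N then 1 else Num.sqrt 2) * harm_cst i.1.2 i.2 *
  (leg_at i.1.2 i.2 x * tharm i.1.1 i.2 x).

Lemma sph_harm_nat l (m : nat) x : (m <= l)%N -> sph_harm l m x =
  (harm_cst l m * (leg_at l m x * tharm false m x)) +i*
  (harm_cst l m * (leg_at l m x * tharm true m x)).
Proof.
move=> ml; have [r [rE e0 e1]] := longitudeP x.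
rewrite (trig_pow _ _ e0 e1) (trig_pow _ _ e0 e1) /sph_harm cos_colatitude.
rewrite /assoc_legendre /assoc_legendre_nat -/(leg_at l m x) -rE /harm_cst.
have -> : absz (l%:Z - m%:Z) = (l - m)%N by lia.
have -> : absz (l%:Z + m%:Z) = (l + m)%N by lia.
rewrite /trig -[m%:~R]/(m%:R).
move: (Num.sqrt _) (leg_at _ _ _) (r ^+ m) ((-1) ^+ m) (cos _) (sin _) => A B C D E F.
by simpc; congr (_ +i* _); ring.
Qed.

Lemma sph_harm_neg l (k : nat) x : (k < l)%N -> sph_harm l (Negz k) x =
  ((-1) ^+ k.+1 * (harm_cst l k.+1 * (leg_at l k.+1 x * tharm false k.+1 x))) +i*
  (- ((-1) ^+ k.+1 * (harm_cst l k.+1 * (leg_at l k.+1 x * tharm true k.+1 x)))).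
Proof.
move=> kl; have [r [rE e0 e1]] := longitudeP x.
rewrite (trig_pow _ _ e0 e1) (trig_pow _ _ e0 e1) /sph_harm cos_colatitude.
rewrite /assoc_legendre /assoc_legendre_nat -/(leg_at l k.+1 x) -rE /harm_cst.
have -> : absz (l%:Z - Negz k) = (l + k.+1)%N by lia.
have -> : absz (l%:Z + Negz k) = (l - k.+1)%N by lia.
rewrite /trig -[(Negz k)%:~R]/(- (k.+1%:R)) mulNr cosN sinN.
have f0 n : 0 < n`!%:R :> R by rewrite ltr0n fact_gt0.
(* The normalizations of orders [- m] and [m] differ by a quotient of factorials, the inverse of the
   one built into [assoc_legendre] at negative orders. *)
have -> : Num.sqrt (l.*2.+1%:R * ((l + k.+1)`!%:R / (l - k.+1)`!%:R)) =
    Num.sqrt (l.*2.+1%:R * ((l - k.+1)`!%:R / (l + k.+1)`!%:R)) *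
    ((l + k.+1)`!%:R / (l - k.+1)`!%:R) :> R.
  have := f0 (l + k.+1)%N; have := f0 (l - k.+1)%N.
  move: ((l - k.+1)`!%:R : R) ((l + k.+1)`!%:R : R) => b a b0 a0.
  rewrite -[in RHS](@ger0_norm _ (a / b)); last by rewrite divr_ge0// ltW.
  rewrite -sqrtr_sqr -sqrtrM; last by rewrite mulr_ge0// divr_ge0// ltW.
  by congr Num.sqrt; field; rewrite ?gt_eqF.
have := f0 (l + k.+1)%N; have := f0 (l - k.+1)%N.
move: (Num.sqrt _) (leg_at _ _ _) (r ^+ _) ((-1) ^+ _) (cos _) (sin _) => A B C D E F.
move: ((l - k.+1)`!%:R : R) ((l + k.+1)`!%:R : R) => a b a0 b0.
by simpc; congr (_ +i* _); field; rewrite ?gt_eqF.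
Qed.

Definition harm_re (m : int) : R := match m with
  | Posz k => if k == 0%N then 1 else (Num.sqrt 2)^-1
  | Negz k => (-1) ^+ k.+1 / Num.sqrt 2 end.
(** At [m = 0] the value is arbitrary because [basis (true, l, 0)] vanishes; a nonzero choice keeps
    the factor invertible, as [fourier_eqnE] requires. *)
Definition harm_im (m : int) : R := match m with
  | Posz k => if k == 0%N then 1 else (Num.sqrt 2)^-1
  | Negz k => - ((-1) ^+ k.+1 / Num.sqrt 2) end.

Lemma sqrt2_neq0 : Num.sqrt 2 != 0 :> R.
Proof. by rewrite gt_eqF// sqrtr_gt0. Qed.

Lemma harm_re_neq0 m : harm_re m != 0.
Proof.
case: m => [[|k]|k] /=; rewrite ?oner_eq0 ?invr_eq0 ?sqrt2_neq0//.
by rewrite mulf_neq0 ?invr_eq0 ?sqrt2_neq0// expf_neq0// oppr_eq0 oner_eq0.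
Qed.

Lemma harm_im_neq0 m : harm_im m != 0.
Proof.
case: m => [[|k]|k] /=; rewrite ?oppr_eq0 ?oner_eq0 ?invr_eq0 ?sqrt2_neq0//.
by rewrite mulf_neq0 ?invr_eq0 ?sqrt2_neq0// expf_neq0// oppr_eq0 oner_eq0.
Qed.

Lemma sph_harmE l (m : int) x : (absz m <= l)%N -> sph_harm l m x =
  (harm_re m * basis (false, l, absz m) x) +i*
  (harm_im m * basis (true, l, absz m) x).
Proof.
have s0 := sqrt2_neq0.
case: m => [k|k] kl; rewrite ?NegzE ?abszN -?NegzE /basis /=.
  rewrite sph_harm_nat//; case: (_ == _); first by rewrite !mul1r.
  by rewrite -!(mulrA (Num.sqrt 2)) !(mulrA _^-1) mulVf// !mul1r.
rewrite sph_harm_neg//; move: s0 (_ ^+ k.+1) (_ * tharm _ _ _) (_ * tharm _ _ _).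
by move: (Num.sqrt 2) (harm_cst _ _) => a b a0 c e g; congr (_ +i* _); field.
Qed.

Lemma bmfun_basis i : bmfun (basis i).
Proof.
apply: bmfunZ; apply: bmfunM; last exact: bmfun_tharm.
by apply: bmfun_horner; exact: bmfun_sc.
Qed.

Lemma basis_true0 l x : basis (true, l, 0%N) x = 0.
Proof. by rewrite /basis/= tharm0 !mulr0. Qed.

End sphere_functions.

(** * Integrals over the colatitude and the longitude *)

Section rintegral_ftc.
Variable R : realType.
Local Notation leb := (@lebesgue_measure R).

Lemma continuous_integrable_itv (f : R -> R) a b : continuous f ->
  leb.-integrable `[a, b] (EFin \o f).
Proof.
move=> cf; have [M fM] := continuous_bmfun_itv a b cf.
apply: measurable_bounded_integrable => //.
- by rewrite /= lebesgue_measure_itv/=; case: ifP => // _; rewrite -EFinB ltry.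
- by apply: measurable_funTS; exact: continuous_measurable_fun.
- exists M; split; first by rewrite num_real.
  by move=> N MN x /= xab; rewrite (le_trans (fM x xab))// ltW.
Qed.

Lemma Rintegral_FTC2 (f F : R -> R) (a b : R) : a < b -> continuous f ->
  (forall x : R, is_derive x 1 F (f x)) -> \int[leb]_(x in `[a, b]) f x = F b - F a.
Proof.
move=> ab cf dF; rewrite /Rintegral.
have cF : continuous F.
  by move=> x; apply/differentiable_continuous/derivable1_diffP.
rewrite (@continuous_FTC2 _ _ F) ?EFinB//=.
- exact: continuous_subspaceT.
- split; first by move=> x _.
  + exact/cvg_at_right_filter/cF.
  + exact/cvg_at_left_filter/cF.
- by move=> x _; rewrite derive1E derive_val.
Qed.

(** The substitution [z = cos theta], carried out with an explicit primitive. *)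
Lemma Rintegral_colatitude (p : {poly R}) :
  \int[leb]_(t in `[0, pi]) (p.[cos t] * sin t) = intp p.
Proof.
have cp : continuous (fun t => p.[cos t] * sin t : R).
  move=> t; apply: cvgM; last exact: continuous_sin.
  by apply: continuous_comp; [exact: continuous_cos|exact: continuous_horner].
have dp (t : R) : is_derive t 1 (fun t => - (primp p).[cos t] : R) (p.[cos t] * sin t).
  apply: trigger_derive.
  by rewrite deriv_primp mulrN opprK.
rewrite (Rintegral_FTC2 (pi_gt0 R) cp dp).
by rewrite cospi cos0 opprK addrC.
Qed.

Lemma trig_lin_derive b (c t : R) :
  is_derive t 1 (fun t => trig b (c * t)) ((-1) ^+ (~~ b) * c * trig (~~ b) (c * t)).
Proof.
have dl : is_derive t 1 (fun t => c * t) c.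
  by apply: is_derive_eq; rewrite /GRing.scale/=; ring.
case: b; rewrite /trig /=; apply: trigger_derive.
- by rewrite expr0 mul1r mulrC.
- by rewrite expr1; ring.
Qed.

Lemma continuous_trig_lin b (c : R) : continuous (fun t => trig b (c * t)).
Proof.
move=> t; apply/differentiable_continuous/derivable1_diffP.
by have [] := trig_lin_derive b c t.
Qed.

Lemma trig2pi b n : trig b (n%:R * (pi *+ 2)) = (~~ b)%:R :> R.
Proof.
elim: n => [|n IH]; first by rewrite mul0r /trig sin0 cos0; case: b.
rewrite -natr1 mulrDl mul1r /trig; move: IH; rewrite /trig.
by case: b => e; rewrite (sinD, cosD) sin2pi cos2pi mulr0 mulr1 ?addr0 ?subr0 e.
Qed.

Local Notation I2pi := (`[0, (pi *+ 2 : R)]%classic).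

Lemma pi2_gt0 : 0 < pi *+ 2 :> R.
Proof. by rewrite mulrn_wgt0// pi_gt0. Qed.

Lemma Rintegral_trig b n : n != 0%N ->
  \int[leb]_(t in I2pi) trig b (n%:R * t) = 0.
Proof.
move=> n0; have n0' : n%:R != 0 :> R by rewrite pnatr_eq0.
have dp (t : R) : is_derive t 1
    (fun t => ((-1) ^+ b / n%:R) *: trig (~~ b) (n%:R * t) : R) (trig b (n%:R * t)).
  have dl := trig_lin_derive (~~ b) n%:R t; apply: trigger_derive.
  by rewrite negbK /GRing.scale/=; case: b {dl}; rewrite ?expr0 ?expr1/=; field.
rewrite (Rintegral_FTC2 pi2_gt0 (@continuous_trig_lin b n%:R) dp).
by rewrite trig2pi mulr0 /trig sin0 cos0; case: b {dp} => /=; rewrite subrr.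
Qed.

Lemma Rintegral_trig0 b : \int[leb]_(t in I2pi) trig b (0%:R * t) = (~~ b)%:R * (pi *+ 2).
Proof.
under eq_Rintegral do rewrite mul0r.
rewrite Rintegral_cst//= lebesgue_measure_itv/= lte_fin pi2_gt0 oppr0 addr0.
by rewrite /trig sin0 cos0; case: b.
Qed.

Lemma trig_mul b b' m n (t : R) : (m <= n)%N ->
  trig b (m%:R * t) * trig b' (n%:R * t) =
  2^-1 * ((-1) ^+ (b && ~~ b') * trig (b (+) b') ((n - m)%:R * t) +
          (-1) ^+ (b && b') * trig (b (+) b') ((n + m)%:R * t)).
Proof.
move=> mn; rewrite natrB// natrD mulrBl mulrDl.
by case: b; case: b'; rewrite /trig /= ?sinB ?cosB ?sinD ?cosD ?expr0 ?expr1; field.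
Qed.

(** Product-to-sum formulas reduce it to single frequencies. The side conditions exclude the sine of
    frequency 0, for which the diagonal value [2 pi] would be false. *)
Lemma Rintegral_trig_mul (b b' : bool) m n : (b <= m)%N -> (b' <= n)%N ->
  \int[leb]_(t in I2pi) (trig b (m%:R * t) * trig b' (n%:R * t)) =
  if (b == b') && (m == n) then (if m == 0%N then pi *+ 2 else pi) else 0.
Proof.
wlog mn : b b' m n / (m <= n)%N.
  move=> W bm bn; have [mn|/ltnW nm] := leqP m n; first exact: W.
  under eq_Rintegral do rewrite mulrC.
  by rewrite W// eq_sym [n == _]eq_sym; case: eqP => //= _; case: eqP => // ->.
move=> bm bn; under eq_Rintegral do rewrite trig_mul//.
have ci c k : leb.-integrable I2pi (EFin \o (fun t => c * trig (b (+) b') (k%:R * t))).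
  by apply: continuous_integrable_itv => t; apply: cvgMl_tmp; exact: continuous_trig_lin.
have cj k : leb.-integrable I2pi (EFin \o (fun t => trig (b (+) b') (k%:R * t))).
  by apply: continuous_integrable_itv => t; exact: continuous_trig_lin.
rewrite RintegralZl//; last first.
  by apply: continuous_integrable_itv => t; apply: cvgD; apply: cvgMl_tmp; exact: continuous_trig_lin.
rewrite RintegralD// !RintegralZl//.
have [e|mn'] := eqVneq m n; last first.
  rewrite andbF !Rintegral_trig ?mulr0 ?addr0 ?mulr0//; lia.
subst n; rewrite subnn Rintegral_trig0 andbT.
have [m0|m0] := eqVneq m 0%N.
  rewrite m0 addn0 Rintegral_trig0; move: bm bn; rewrite m0.
  by case: b ci cj => // _ _; case: b' => // _ _; rewrite /= !expr0; field.
rewrite Rintegral_trig; last lia.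
by case: b b' {bm bn ci cj} => -[]; rewrite /= ?expr0 ?expr1; field.
Qed.

End rintegral_ftc.

(** * Integration on the sphere in spherical coordinates *)

Section sphere_integral.
Variable R : realType.
Local Notation leb := (@lebesgue_measure R).
Local Notation mu := (@sphere_measure R).
Local Notation S2 := (sphere R).

Let dens (p : R * R) : R := sin p.1 / (pi *+ 4).
Local Notation sph := (@spherical R).
Local Notation ang := (@angles R).

Let dens_ge0 p : ang p -> 0 <= dens p.
Proof.
case=> /=; rewrite !in_itv/= => p1 _.
by rewrite divr_ge0 ?sin_ge0_pi// mulrn_wge0// pi_ge0.
Qed.

Let mdens : measurable_fun setT dens.
Proof.
apply: measurable_funM => //; apply: measurableT_comp => //.
by apply: continuous_measurable_fun; exact: continuous_sin.
Qed.

Let mang : measurable ang. Proof. exact: measurable_angles. Qed.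

Let msph : measurable_fun setT sph. Proof. exact: measurable_spherical. Qed.

Let integral_sphere_indic E : measurable E ->
  (\int[mu]_x (\1_E x)%:E =
   \int[leb \x leb]_(p in ang) ((\1_E (sph p))%:E * (dens p)%:E))%E.
Proof.
move=> mE; rewrite integral_indic//= setIT /sphere_measure.
rewrite integral_mkcondr; apply: eq_integral => p _.
rewrite patchE indicE (_ : (p \in sph @^-1` E) = (sph p \in E)); last first.
  by apply/idP/idP; rewrite !inE.
case: (_ \in _) => /=.
  by rewrite mul1e.
by rewrite mul0e.
Qed.

Import HBNNSimple.

Let integral_sphere_nnsfun (f : {nnsfun S2 >-> R}) :
  (\int[mu]_x (f x)%:E =
   \int[leb \x leb]_(p in ang) ((f (sph p))%:E * (dens p)%:E))%E.
Proof.
under [LHS]eq_integral do rewrite fimfunE -fsumEFin//.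
rewrite [LHS]ge0_integral_fsum//; last 2 first.
  - by move=> r; exact/measurable_EFinP/measurableT_comp.
  - by move=> n x _; rewrite EFinM nnfun_muleindic_ge0.
under [RHS]eq_integral.
  move=> x xD; rewrite fimfunE -fsumEFin// ge0_mule_fsuml; last first.
    by move=> r; rewrite EFinM nnfun_muleindic_ge0.
  over.
rewrite [RHS]ge0_integral_fsum//; last 2 first.
  - move=> r; apply/measurable_funTS; apply: emeasurable_funM; last exact/measurable_EFinP.
    apply/measurable_EFinP; apply: measurable_funM => //.
    by apply: (measurableT_comp _ msph); exact: measurable_indic.
  - move=> n x xa; rewrite mule_ge0//; first by rewrite EFinM nnfun_muleindic_ge0.
    by rewrite lee_fin dens_ge0.
apply: eq_fsbigr => r _.
have mf : measurable (f @^-1` [set r]) by exact: measurable_funPTI.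
have [r0|r0] := ltP r 0.
  rewrite (_ : f @^-1` [set r] = set0); last first.
    by apply/seteqP; split => // x /= fx; have : 0 <= f x by []; rewrite fx leNgt r0.
  rewrite !integral0_eq// => x _; rewrite indic0 mulr0//.
  by rewrite mul0e.
under eq_integral do rewrite EFinM.
rewrite ge0_integralZl//.
rewrite integral_sphere_indic// -ge0_integralZl//.
- by apply: eq_integral => p _; rewrite EFinM muleA.
- apply/measurable_funTS; apply: emeasurable_funM; last exact/measurable_EFinP.
  apply/measurable_EFinP.
  apply: (@measurableT_comp _ _ _ _ _ _ (\1_(f @^-1` [set r]) : S2 -> R) _ sph) => //.
- by move=> x xa; rewrite mule_ge0// lee_fin// dens_ge0.
- exact/measurable_EFinP/measurable_indic.
Qed.

(** The definition of the measure is the case of indicators; simple functions follow by linearity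
    and the general case by monotone convergence. *)
Lemma ge0_integral_sphere (f : S2 -> \bar R) :
  measurable_fun setT f -> (forall x, 0 <= f x)%E ->
  (\int[mu]_x f x =
   \int[leb \x leb]_(p in ang) (f (sph p) * (dens p)%:E))%E.
Proof.
move=> mf f0.
pose f_ := nnsfun_approx measurableT mf.
have mfs n : measurable_fun ang (fun p => ((f_ n (sph p))%:E * (dens p)%:E)%E).
  apply/measurable_funTS; apply: emeasurable_funM; last exact/measurable_EFinP.
  by apply/measurable_EFinP; exact: (@measurableT_comp _ _ _ _ _ _ (f_ n) _ sph).
transitivity (lim (\int[mu]_x (f_ n x)%:E @[n --> \oo])%E).
  rewrite -monotone_convergence//=.
  - apply: eq_integral => ? /[!inE] xD; apply/esym/cvg_lim => //=.
    exact: cvg_nnsfun_approx.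
  - by move=> n; exact/measurable_EFinP/measurable_funTS.
  - by move=> n ? _; rewrite lee_fin.
  - by move=> ? _ ? ? mn; rewrite lee_fin; exact/lefP/nd_nnsfun_approx.
rewrite [RHS](_ : _ = lim
    (\int[leb \x leb]_(p in ang) ((f_ n (sph p))%:E * (dens p)%:E) @[n --> \oo])%E); last first.
  rewrite -monotone_convergence//=.
  - apply: eq_integral => p /[!inE] pD; apply/esym/cvg_lim => //.
    apply: cvgeZr => //; exact: cvg_nnsfun_approx.
  - by move=> n p pa; rewrite mule_ge0// lee_fin// dens_ge0.
  - move=> p pa m n mn; apply: lee_wpmul2r; first by rewrite lee_fin dens_ge0.
    by rewrite lee_fin; exact/lefP/nd_nnsfun_approx.
by apply: congr_lim; apply/funext => n /=; exact: integral_sphere_nnsfun.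
Qed.

Lemma integral_sphere (f : S2 -> R) : measurable_fun setT f ->
  (\int[mu]_x (f x)%:E =
   \int[leb \x leb]_(p in ang) (f (sph p) * dens p)%:E)%E.
Proof.
move=> mf; rewrite integralE [RHS]integralE.
rewrite !ge0_integral_sphere//; first last.
- by apply: measurable_funepos; exact/measurable_EFinP.
- by apply: measurable_funeneg; exact/measurable_EFinP.
congr (_ - _)%E; apply: eq_integral => p /[!inE] /dens_ge0 d0.
- by rewrite !funeposE -!EFin_max -EFinM maxr_pMl// mul0r.
- by rewrite !funenegE -!EFinN -!EFin_max -EFinM maxr_pMl// mul0r mulNr.
Qed.

(** The factor [sin p.1] of the surface element is included in the product to be separated, after
    which Fubini applies on the rectangle of angles. *)
Lemma Rintegral_sphere_sep (f : S2 -> R) (u v : R -> R) :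
  measurable_fun setT f -> continuous u -> continuous v ->
  (forall p, f (sph p) * sin p.1 = u p.1 * v p.2) ->
  \int[mu]_x f x = (pi *+ 4)^-1 * ((\int[leb]_(s in `[0, pi]) u s) *
    (\int[leb]_(t in `[0, pi *+ 2]) v t)).
Proof.
move=> mf cu cv fuv; rewrite {1}/Rintegral integral_sphere//.
have -> : (fun p => (f (sph p) * dens p)%:E) = (fun p => ((pi *+ 4)^-1 * u p.1 * v p.2)%:E).
  by apply/funext => p; rewrite /dens mulrA fuv; congr EFin; ring.
pose c : R := (pi *+ 4)^-1.
have mu_ : measurable_fun setT u by exact: continuous_measurable_fun.
have mv_ : measurable_fun setT v by exact: continuous_measurable_fun.
have [M uM] := continuous_bmfun_itv 0 pi cu.
have [N vN] := continuous_bmfun_itv 0 (pi *+ 2) cv.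
have iF : (leb \x leb)%E.-integrable ang (EFin \o (fun p : R * R => c * u p.1 * v p.2)).
  apply: measurable_bounded_integrable => //.
  - rewrite /angles /= product_measure1E//= !lebesgue_measure_itv/= !lte_fin.
    by rewrite pi_gt0 pi2_gt0 -!EFinB -EFinM ltry.
  - apply: measurable_funTS; apply: measurable_funM; last exact: measurableT_comp.
    by apply: measurable_funM => //; exact: measurableT_comp.
  - exists (`|c| * M * N); split; first by rewrite num_real.
    move=> N' MN p /= [p1 p2]; rewrite (le_trans _ (ltW MN))//.
    rewrite !normrM ler_pM//; last exact: vN.
    by rewrite ler_pM//; exact: uM.
have iF' : (leb \x leb)%E.-integrable setT
    ((EFin \o (fun p : R * R => c * u p.1 * v p.2)) \_ ang).
  have H := @integrable_mkcond _ (measurableTypeR R * measurableTypeR R)%type R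
    (product_measure1 leb leb) ang
    (EFin \o (fun p : R * R => c * u p.1 * v p.2)) mang.
  exact: (proj1 H iF).
rewrite integral_mkcond -(integral12_prod_meas1 iF').
pose J := \int[leb]_(t in `[0, pi *+ 2]) v t.
pose g (s : R) : R := c * u s * J.
transitivity (fine (\int[leb]_x ((EFin \o g) \_ `[0%R, pi]) x)%E).
  congr fine; apply: eq_integral => s _; rewrite /fubini_F patchE.
  case: ifPn => [/set_mem s0|/negP s0].
    rewrite /= /g EFinM /J /Rintegral fineK; last first.
      by apply: integrable_fin_num => //; exact: continuous_integrable_itv.
    rewrite -integralZl//; last exact: continuous_integrable_itv.
    rewrite [RHS]integral_mkcond; apply: eq_integral => t _.
    rewrite !patchE in_setX (mem_set s0)/=.
    by case: ifP => // _; rewrite -EFinM.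
  apply: integral0_eq => t _; rewrite patchE; case: ifPn => // /set_mem [/= s1 _].
  by case: s0; apply/mem_set.
rewrite -integral_mkcond -[fine _]/(Rintegral _ _ _) -/J.
rewrite -RintegralZr//; last exact: continuous_integrable_itv.
rewrite -RintegralZl//; last first.
  by apply: continuous_integrable_itv => x; apply: cvgMr_tmp; exact: cu.
by apply: eq_Rintegral => x _; rewrite mulrA.
Qed.

End sphere_integral.

(** * Orthonormality of the real harmonics *)

Section orthonormality.
Variable R : realType.
Local Notation mu := (@sphere_measure R).
Implicit Types i j : bool * nat * nat.

Definition valid i := (i.1.1 <= i.2 <= i.1.2)%N.

Lemma sc_spherical (p : R * R) :
  [/\ sc 0 (spherical p) = sin p.1 * cos p.2,
      sc 1 (spherical p) = sin p.1 * sin p.2 &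
      sc 2 (spherical p) = cos p.1].
Proof. by split; rewrite /sc /sphere_coord /= mxE inordK. Qed.

(** The factors are [1 / (4 pi)] from the density times the longitude integral, which is [2 pi] for
    [m = 0] and [pi] otherwise. *)
Lemma Rintegral_basis (b b' : bool) (m m' : nat) (p : {poly R}) :
  (b <= m)%N -> (b' <= m')%N ->
  \int[mu]_x (p.[sc 2 x] * tharm b m x * tharm b' m' x) =
  if (b == b') && (m == m') then
    (if m == 0%N then 2^-1 else 4^-1) * intp ((1 - 'X^2) ^+ m * p) else 0.
Proof.
move=> bm bm'.
have cs : continuous (@sin R) := @continuous_sin R.
have cc : continuous (fun x => p.[cos x] : R).
  by move=> x; apply: continuous_comp; [exact: continuous_cos|exact: continuous_horner].
rewrite (@Rintegral_sphere_sep _ _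
  (fun s => p.[cos s] * sin s ^+ (m + m') * sin s)
  (fun t => trig b (m%:R * t) * trig b' (m'%:R * t))); last first.
- move=> q; have [e0 e1 ->] := sc_spherical q.
  rewrite !(trig_pow _ _ e0 e1) exprD; ring.
- by move=> t; apply: cvgM; exact: continuous_trig_lin.
- move=> t; apply: cvgM; last exact: cs.
  by apply: cvgM; [exact: cc|exact: (continuous_comp (cs t) (@exprn_continuous _ _ _))].
- have [//] : bmfun (fun x : sphere R => p.[sc 2 x] * tharm b m x * tharm b' m' x).
  apply: bmfunM; last exact: bmfun_tharm.
  by apply: bmfunM; [apply: bmfun_horner; exact: bmfun_sc|exact: bmfun_tharm].
rewrite Rintegral_trig_mul//; case: ifPn => [/andP[_ /eqP <-]|_]; last by rewrite !mulr0.
under eq_Rintegral.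
  move=> s _; rewrite addnn -mul2n exprM sin2cos2.
  rewrite (_ : p.[cos s] * _ = ((1 - 'X^2) ^+ m * p).[cos s]).
    over.
  by rewrite hornerM horner_exp !hornerE mulrC.
rewrite Rintegral_colatitude.
have : pi != 0 :> R by rewrite gt_eqF// pi_gt0.
by move: (@pi R) (intp _) => q a q0; case: eqP => _; field.
Qed.

Lemma basis_orthonormal i j : valid i -> valid j ->
  \int[mu]_x (basis i x * basis j x) = (i == j)%:R.
Proof.
case: i j => [[b l] m] [[b' l'] m'] /andP/= [bm ml] /andP/= [bm' ml'].
pose N (l m : nat) : R := (if m == 0%N then 1 else Num.sqrt 2) * harm_cst R l m.
pose p := (legendre R l)^`(m) * (legendre R l')^`(m').
have -> : (fun x : sphere R => basis (b, l, m) x * basis (b', l', m') x) =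
    (fun x => (N l m * N l' m') * (p.[sc 2 x] * tharm b m x * tharm b' m' x)).
  by apply/funext => x; rewrite /basis /N /leg_at /p hornerM /=; ring.
rewrite RintegralZl//; last first.
  apply: bmfun_integrable; apply: bmfunM; last exact: bmfun_tharm.
  by apply: bmfunM; [apply: bmfun_horner; exact: bmfun_sc|exact: bmfun_tharm].
rewrite Rintegral_basis// !xpair_eqE.
have [bb|] := eqVneq b b'; last by rewrite mulr0.
subst b'.
have [mm|] := eqVneq m m'; last by rewrite !andbF mulr0.
subst m'; rewrite andbT /p [_ ^+ m * (_ * _)]mulrA -/(legip R m l l').
have [ll|ll] := eqVneq l l'; last by rewrite legip_neq ?mulr0//; exact/eqP.
subst l'; rewrite legip_diag// /N /harm_cst /=.
have f0 n : 0 < n`!%:R :> R by rewrite ltr0n fact_gt0.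
set c := (if m == 0%N then 1 else Num.sqrt 2).
(* The factor [sqrt 2] at orders [m > 0] makes up for the halved longitude integral. *)
have c2 : c ^+ 2 * (if m == 0%N then 2^-1 else 4^-1) = 2^-1.
  rewrite /c; case: ifP => _; first by rewrite expr1n mul1r.
  by rewrite sqr_sqrtr//; field.
have s1 : (-1) ^+ m * (-1) ^+ m = 1 :> R by rewrite -expr2 sqrr_sign.
set s := Num.sqrt _; set e := (-1) ^+ m; rewrite -/e in s1.
have s2 : s ^+ 2 = l.*2.+1%:R * ((l - m)`!%:R / (l + m)`!%:R).
  by rewrite sqr_sqrtr// mulr_ge0// divr_ge0// ltW.
clearbody c s e; move: c2; set k := (if m == 0%N then _^-1 else _) => c2; clearbody k.
transitivity ((c ^+ 2 * k) * (e * e) * s ^+ 2 *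
  (2 / l.*2.+1%:R * ((l + m)`!%:R / (l - m)`!%:R))); first by ring.
rewrite c2 s1 s2; have := f0 (l - m)%N; have := f0 (l + m)%N.
have : l.*2.+1%:R != 0 :> R by rewrite pnatr_eq0.
move: ((l - m)`!%:R : R) ((l + m)`!%:R : R) (l.*2.+1%:R : R) => u v w w0 u0 v0.
by field; rewrite w0 !gt_eqF.
Qed.

Definition coef (f : sphere R -> R) i : R := \int[mu]_x (f x * basis i x).

Lemma coef_basis_sum (s : seq (bool * nat * nat)) (c : bool * nat * nat -> R) j :
  uniq s -> {in s, forall i, valid i} -> valid j ->
  coef (fun x => \sum_(i <- s) c i * basis i x) j = (j \in s)%:R * c j.
Proof.
elim: s => [|i s IH] /= us vs vj.
  rewrite /coef; under eq_Rintegral do rewrite big_nil mul0r.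
  by rewrite Rintegral_cst// !mul0r.
move: us => /andP[i_s us].
have vs' : {in s, forall i, valid i} by move=> k ks; apply: vs; rewrite inE ks orbT.
have vi : valid i by apply: vs; rewrite inE eqxx.
rewrite /coef; under eq_Rintegral do rewrite big_cons mulrDl -mulrA.
have bs : bmfun (fun x => (\sum_(i <- s) c i * basis i x) * basis j x : R).
  apply: bmfunM; last exact: bmfun_basis.
  by apply: bmfun_sum => k; apply: bmfunZ; exact: bmfun_basis.
have bi : bmfun (fun x => basis i x * basis j x : R).
  by apply: bmfunM; exact: bmfun_basis.
rewrite RintegralD//; [|exact/bmfun_integrable/bmfunZ|exact/bmfun_integrable].
rewrite RintegralZl//; last exact/bmfun_integrable.
rewrite basis_orthonormal// -/(coef _ j) IH// inE [j == i]eq_sym.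
by case: eqVneq => [<-|ij] /=; rewrite ?(negbTE i_s) ?mul0r ?mulr1 ?mulr0 ?mul1r ?addr0 ?add0r.
Qed.

Lemma parseval_sum (s : seq (bool * nat * nat)) (c : bool * nat * nat -> R) :
  uniq s -> {in s, forall i, valid i} ->
  \int[mu]_x ((\sum_(i <- s) c i * basis i x) ^+ 2) = \sum_(i <- s) c i ^+ 2.
Proof.
move=> us vs.
pose g x := \sum_(i <- s) c i * basis i x : R.
have bg : bmfun g by apply: bmfun_sum => k; apply: bmfunZ; exact: bmfun_basis.
have -> : (fun x => (\sum_(i <- s) c i * basis i x) ^+ 2) =
    (fun x => \sum_(i <- s) c i * (g x * basis i x)).
  apply/funext => x; rewrite expr2 -/(g x) {2}/g mulr_sumr.
  by apply: eq_bigr => i _; rewrite mulrCA.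
(* The induction runs over a sublist [r] while [g] remains the full sum, whose coefficients are
   known. *)
have H (r : seq (bool * nat * nat)) : {subset r <= s} ->
    \int[mu]_x (\sum_(i <- r) c i * (g x * basis i x)) = \sum_(i <- r) c i ^+ 2.
  elim: r => [|i r IH] rs.
    under eq_Rintegral do rewrite big_nil.
    by rewrite Rintegral_cst// mul0r big_nil.
  have is_ : i \in s by apply: rs; rewrite inE eqxx.
  under eq_Rintegral do rewrite big_cons.
  have bi k : bmfun (fun x => g x * basis k x : R).
    by apply: bmfunM => //; exact: bmfun_basis.
  rewrite RintegralD//; last 2 first.
  - by apply/bmfun_integrable/bmfunZ.
  - by apply/bmfun_integrable/bmfun_sum => k; exact: bmfunZ.
  rewrite RintegralZl//; last exact/bmfun_integrable.
  rewrite IH; last by move=> k kr; apply: rs; rewrite inE kr orbT.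
  rewrite -/(coef g i) coef_basis_sum// ?is_ ?mul1r ?big_cons ?expr2//.
  exact: vs.
exact: H.
Qed.

End orthonormality.

(** * Completeness of the spherical harmonics *)

Section sign_polynomials.
Variable R : realType.

(* The iterates of z |-> (3 z - z ^ 3) / 2 push [-1, 1] \ {0} towards the fixed
   points -1 and 1, so that they converge to the sign function. *)
Fixpoint sgpoly (n : nat) : {poly R} :=
  if n is n'.+1 then 2^-1 *: (3%:P * sgpoly n' - sgpoly n' ^+ 3) else 'X.

Lemma sgpolyS n z : (sgpoly n.+1).[z] =
  2^-1 * (3 * (sgpoly n).[z] - (sgpoly n).[z] ^+ 3).
Proof. by rewrite /= hornerZ hornerD hornerN hornerM hornerC horner_exp. Qed.

Lemma sgpolyN n z : (sgpoly n).[- z] = - (sgpoly n).[z].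
Proof.
elim: n => [|n IH]; first by rewrite !hornerX.
by rewrite !sgpolyS IH; field.
Qed.

(** The identity [e2] factors the distance to 1: each step multiplies it by [1 - p / 2 - p^2 / 2],
    at most [1 - z / 2] since the iterates stay above [z]. *)
Lemma sgpoly_bounds n z : 0 <= z <= 1 ->
  z <= (sgpoly n).[z] <= 1 /\ 1 - (sgpoly n).[z] <= (1 - z / 2) ^+ n.
Proof.
move=> /andP[z0 z1]; elim: n => [|n [/andP[zp p1] IH]].
  by rewrite hornerX expr0 lexx z1 lerBlDr lerDl z0.
rewrite sgpolyS; move: (sgpoly n).[z] zp p1 IH => p zp p1 IH.
have p0 : 0 <= p by exact: le_trans zp.
have e1 : 2^-1 * (3 * p - p ^+ 3) - p = 2^-1 * (p * ((1 - p) * (1 + p))) by field.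
have e2 : 1 - 2^-1 * (3 * p - p ^+ 3) = (1 - p) * (1 - 2^-1 * p - 2^-1 * p ^+ 2) by field.
have q0 : 0 <= 1 - p by rewrite subr_ge0.
have q1 : 0 <= 1 - 2^-1 * p - 2^-1 * p ^+ 2.
  have : p ^+ 2 <= 1 by rewrite expr_le1.
  lra.
split.
  apply/andP; split.
    rewrite (le_trans zp)// -subr_ge0 e1 !mulr_ge0//; lra.
  by rewrite -subr_ge0 e2 mulr_ge0.
rewrite e2 [X in _ <= X]exprSr; apply: ler_pM => //.
by have := sqr_ge0 p; lra.
Qed.

Lemma sgpoly_le1 n z : `|z| <= 1 -> `|(sgpoly n).[z]| <= 1.
Proof.
rewrite !ler_norml => /andP[zN z1]; have [z0|/ltW z0] := leP 0 z.
  have /(sgpoly_bounds n)[/andP[h1 ->] _] : 0 <= z <= 1 by rewrite z0.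
  by rewrite andbT (le_trans _ h1)// (le_trans _ z0)// lerN10.
have /(sgpoly_bounds n)[/andP[h1 h2] _] : 0 <= - z <= 1 by rewrite oppr_ge0 z0 lerNl.
move: h1 h2; rewrite sgpolyN => h1 h2; apply/andP; split; lra.
Qed.

Lemma sgpoly_cvg z : `|z| <= 1 -> (sgpoly n).[z] @[n --> \oo] --> Num.sg z.
Proof.
have H (y : R) : 0 < y <= 1 -> (sgpoly n).[y] @[n --> \oo] --> (1 : R).
  move=> /andP[y0 y1].
  have hb n : 1 - (1 - y / 2) ^+ n <= (sgpoly n).[y] <= 1.
    have [|/andP[_ ->] h] := @sgpoly_bounds n y; first by rewrite ltW.
    rewrite andbT; lra.
  apply: (@squeeze_cvgr _ _ _ _ (fun n => 1 - (1 - y / 2) ^+ n) (fun=> 1)).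
  - by apply: nearW => n; exact: hb.
  - rewrite -[X in _ --> X]subr0; apply: cvgB; first exact: cvg_cst.
    by apply: cvg_expr; rewrite ger0_norm; lra.
  - exact: cvg_cst.
move=> z1; have [z0|z0|->] := ltgtP z 0.
- have -> : (fun n => (sgpoly n).[z]) = (fun n => - (sgpoly n).[- z]).
    by apply/funext => n; rewrite sgpolyN opprK.
  rewrite ltr0_sg//.
  apply: cvgN; apply: H.
  by rewrite oppr_gt0 z0; move: z1; rewrite ltr0_norm.
- by rewrite gtr0_sg//; apply: H; rewrite z0; move: z1; rewrite gtr0_norm.
- rewrite sgr0; under eq_fun => n.
    have -> : (sgpoly n).[0] = 0.
      by elim: n => [|n IH]; rewrite ?hornerX// sgpolyS IH; field.
    over.
  exact: cvg_cst.
Qed.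

End sign_polynomials.

Lemma tharm_eq0 (R : realType) (b : bool) n (x : sphere R) :
  (n < b)%N -> tharm b n x = 0.
Proof. by case: b => //; case: n => // _; rewrite tharm0. Qed.

Section completeness.
Variable R : realType.
Local Notation mu := (@sphere_measure R).
Local Notation S2 := (sphere R).
Variable f : S2 -> R.
Hypothesis fint : mu.-integrable setT (EFin \o f).
Hypothesis f0 : forall i, valid i -> coef f i = 0.

Let I (h : S2 -> R) := \int[mu]_x (f x * h x).

Let ID h k : bmfun h -> bmfun k -> I (fun x => h x + k x) = I h + I k.
Proof.
move=> bh bk; rewrite /I; under eq_Rintegral do rewrite mulrDr.
by rewrite RintegralD//; exact: bmfun_integrableM.
Qed.

Let IZ c h : bmfun h -> I (fun x => c * h x) = c * I h.
Proof.
move=> bh; rewrite /I; under eq_Rintegral do rewrite mulrCA.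
by rewrite RintegralZl//; exact: bmfun_integrableM.
Qed.

Let tf (q : {poly R}) b n (x : S2) := q.[sc 2 x] * tharm b n x.

Let btf q b n : bmfun (tf q b n).
Proof.
by apply: bmfunM; [apply: bmfun_horner; exact: bmfun_sc|exact: bmfun_tharm].
Qed.

(** By [leg_span] it suffices to take for [q] the derivatives of order [n] of Legendre polynomials,
    and then [tf q b n] is a nonzero multiple of a basis function, or zero when [n < b]. *)
Let Itf q b n : I (tf q b n) = 0.
Proof.
pose F q := I (tf q b n) = 0.
apply: (@leg_span R n F); rewrite /F.
- rewrite /I; under eq_Rintegral do rewrite /tf horner0 mul0r mulr0.
  by rewrite Rintegral_cst// mul0r.
- move=> p r p0 r0; rewrite -[RHS]addr0 -{1}p0 -r0 -ID//; congr I.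
  by apply/funext => x; rewrite /tf hornerD mulrDl.
- move=> c p p0; rewrite -[RHS](mulr0 c) -p0 -IZ//; congr I.
  by apply/funext => x; rewrite /tf hornerZ mulrA.
- move=> l nl; have [bn|bn] := leqP b n; last first.
    rewrite /I; under eq_Rintegral.
      move=> x _; rewrite /tf (_ : tharm b n x = 0) ?mulr0; first over.
      exact: tharm_eq0.
    by rewrite Rintegral_cst// mul0r.
  have v : valid (b, l, n) by rewrite /valid/= bn.
  have := f0 v; rewrite /coef /basis/=.
  set c := (_ * harm_cst R l n); rewrite -/(I (fun x => c * tf _ b n x)) IZ//.
  move/eqP; rewrite mulf_eq0 => /orP[|/eqP//].
  rewrite mulf_eq0 => /orP[|].
    by case: ifP; rewrite ?oner_eq0// (negbTE (sqrt2_neq0 R)).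
  rewrite mulf_eq0 expf_eq0 oppr_eq0 oner_eq0 andbF/= sqrtr_eq0 leNgt.
  by rewrite mulr_gt0// divr_gt0// ltr0n fact_gt0.
Qed.

(* [P] is stable under multiplication by coordinates and under bounded limits,
   hence by signs of affine functions of a coordinate and by indicators. *)
Let P (h : S2 -> R) := bmfun h /\ forall q b n, I (fun x => h x * tf q b n x) = 0.

Let P1 : P (fun=> 1).
Proof.
split=> [|q b n]; first exact: bmfun_cst.
by under [X in I X]eq_fun do rewrite mul1r; exact: Itf.
Qed.

Let PD h k : P h -> P k -> P (fun x => h x + k x).
Proof.
move=> [bh Ph] [bk Pk]; split=> [|q b n]; first exact: bmfunD.
under [X in I X]eq_fun do rewrite mulrDl.
by rewrite ID ?Ph ?Pk ?addr0//; exact: bmfunM.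
Qed.

Let PZ c h : P h -> P (fun x => c * h x).
Proof.
move=> [bh Ph]; split=> [|q b n]; first exact: bmfunZ.
under [X in I X]eq_fun do rewrite -mulrA.
by rewrite IZ ?Ph ?mulr0//; exact: bmfunM.
Qed.

Let PB h k : P h -> P k -> P (fun x => h x - k x).
Proof.
move=> Ph /(PZ (-1)) Pk; have := PD Ph Pk.
by under eq_fun do rewrite mulN1r.
Qed.

(** Multiplying [tf q b n] by a coordinate gives a combination of two functions of the same form;
    the quantification over all [q], [b], [n] in [P] covers both. *)
Let Psc j h : (j < 3)%N -> P h -> P (fun x => h x * sc j x).
Proof.
move=> j3 [bh Ph]; split=> [|q b n]; first by apply: bmfunM => //; exact: bmfun_sc.
have lin u v q1 b1 n1 q2 b2 n2 :
    (forall x, sc j x * tf q b n x = u * tf q1 b1 n1 x + v * tf q2 b2 n2 x) ->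
    I (fun x => h x * sc j x * tf q b n x) = 0.
  move=> e; under [X in I X]eq_fun => x.
    rewrite -mulrA e mulrDr (mulrCA (h x) u) (mulrCA (h x) v); over.
  rewrite ID ?IZ ?Ph ?mulr0 ?addr0//; try apply: bmfunZ; exact: bmfunM.
have eh x : (q * (1 - 'X^2)).[sc 2 x] = q.[sc 2 x] * (1 - sc 2 x ^+ 2).
  by rewrite hornerM !hornerE.
case: j j3 lin => [|[|[|//]]] _ lin.
(* Frequency 0 has no lower neighbour: the product is of frequency 1 for the cosine and vanishes for
   the sine, hence the coefficient [(~~ b)%:R]. *)
- case: n lin => [|n] lin.
    apply: (lin (~~ b)%:R 0 q false 1%N q b 0%N) => x.
    by rewrite /tf !(tharm0, tharmS)/= !expr1; ring.
  apply: (lin 2^-1 2^-1 q b n.+2 (q * (1 - 'X^2)) b n) => x.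
  rewrite /tf mulrCA tharm_step0 eh.
  by move: (tharm _ _ _) (tharm _ _ _) (_.[_]) (_ ^+ 2) => t1 t2 a c; ring.
- case: n lin => [|n] lin.
    apply: (lin (~~ b)%:R 0 q true 1%N q b 0%N) => x.
    by rewrite /tf !(tharm0, tharmS)/= !expr0; ring.
  apply: (lin ((-1) ^+ b * 2^-1) (- (-1) ^+ b * 2^-1) q (~~ b) n.+2
    (q * (1 - 'X^2)) (~~ b) n) => x.
  rewrite /tf mulrCA tharm_step1 eh.
  by move: (tharm _ _ _) (tharm _ _ _) (_.[_]) (_ ^+ 2) => t1 t2 a c; ring.
- apply: (lin 1 0 (q * 'X) b n q b n) => x.
  rewrite /tf [(q * 'X).[_]]hornerM hornerX.
  by move: (tharm _ _ _) (q.[_]) => t a; ring.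
Qed.

Let Ppoly j (p : {poly R}) h : (j < 3)%N -> P h -> P (fun x => h x * p.[sc j x]).
Proof.
move=> j3 Ph; elim/poly_ind: p => [|p c IH].
  under eq_fun do rewrite horner0 mulr0.
  by have := PZ 0 Ph; under eq_fun do rewrite mul0r.
under eq_fun do rewrite hornerMXaddC mulrDr mulrA (mulrC _ c).
by apply: PD; [exact: Psc|exact: PZ].
Qed.

Let Plim (hk : nat -> S2 -> R) h M : (forall k, P (hk k)) ->
  (forall k x, `|hk k x| <= M) -> (forall x, hk k x @[k --> \oo] --> h x) -> P h.
Proof.
move=> Ph hM hc.
have mh : measurable_fun setT h.
  by apply: (measurable_fun_cvg (fun k => (Ph k).1.1)) => x _; exact: hc.
have bh : bmfun h.
  split=> //; exists M => x.
  have /cvg_lim <- // : `|hk k x| @[k --> \oo] --> `|h x| by apply: cvg_norm; exact: hc.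
  apply: limr_le; first by apply/cvg_ex; exists `|h x|; apply: cvg_norm; exact: hc.
  by apply: nearW => k; exact: hM.
split=> // q b n.
have [mt [N tN]] := btf q b n.
have mf : measurable_fun setT f.
  by apply/measurable_EFinP; exact: measurable_int fint.
have := @dominated_convergence _ _ _ mu setT measurableT
  (fun k x => (f x * (hk k x * tf q b n x))%:E)
  (fun x => (f x * (h x * tf q b n x))%:E)
  (fun x => (`|f x| * (M * N))%:E).
case.
- move=> k; apply/measurable_EFinP; apply: measurable_funM => //.
  by apply: measurable_funM => //; exact: (Ph k).1.1.
- apply/measurable_EFinP; apply: measurable_funM => //.
  exact: measurable_funM.
- apply: aeW => x _; apply: cvg_EFin; first exact: nearW.
  apply: cvgMl_tmp; apply: cvgMr_tmp; exact: hc.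
- under eq_fun do rewrite EFinM.
  exact/integrableZr/integrable_norm.
- apply: aeW => x k _; rewrite abse_EFin lee_fin normrM ler_wpM2l// [`|hk k x * _|]normrM.
  exact: ler_pM.
move=> _ _ cv; rewrite /I /Rintegral.
have : (0%E : \bar R) @[k --> \oo] --> (\int[mu]_x (f x * (h x * tf q b n x))%:E)%E.
  apply: cvg_trans cv; apply: near_eq_cvg; apply: nearW => k.
  have := (Ph k).2 q b n; rewrite /I /Rintegral => e.
  have ii : mu.-integrable setT (EFin \o (fun x => f x * (hk k x * tf q b n x))).
    by apply: bmfun_integrableM => //; apply: bmfunM => //; exact: (Ph k).1.
  by have := fineK (integrable_fin_num measurableT ii); rewrite e => ei; exact: esym ei.
by move/cvg_lim => <-//; rewrite lim_cst.
Qed.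

Let Psg j c h : (j < 3)%N -> P h -> P (fun x => h x * Num.sg (sc j x - c)).
Proof.
move=> j3 Ph; have [_ [M hM]] := Ph.1.
(* Dividing by [1 + |c|] brings the affine function into [-1, 1], where the sign polynomials
   converge, without changing its sign. *)
have c0 : 0 < 1 + `|c| by rewrite ltr_pwDl.
pose z x := (1 + `|c|)^-1 * (sc j x - c).
have z1 x : `|z x| <= 1.
  rewrite normrM normfV (gtr0_norm c0) mulrC ler_pdivrMr// mul1r.
  by rewrite (le_trans (ler_normB _ _))// lerD2r sc_le1.
apply: (@Plim (fun k x => h x * (sgpoly R k).[z x]) _ M).
- move=> k; have := @Ppoly j (sgpoly R k \Po ((1 + `|c|)^-1 *: ('X - c%:P))) h j3 Ph.
  by under eq_fun do rewrite horner_comp !hornerE.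
- move=> k x; rewrite normrM -[M]mulr1 ler_pM//.
  exact: sgpoly_le1.
- move=> x; apply: cvgMl_tmp.
  have -> : Num.sg (sc j x - c) = Num.sg (z x).
    by rewrite sgrM [Num.sg (_^-1)]gtr0_sg ?invr_gt0// mul1r.
  exact: sgpoly_cvg.
Qed.

(** Requiring stability of [P] under multiplication by the indicator, rather than [P] for the
    indicator alone, makes intersections immediate and so gives a sigma-algebra. *)
Let ok (E : set S2) := measurable E /\ forall h, P h -> P (fun x => h x * \1_E x).

Let ok_gt j c : (j < 3)%N -> ok (sc j @^-1` `]c, +oo[).
Proof.
move=> j3; split.
  by rewrite -[X in measurable X]setTI; apply: (measurable_sc j3).
move=> h Ph; have Ps := Psg c j3 Ph; have Pss := Psg c j3 Ps.
(* The indicator of [s > 0] is [(sg s + sg s ^ 2) / 2], which is also right at [s = 0]. *)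
have := PZ 2^-1 (PD Ps Pss); congr P; apply/funext => x.
rewrite indicE (_ : (x \in _) = (0 < sc j x - c)); last first.
  by apply/idP/idP; rewrite inE/= in_itv/= andbT subr_gt0.
by have [z|z|<-] := ltgtP 0; rewrite ?(gtr0_sg z) ?(ltr0_sg z) ?sgr0/=; field.
Qed.

Let okC E : ok E -> ok (~` E).
Proof.
move=> [mE PE]; split; first exact: measurableC.
move=> h Ph; have := PB Ph (PE _ Ph); congr P; apply/funext => x.
by rewrite !indicE in_setC; case: (_ \in _); rewrite /=; ring.
Qed.

Let okU E F : ok E -> ok F -> ok (E `|` F).
Proof.
move=> [mE PE] [mF PF]; split; first exact: measurableU.
move=> h Ph; have := PB (PD (PE _ Ph) (PF _ Ph)) (PF _ (PE _ Ph)).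
congr P; apply/funext => x.
by rewrite !indicE in_setU; do 2 case: (_ \in _); rewrite /=; ring.
Qed.

Let ok0 : ok set0.
Proof.
split=> // h /(PZ 0); congr P; apply/funext => x.
by rewrite indic0 mulr0 mul0r.
Qed.

Let ok_bigcup (F : (set S2)^nat) : (forall k, ok (F k)) -> ok (\bigcup_k F k).
Proof.
move=> okF; split; first by apply: bigcupT_measurable => k; exact: (okF k).1.
have okG n : ok (\bigcup_(k < n) F k).
  elim: n => [|n IH]; first by rewrite bigcup_mkord big_ord0.
  by rewrite bigcup_mkord big_ord_recr/= -bigcup_mkord; exact: okU.
move=> h Ph; have [_ [M hM]] := Ph.1.
apply: (@Plim (fun n x => h x * \1_(\bigcup_(k < n) F k) x) _ M).
- by move=> n; exact: (okG n).2.
- move=> n x; rewrite normrM -[M]mulr1 ler_pM//.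
  by rewrite indicE; case: (_ \in _); rewrite ?normr1 ?normr0.
- move=> x; apply: cvgMl_tmp; apply: cvg_near_cst.
  have [[k _ Fk]|nF] := pselect ((\bigcup_k F k) x).
    near=> n; rewrite !indicE !mem_set//; first by exists k.
    by exists k => //=; near: n; exact: nbhs_infty_gt.
  apply: nearW => n; rewrite !indicE !memNset// => -[k _ Fk].
  by apply: nF; exists k.
Unshelve. all: by end_near. Qed.

Let ok_all E : measurable E -> ok E.
Proof.
apply: smallest_sub.
  by split; [exact: ok0|move=> A; rewrite setTD; exact: okC|exact: ok_bigcup].
rewrite -bigcup_mkord_ord => _ [j /= j3 [B mB <-]]; rewrite setTI.
change (ok (sc j @^-1` B)); move: B mB.
rewrite [measurable](RGenOInfty.measurableE R); apply: smallest_sub.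
  split => /=; first by rewrite preimage_set0.
  - by move=> A okA; rewrite setTD preimage_setC; exact: okC.
  - by move=> F okF; rewrite preimage_bigcup; exact: ok_bigcup.
by move=> _ [c ->]; exact: ok_gt.
Qed.

(** Testing [P] for an indicator against the constant function 1 shows that [f] has zero integral
    over every measurable set. *)
Lemma coef_eq0_ae : {ae mu, forall x, f x = 0}.
Proof.
have : ae_eq mu setT (EFin \o f) (cst 0%E).
  apply: integral_ae_eq => // E _ mE.
  have [_ /(_ _ P1)[_ /(_ 1 false 0%N)]] := ok_all mE.
  rewrite /I; under eq_Rintegral.
    move=> x _; rewrite mul1r /tf tharm0 hornerC !mulr1; over.
  move=> e; rewrite integral0 -[0%E]/(0%R%:E) -e.
  rewrite /Rintegral fineK; last first.
    by apply: integrable_fin_num => //; apply: bmfun_integrableM => //; exact: bmfun_indic.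
  rewrite integral_mkcond; apply: eq_integral => x _.
  by rewrite patchE indicE; case: (_ \in _); rewrite ?mulr1 ?mulr0.
by apply: filterS => x /(_ Logic.I) [].
Qed.

End completeness.

(** * Ornstein-Uhlenbeck paths *)

Section calculus.
Variable R : realType.
Local Notation leb := (@lebesgue_measure R).
Implicit Types (f g F : R -> R) (a b t x y : R).

(** Compactness of the segment in its near-covering form, the parameter being the modulus [r]; only
    [x] is confined to the segment. *)
Lemma continuous_uniform_itv g a b e : continuous g -> 0 < e ->
  exists2 r, 0 < r & forall x y, a <= x <= b -> `|x - y| < r -> `|g x - g y| <= e.
Proof.
move=> cg e0.
have := (compact_near_coveringP _).1 (@segment_compact R a b).
move=> /(_ R (0^'+) (fun r x => forall y, `|x - y| < r -> `|g x - g y| <= e) _).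
case.
  move=> x _; have /cvgrPdist_lt/(_ (e / 2)) := cg x.
  rewrite divr_gt0// => /(_ isT)[r /= r0 hr].
  exists (ball x (r / 2), [set s | 0 < s < r / 2]).
    split; first by apply: nbhsx_ballx; rewrite divr_gt0.
    exists (r / 2) => /=; first by rewrite divr_gt0.
    by move=> s /=; rewrite sub0r normrN => + s0; rewrite s0 gtr0_norm.
  move=> [x' s] /= [xx' /andP[s0 sr]] y x'y.
  have h1 := hr x'; have h2 := hr y.
  rewrite (_ : g x' - g y = (g x - g y) - (g x - g x')); last ring.
  rewrite (le_trans (ler_normB _ _))// [leRHS]splitr lerD// ltW//.
    apply: h2; rewrite /= (_ : x - y = (x - x') + (x' - y)); last ring.
    rewrite (le_lt_trans (ler_normD _ _))// (splitr r) ltrD//.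
    exact: lt_trans sr.
  by apply: h1; rewrite /= (lt_trans xx')// ltr_pdivrMr// mulr_natr mulr2n ltrDl.
move=> r /= r0 H; exists (r / 2); first by rewrite divr_gt0.
move=> x y xab; apply: (H (r / 2)) => //=.
- by rewrite sub0r normrN gtr0_norm ?divr_gt0// ltr_pdivrMr// mulr_natr mulr2n ltrDl.
- by rewrite divr_gt0.
Qed.

Lemma Rintegral_FTC2_itv f F a b : a <= b -> continuous f ->
  (forall x, a <= x <= b -> is_derive x 1 F (f x)) ->
  \int[leb]_(x in `[a, b]) f x = F b - F a.
Proof.
move=> ab cf dF.
have cF x : a <= x <= b -> {for x, continuous F}.
  by move=> /dF[? _]; apply/differentiable_continuous/derivable1_diffP.
move: ab; rewrite le_eqVlt => /predU1P[->|ab].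
  by rewrite set_itv1 Rintegral_set1 subrr.
rewrite /Rintegral (@continuous_FTC2 _ _ F) ?EFinB//=.
- exact: continuous_subspaceT.
- split.
  + by move=> x; rewrite in_itv/= => /andP[ax xb]; have [] := dF x; rewrite ?(ltW ax) ?ltW.
  + by apply/cvg_at_right_filter/cF; rewrite lexx ltW.
  + by apply/cvg_at_left_filter/cF; rewrite lexx ltW.
- move=> x; rewrite in_itv/= => /andP[ax xb]; rewrite derive1E.
  by have [] := dF x; rewrite ?(ltW ax) ?ltW.
Qed.

(* A primitive of f that is differentiable at every t > -1, in particular at
   the end point 0. *)
Definition prim f t := \int[leb]_(s in `[-1, t]) f s - \int[leb]_(s in `[-1, 0]) f s.

Lemma prim0 f : prim f 0 = 0.
Proof. by rewrite /prim subrr. Qed.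

Lemma is_derive_prim f t : continuous f -> 0 <= t -> is_derive t 1 (prim f) (f t).
Proof.
move=> cf t0; have t1 : -1 < t by rewrite (lt_le_trans _ t0)// ltrN10.
have [||d e] := @continuous_FTC1_closed _ f (-1) t (t + 1) _ _ t1 (cf t).
- by rewrite ltrDl.
- exact: continuous_integrable_itv.
pose F1 := fun t : R => \int[leb]_(s in `[-1, t]) f s.
have d1 : is_derive t 1 F1 (f t) := DeriveDef d (etrans (esym (derive1E _ _)) e).
rewrite -[f t]subr0.
exact: (@is_deriveB _ _ _ F1 (cst (\int[leb]_(s in `[-1, 0]) f s))).
Qed.

Lemma primE f t : continuous f -> 0 <= t -> prim f t = \int[leb]_(s in `[0, t]) f s.
Proof.
move=> cf t0; have h x : 0 <= x <= t -> is_derive x 1 (prim f) (f x).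
  by move=> /andP[x0 _]; exact: is_derive_prim.
by rewrite (Rintegral_FTC2_itv t0 cf h) prim0 subr0.
Qed.

(* One cell of a Riemann-Stieltjes sum; [G] is a primitive of [g df]. *)
Lemma rs_cell f df g G a b c e : a <= b ->
  (forall x, a <= x <= b -> is_derive x 1 f (df x)) ->
  (forall x, a <= x <= b -> 0 <= df x) ->
  (forall x, a <= x <= b -> is_derive x 1 G (df x * g x)) ->
  (forall x, a <= x <= b -> `|g x - c| <= e) ->
  `|G b - G a - c * (f b - f a)| <= e * (f b - f a).
Proof.
move=> ab df1 df0 dG gc.
(* With [k] equal to 1 or -1, one monotonicity argument yields both sides of the absolute value. *)
have mono k : (forall x, a <= x <= b -> 0 <= df x * (k * (g x - c) + e)) ->
    - (k * (G b - G a - c * (f b - f a))) <= e * (f b - f a).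
  move=> h; pose K := fun x => k *: (G x - c *: f x) + e *: f x.
  have dK x : a <= x <= b -> is_derive x 1 K (df x * (k * (g x - c) + e)).
    move=> xab; have d1 := df1 _ xab; have d2 := dG _ xab.
    by apply: trigger_derive; rewrite /GRing.scale/=; ring.
  have h1 x : x \in `]a, b[ -> is_derive x 1 K (df x * (k * (g x - c) + e)).
    by rewrite in_itv/= => /andP[ax xb]; apply: dK; rewrite !ltW.
  have h2 : {within `[a, b], continuous K}.
    apply: derivable_within_continuous => x; rewrite in_itv/= => xab.
    by have [] := dK _ xab.
  have [x xab eK] := MVT_segment ab h1 h2.
  have : 0 <= K b - K a.
    by rewrite eK mulr_ge0 ?subr_ge0//; apply: h; move: xab; rewrite in_itv.
  rewrite /K /GRing.scale/=; lra.
rewrite ler_norml; apply/andP; split.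
- have := mono 1; rewrite mul1r => h; rewrite lerNl; apply: h => x xab.
  rewrite mulr_ge0 ?df0// mul1r; move: (gc _ xab); rewrite ler_norml; lra.
- have := mono (-1); rewrite mulN1r opprK; apply => x xab.
  rewrite mulr_ge0 ?df0// mulN1r; move: (gc _ xab); rewrite ler_norml; lra.
Qed.

(** Integration by parts puts the regularity on [f], the integrator [g] being only continuous, as
    fBm paths are. Split at its tag, a cell [[a, b]] contributes two errors: on the left piece [g]
    is compared with [g a], on the right piece with [g b]. *)
Lemma is_RS_integral_parts f df g G t : 0 <= t -> continuous g ->
  (forall x, 0 <= x <= t -> is_derive x 1 f (df x)) ->
  (forall x, 0 <= x <= t -> 0 <= df x) ->
  (forall x, 0 <= x <= t -> is_derive x 1 G (df x * g x)) ->
  is_RS_integral f g 0 t (f t * g t - f 0 * g 0 - (G t - G 0)).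
Proof.
move=> t0 cg df1 df0 dG e e0.
(* The cell errors add up to [e' * (f t - f 0)]; the summand 1 avoids a zero denominator and the
   factor 2 gives a strict inequality. *)
pose e' := e / (2 * (1 + `|f t - f 0|)).
have C0 : 0 < 1 + `|f t - f 0| by rewrite ltr_pwDl.
have e'0 : 0 < e' by rewrite divr_gt0// mulr_gt0.
have [r r0 hr] := continuous_uniform_itv 0 t cg e'0.
exists r => // s xi x ps hx.
pose h y := f y * g y - G y.
have x0 : x 0%N = 0 by [].
have xn : x (size s) = t by exact: itv_partition_nth_size.
have tel u : \sum_(k < size s) (u (x k.+1) - u (x k)) = u t - u 0 :> R.
  by rewrite -xn -{2}x0 -(big_mkord xpredT (fun k => u (x k.+1) - u (x k)))
    (telescope_sumr (fun k => u (x k))).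
have -> : f t * g t - f 0 * g 0 - (G t - G 0) = h t - h 0 by rewrite /h; ring.
rewrite -tel -sumrB; apply: (@le_lt_trans _ _ (e' * (f t - f 0))); last first.
  apply: (@le_lt_trans _ _ (e' * (1 + `|f t - f 0|))).
    by rewrite ler_pM2l// (le_trans (ler_norm _))// lerDr.
  by rewrite /e' invfM mulrA divfK ?gt_eqF// ltr_pdivrMr// mulr_natr mulr2n ltrDl.
rewrite -tel mulr_sumr (le_trans (ler_norm_sum _ _ _))// ler_sum// => k _.
have [/andP[xk xk1] d] := hx k (ltn_ord k).
have b0 : 0 <= x k by apply: (itv_partition_nth_ge _ ps); rewrite ltnS ltnW.
have b1 : x k.+1 <= t by apply: (itv_partition_nth_le _ ps); rewrite ltnS.
move: (x k) (x k.+1) (xi k) xk xk1 d b0 b1 => a b c ac cb d a0 bt.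
have sub y : a <= y <= b -> 0 <= y <= t.
  by move=> /andP[ay yb]; rewrite (le_trans a0)//= (le_trans yb).
have := @rs_cell f df g G c b (g b) e' cb.
have := @rs_cell f df g G a c (g a) e' ac.
have s1 y : a <= y <= c -> 0 <= y <= t.
  by move=> /andP[ay yb]; apply: sub; rewrite ay/= (le_trans yb).
have s2 y : c <= y <= b -> 0 <= y <= t.
  by move=> /andP[ay yb]; apply: sub; rewrite yb andbT (le_trans _ ay).
move=> H1 H2.
have {}H1 : `|G c - G a - g a * (f c - f a)| <= e' * (f c - f a).
  apply: H1 => y yy; [exact/df1/s1|exact/df0/s1|exact/dG/s1|].
  apply: hr; first exact: s1.
  move: yy => /andP[ay yc]; rewrite ger0_norm ?subr_ge0//.
  by rewrite (le_lt_trans _ d)// lerD2r (le_trans yc).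
have {}H2 : `|G b - G c - g b * (f b - f c)| <= e' * (f b - f c).
  apply: H2 => y yy; [exact/df1/s2|exact/df0/s2|exact/dG/s2|].
  apply: hr; first exact: s2.
  move: yy => /andP[ay yc]; rewrite distrC ger0_norm ?subr_ge0//.
  by rewrite (le_lt_trans _ d)// lerD2l lerN2 (le_trans ac).
rewrite (_ : _ - _ = (G c - G a - g a * (f c - f a)) + (G b - G c - g b * (f b - f c))); last first.
  by rewrite /h; ring.
rewrite (le_trans (ler_normD _ _))// (le_trans (lerD H1 H2))//.
by rewrite -mulrDr addrC subrKA.
Qed.

Lemma is_RS_integral_ext f g h a b i :
  (forall x, a <= x <= b -> g x = h x) ->
  is_RS_integral f g a b i -> is_RS_integral f h a b i.
Proof.
move=> gh H e /H[r r0 hr]; exists r => // s xi x ps hx.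
have := hr s xi ps hx; rewrite -/x; congr (`|_ - _| < _).
apply: eq_bigr => k _; have kb : (k < (size s).+1)%N by rewrite ltnS ltnW.
by rewrite !gh// ?(itv_partition_nth_ge _ ps) ?(itv_partition_nth_le _ ps)// ltnS.
Qed.

Lemma fine_partition_exists a b r : a <= b -> 0 < r ->
  exists2 s : seq R, itv_partition a b s &
    forall k, (k < size s)%N ->
      nth b (a :: s) k <= nth b (a :: s) k.+1 /\
      nth b (a :: s) k.+1 - nth b (a :: s) k < r.
Proof.
rewrite le_eqVlt => /predU1P[->|ab] r0.
  by exists [::] => //; split.
pose n := (Num.truncn ((b - a) / r)).+1.
have n0 : 0 < n%:R :> R by rewrite ltr0n.
have nr : (b - a) / n%:R < r.
  rewrite ltr_pdivrMr// mulrC -ltr_pdivrMr//.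
  exact: Num.Theory.truncnS_gt.
pose p k := a + (b - a) * (k%:R / n%:R).
have dp k : p k.+1 - p k = (b - a) / n%:R.
  by rewrite /p -natr1; field; rewrite gt_eqF.
have pn : p n = b by rewrite /p divff ?gt_eqF// mulr1 addrC subrK.
have p0 : p 0%N = a by rewrite /p mul0r mulr0 addr0.
have dp0 : 0 < (b - a) / n%:R by rewrite divr_gt0// subr_gt0.
pose s := [seq p k.+1 | k <- iota 0 n].
have ss : size s = n by rewrite size_map size_iota.
have e k : (k <= n)%N -> nth b (a :: s) k = p k.
  case: k => [|k kn]; first by rewrite p0.
  by rewrite /= (nth_map 0%N) ?size_iota// nth_iota.
exists s; last first.
  move=> k; rewrite ss => kn; rewrite !e// ?(ltnW kn)// dp; split => //.
  by rewrite -subr_ge0 dp ltW.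
split.
  apply/(pathP b) => k; rewrite ss => kn.
  by have := e k (ltnW kn); have := e k.+1 kn => /= -> ->; rewrite -subr_gt0 dp.
by rewrite (last_nth b) ss e// pn.
Qed.

(** A partition finer than both moduli compares two candidate values, so [get] has no choice. *)
Lemma RS_integral_unique f g a b i : a <= b ->
  is_RS_integral f g a b i -> RS_integral f g a b = i.
Proof.
move=> ab hi; apply: get_unique => // j hj.
apply/eqP; rewrite -subr_eq0 -normr_le0 leNgt; apply/negP => d0.
have d2 : 0 < `|j - i| / 2 by rewrite divr_gt0.
have [r r0 hr] := hi _ d2; have [r' r'0 hr'] := hj _ d2.
have rr : 0 < Num.min r r' by rewrite lt_min r0.
have [s ps hs] := fine_partition_exists ab rr.
have h1 : `|\sum_(k < size s) f (nth b (a :: s) k) *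
    (g (nth b (a :: s) k.+1) - g (nth b (a :: s) k)) - i| < `|j - i| / 2.
  apply: (hr s (nth b (a :: s)) ps) => k /hs[xk]; rewrite lt_min => /andP[? _].
  by rewrite lexx xk.
have h2 : `|\sum_(k < size s) f (nth b (a :: s) k) *
    (g (nth b (a :: s) k.+1) - g (nth b (a :: s) k)) - j| < `|j - i| / 2.
  apply: (hr' s (nth b (a :: s)) ps) => k /hs[xk]; rewrite lt_min => /andP[_ ?].
  by rewrite lexx xk.
have := ltrD h1 h2; rewrite -splitr ltNge => /negP; apply.
by rewrite distrC -[i - j](subrKA (\sum_(k < size s) f (nth b (a :: s) k) *
    (g (nth b (a :: s) k.+1) - g (nth b (a :: s) k))))
  (le_trans (ler_normD _ _))// lerD2r distrC.
Qed.

Lemma is_derive_expR_lin (c t : R) :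
  is_derive t 1 (fun s : R => expR (c * s)) (c * expR (c * t)).
Proof.
have d1 : is_derive t 1 (fun s : R => c * s) c.
  by apply: trigger_derive; rewrite /GRing.scale/=; ring.
by apply: trigger_derive; rewrite mulrC.
Qed.

Lemma continuous_expR_lin (c : R) : continuous (fun s : R => expR (c * s)).
Proof.
move=> t; apply/differentiable_continuous/derivable1_diffP.
by have [] := is_derive_expR_lin c t.
Qed.

End calculus.

Lemma continuous_abs_comp (R : realType) (h : R -> R) (t : R) :
  {for `|t|, continuous h} -> {for t, continuous (fun s => h `|s|)}.
Proof. by move=> ch; apply: continuous_comp => //; exact: norm_continuous. Qed.

Section ornstein_uhlenbeck.
Variable R : realType.
Local Notation leb := (@lebesgue_measure R).
Variables (a : R) (g : R -> R).
Hypothesis a0 : 0 <= a.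
Hypothesis cg : continuous g.
Hypothesis g0 : g 0 = 0.

Let k s := expR (a * s) * g s.

Let ck : continuous k.
Proof.
by move=> t; apply: cvgM; [exact: continuous_expR_lin|exact: cg].
Qed.

(** The integral of [expR (- a * (t - s))] against [dg(s)] after integration by parts, so that only
    an ordinary integral of [g] remains. *)
Definition ou t := g t - a * expR (- a * t) * prim k t.

Lemma RS_integral_ou t : 0 <= t ->
  RS_integral (fun s => expR (- a * (t - s))) g 0 t = ou t.
Proof.
move=> t0; apply: RS_integral_unique => //.
pose f s := expR (- a * (t - s)).
pose G := fun s => (a * expR (- a * t)) *: prim k s.
have -> : ou t = f t * g t - f 0 * g 0 - (G t - G 0).
  by rewrite /ou /f /G subrr mulr0 expR0 g0 prim0 scaler0 /GRing.scale/=; ring.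
have fm s : f s = expR (- a * t) * expR (a * s).
  by rewrite -expRD /f; congr expR; ring.
have d1 (s : R) : is_derive s 1 (fun s : R => expR (- a * t)%R *: expR (a * s) : R) (a * f s).
  have d := is_derive_expR_lin a s; apply: trigger_derive.
  by rewrite fm /GRing.scale/=; ring.
have fE : f = (fun s => expR (- a * t)%R *: expR (a * s) : R).
  by apply/funext => s; rewrite fm.
have h1 s : 0 <= s <= t -> is_derive s 1 f (a * f s) by move=> _; rewrite {1}fE.
have h2 s : 0 <= s <= t -> 0 <= a * f s by move=> _; rewrite mulr_ge0// expR_ge0.
have h3 s : 0 <= s <= t -> is_derive s 1 G (a * f s * g s).
  move=> /andP[s0 _]; have dp := is_derive_prim ck s0.
  by apply: trigger_derive; rewrite fE /GRing.scale/= /k; ring.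
exact: is_RS_integral_parts t0 cg h1 h2 h3.
Qed.

Lemma continuous_ou_abs : continuous (fun t : R => ou `|t|).
Proof.
move=> t.
have cp : {for `|t|, continuous (prim k)}.
  have [d _] := is_derive_prim ck (normr_ge0 t).
  exact/differentiable_continuous/derivable1_diffP.
apply: (@continuous_abs_comp _ ou); apply: cvgB; first exact: cg.
apply: cvgM; last exact: cp.
by apply: cvgMl_tmp; exact: continuous_expR_lin.
Qed.

Let c K r t := K * expR (- a * t) + r * ou t.

Let ccabs K r : continuous (fun t : R => c K r `|t|).
Proof.
move=> t; apply: cvgD; last by apply: cvgMl_tmp; exact: continuous_ou_abs.
apply: cvgMl_tmp.
by apply: (@continuous_abs_comp _ (fun s => expR (- a * s))); exact: continuous_expR_lin.
Qed.

Lemma ou_integrable K r t :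
  leb.-integrable `[0, t] (EFin \o (fun s => K * expR (- a * s) + r * ou s)).
Proof.
have := continuous_integrable_itv 0 t (@ccabs K r); apply: eq_integrable => //.
by move=> s; rewrite inE/= in_itv/= => /andP[s0 _]; rewrite /= ger0_norm.
Qed.

Lemma ou_integral_equation K r t : 0 <= t ->
  K * expR (- a * t) + r * ou t =
  K - a * (\int[leb]_(s in `[0, t]) (K * expR (- a * s) + r * ou s)) + r * g t.
Proof.
move=> t0; rewrite -RintegralZl//; last exact: ou_integrable.
(* A primitive of [a] times the integrand: in the second summand the factors [expR (- a * s)] and
   [k s] multiply to [g s], which produces [ou]. *)
pose F := fun s => - K *: expR (- a * s) + (r * a) *: (expR (- a * s) * prim k s).
have dF s : 0 <= s <= t -> is_derive s 1 F (a * c K r `|s|).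
  move=> /andP[s0 _]; rewrite (ger0_norm s0); have d1 := is_derive_prim ck s0.
  have d2 := is_derive_expR_lin (- a) s.
  have xy : expR (- a * s) * expR (a * s) = 1 by rewrite -expRD mulNr addNr expR0.
  have kE : k s = expR (a * s) * g s by [].
  apply: trigger_derive; rewrite /GRing.scale/= kE /c /ou.
  apply/eqP; rewrite -subr_eq0; apply/eqP.
  transitivity (r * a * g s * (expR (- a * s) * expR (a * s) - 1)); last first.
    by rewrite xy subrr mulr0.
  by move: (expR _) (expR _) (prim _ _) => x y p; ring.
have ca : continuous (fun s : R => a * c K r `|s|).
  by move=> s; apply: cvgMl_tmp; exact: ccabs.
have -> : \int[leb]_(s in `[0, t]) (a * (K * expR (- a * s) + r * ou s)) = F t - F 0.
  rewrite -(Rintegral_FTC2_itv t0 ca dF); apply: eq_Rintegral => s.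
  by rewrite inE/= in_itv/= => /andP[s0 _]; rewrite ger0_norm.
by rewrite /F /ou prim0 !mulr0 expR0 scaler0 /GRing.scale/=; ring.
Qed.

End ornstein_uhlenbeck.

Section gronwall.
Variable R : realType.
Local Notation leb := (@lebesgue_measure R).

(** The equation for [D] holds only almost everywhere, but its integral [F] is continuous and
    satisfies [F' = - a F] at every interior point. *)
Lemma volterra_unique (a T : R) (D : R -> R) : 0 <= T ->
  leb.-integrable `[0, T] (EFin \o D) ->
  {ae leb, forall s, s \in `[0, T] -> D s = - a * \int[leb]_(r in `[0, s]) D r} ->
  \int[leb]_(r in `[0, T]) D r = 0.
Proof.
rewrite le_eqVlt => /predU1P[<-|T0] iD aeD; first by rewrite set_itv1 Rintegral_set1.
pose F s := \int[leb]_(r in `[0, s]) D r.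
have cF : {within `[0, T], continuous F}.
  exact: parameterized_integral_continuous (ltW T0) iD.
have iF : leb.-integrable `[0, T] (EFin \o F).
  by apply: continuous_compact_integrable => //; exact: segment_compact.
have iaF : leb.-integrable `[0, T] (EFin \o (fun s => - a * F s)).
  rewrite (_ : EFin \o _ = (fun x => (- a)%:E * (EFin \o F) x)%E); last first.
    by apply/funext => x; rewrite /= EFinM.
  exact: integrableZl.
have FE s : s \in `[0, T] -> F s = \int[leb]_(r in `[0, s]) (- a * F r).
  rewrite in_itv/= => /andP[s0 sT].
  have sub : `[0, s]%classic `<=` `[0, T]%classic.
    by move=> r /=; rewrite !in_itv/= => /andP[-> rs]; rewrite (le_trans rs).
  rewrite /F /Rintegral; congr fine; apply: ae_eq_integral => //.
  - by have m := measurable_int _ iD; exact: measurable_funS m.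
  - by have m := measurable_int _ iaF; exact: measurable_funS m.
  - move: aeD; apply: filterS; first exact: (ae_filter_ringOfSetsType leb).
    by move=> r h rs /=; congr EFin; apply: h; exact: sub.
have dF s : s \in `]0, T[ -> is_derive s 1 (fun s => \int[leb]_(r in `[0, s]) (- a * F r)) (- a * F s).
  move=> s0T; move: (s0T); rewrite in_itv/= => /andP[s0 sT].
  have cs : {for s, continuous (fun s => - a * F s)}.
    by apply: cvgMl_tmp; exact: (within_continuous_continuous T0 cF s0T).
  have [d e] := @continuous_FTC1_closed _ (fun s => - a * F s) 0 s T sT iaF s0 cs.
  exact: DeriveDef d (etrans (esym (derive1E _ _)) e).
have dF' s : s \in `]0, T[ -> is_derive s 1 F (- a * F s).
  move=> s0T; apply: near_eq_is_derive (dF _ s0T).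
  near=> r; apply/esym/FE/subset_itv_oo_cc; near: r.
  exact: near_in_itvoo.
(* [F' = - a F], so that [expR (a * s) * F s] is constant. *)
pose K := fun s => expR (a * s) * F s.
have dK s : s \in `]0, T[ -> is_derive s 1 K 0.
  move=> /dF' d1.
  have d2 : is_derive s 1 (fun s => a * s) a.
    by apply: trigger_derive; rewrite /GRing.scale/=; ring.
  by apply: trigger_derive; rewrite /GRing.scale/=; ring.
have cK : {within `[0, T], continuous K}.
  move=> s; apply: cvgM; last exact: cF.
  exact/continuous_subspaceT/continuous_expR_lin.
have [s _] := MVT T0 dK cK.
rewrite /K mul0r {2}/F set_itv1 Rintegral_set1 mulr0 subr0.
by move/eqP; rewrite mulf_eq0 gt_eqF ?expR_gt0//= => /eqP.
Unshelve. all: by end_near. Qed.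

End gronwall.

(** * Measure-theoretic complements *)

Section integral_complements.
Context d (T : measurableType d) (R : realType).
Variable mu : {measure set T -> \bar R}.
Implicit Types f g : T -> R.

(* [fine] sends infinite integrals to 0. *)
Lemma Rintegral_not_integrable D f : measurable D -> measurable_fun D f ->
  ~ mu.-integrable D (EFin \o f) -> \int[mu]_(x in D) f x = 0.
Proof.
move=> mD mf nif; rewrite /Rintegral.
have [fin|] := boolP ((\int[mu]_(x in D) (f x)%:E)%E \is a fin_num); last first.
  by rewrite fin_numE negb_and !negbK => /orP[/eqP ->|/eqP ->].
exfalso; apply: nif; apply/integrableP; split; first exact/measurable_EFinP.
by apply/abse_integralP => //; [exact/measurable_EFinP|rewrite -fin_num_abs].
Qed.

Lemma integrableZ_iff D f (c : R) : measurable D -> c != 0 ->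
  mu.-integrable D (EFin \o (fun x => c * f x)) <-> mu.-integrable D (EFin \o f).
Proof.
move=> mD c0; have Z (k : R) g : mu.-integrable D (EFin \o g) ->
    mu.-integrable D (EFin \o (fun x => k * g x)).
  move=> ig; rewrite (_ : EFin \o _ = (fun x => k%:E * (EFin \o g) x)%E).
    exact: integrableZl.
  by apply/funext => x; rewrite /= EFinM.
split; last exact: Z.
move/(Z c^-1); congr (_.-integrable _ _); apply/funext => x /=.
by rewrite mulrA mulVf// mul1r.
Qed.

(** Without integrability both sides are 0 by [Rintegral_not_integrable]; this allows
    [fourier_coefE] for every measurable function. *)
Lemma RintegralZl_measurable D f c : measurable D -> measurable_fun D f ->
  \int[mu]_(x in D) (c * f x) = c * \int[mu]_(x in D) f x.
Proof.
move=> mD mf; have [->|c0] := eqVneq c 0.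
  under eq_Rintegral do rewrite mul0r.
  by rewrite Rintegral_cst// !mul0r.
have [fi|nfi] := pselect (mu.-integrable D (EFin \o f)); first exact: RintegralZl.
rewrite !Rintegral_not_integrable ?mulr0//; first exact: measurable_funM.
by move/integrableZ_iff => /(_ mD c0).
Qed.

Import HBNNSimple.

(* No measurability is required here: an integral of a nonnegative function is
   a supremum over the simple functions below it. *)
Lemma ge0_integral_eq_off (N : set T) (f g : T -> \bar R) :
  measurable N -> mu N = 0%E -> (forall x, 0 <= f x)%E -> (forall x, 0 <= g x)%E ->
  (forall x, ~ N x -> f x = g x) -> (\int[mu]_x f x = \int[mu]_x g x)%E.
Proof.
move=> mN muN f0 g0 fg.
suff H (u v : T -> \bar R) : (forall x, 0 <= u x)%E -> (forall x, 0 <= v x)%E ->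
    (forall x, ~ N x -> u x = v x) -> (\int[mu]_x u x <= \int[mu]_x v x)%E.
  by apply/eqP; rewrite eq_le !H// => x Nx; rewrite fg.
move=> u0 v0 uv; rewrite ge0_integralTE// [leRHS]ge0_integralTE//.
apply: ge_ereal_sup => _ [h /= hu <-].
pose h' := mul_nnsfun h (indic_nnsfun R (measurableC mN)).
apply: ereal_sup_ubound; exists h' => /=.
  move=> x; rewrite /= mindicE in_setC; case: (boolP (x \in N)) => xN /=.
    by rewrite mulr0.
  by rewrite mulr1 -uv//; move/negP: xN => xN Nx; apply: xN; exact: mem_set.
rewrite -!integralT_nnsfun; apply: ae_eq_integral => //.
- exact/measurable_EFinP.
- exact/measurable_EFinP.
- exists N; split => // x /= /not_implyP[_]; apply: contra_notP => Nx.
  by rewrite /= mindicE in_setC memNset// mulr1.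
Qed.

Lemma ge0_integral_eq0_ae (f : T -> \bar R) : measurable_fun setT f ->
  (forall x, 0 <= f x)%E -> (\int[mu]_x f x = 0)%E -> {ae mu, forall x, f x = 0%E}.
Proof.
move=> mf f0 if0.
have [h _] := ae_eq_integral_abs mu measurableT mf.
suff /h : (\int[mu]_x `|f x| = 0)%E by apply: filterS => x /(_ Logic.I).
by under eq_integral do rewrite gee0_abs//.
Qed.

End integral_complements.

Section parameter_integrals.
Context d1 d2 (T1 : measurableType d1) (T2 : measurableType d2) (R : realType).

Lemma measurable_Rintegral_param (m2 : {sigma_finite_measure set T2 -> \bar R})
    (f : T1 * T2 -> R) : measurable_fun setT f ->
  measurable_fun setT (fun x => \int[m2]_y f (x, y)).
Proof.
move=> mf; rewrite /Rintegral; apply: measurableT_comp => //.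
under eq_fun do rewrite integralE.
have mE : measurable_fun setT (EFin \o f) by exact/measurable_EFinP.
have e1 : (fun x => (\int[m2]_y (fun y => (f (x, y))%:E)^\+ y)%E) = fubini_F m2 (EFin \o f)^\+%E.
  by apply/funext => x; apply: eq_integral => y _; rewrite !funeposE.
have e2 : (fun x => (\int[m2]_y (fun y => (f (x, y))%:E)^\- y)%E) = fubini_F m2 (EFin \o f)^\-%E.
  by apply/funext => x; apply: eq_integral => y _; rewrite !funenegE.
apply: emeasurable_funB.
- by rewrite e1; apply: measurable_fun_fubini_tonelli_F => //; exact: measurable_funepos.
- by rewrite e2; apply: measurable_fun_fubini_tonelli_F => //; exact: measurable_funeneg.
Qed.

(** Joint measurability makes the set of disagreement measurable; by Tonelli, if its sections in one
    direction are null, almost all sections in the other direction are null. *)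
Lemma ae_swap (m1 : {sigma_finite_measure set T1 -> \bar R})
    (m2 : {sigma_finite_measure set T2 -> \bar R}) (D : set T1) (f g : T1 * T2 -> R) :
  measurable D -> measurable_fun setT f -> measurable_fun setT g ->
  (forall x, D x -> {ae m2, forall y, f (x, y) = g (x, y)}) ->
  {ae m2, forall y, {ae m1, forall x, D x -> f (x, y) = g (x, y)}}.
Proof.
move=> mD mf mg H.
pose E := [set p | f p - g p != 0] `&` (D `*` setT).
have mE : measurable E.
  apply: measurableI; last exact: measurableX.
  have -> : [set p | f p - g p != 0] = (fun p => f p - g p) @^-1` ~` [set 0].
    by apply/seteqP; split => p /= /eqP.
  rewrite -[X in measurable X]setTI; apply: (measurable_funB mf mg) => //.
  by apply: measurableC; exact: measurable_set1.
pose h p : \bar R := (\1_E p)%:E.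
have mh : measurable_fun setT h by apply/measurable_EFinP/measurable_indic.
have h0 p : (0 <= h p)%E by rewrite lee_fin.
have mhx x : measurable_fun setT (fun y => h (x, y)) by exact: measurableT_comp.
have mhy y : measurable_fun setT (fun x => h (x, y)) by exact: measurableT_comp.
have z : (\int[m2]_y \int[m1]_x h (x, y) = 0)%E.
  rewrite -(fubini_tonelli (m1 := m1) (m2 := m2) h)//.
  apply: integral0_eq => x _.
  have [Dx|nDx] := pselect (D x); last first.
    apply: integral0_eq => y _; rewrite /h indicE memNset// => -[_ [/=]].
    by move=> /nDx.
  rewrite (ae_eq_integral (cst 0%E))//; first by rewrite integral0.
  apply: filterS (H x Dx) => y fg _; rewrite /h indicE memNset//.
  by rewrite /E /= fg subrr eqxx => -[].
have mk : measurable_fun setT (fun y => \int[m1]_x h (x, y))%E.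
  exact: (measurable_fun_fubini_tonelli_G (m1 := m1) h).
have k0 y : (0 <= \int[m1]_x h (x, y))%E by exact: integral_ge0.
apply: filterS (ge0_integral_eq0_ae mk k0 z) => y zy.
apply: filterS (ge0_integral_eq0_ae (mhy y) (fun x => h0 (x, y)) zy) => x + Dx.
rewrite /h indicE; have [//|nE _] := pselect (E (x, y)).
  by move=> Exy; rewrite mem_set// => -[] /eqP; rewrite oner_eq0.
apply/eqP; rewrite -subr_eq0; apply: contra_notT nE => fg; by split.
Qed.

End parameter_integrals.

Lemma cvg_floor_approx (R : realType) (s : R) :
  (Num.floor (n.+1%:R * s))%:~R / n.+1%:R @[n --> \oo] --> s.
Proof.
apply/cvgrPdist_le => e e0; near=> n.
have n0 : 0 < n.+1%:R :> R by rewrite ltr0n.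
have /andP[h1 h2] := floor_itv (n.+1%:R * s).
have -> : s - (Num.floor (n.+1%:R * s))%:~R / n.+1%:R =
    (n.+1%:R * s - (Num.floor (n.+1%:R * s))%:~R) / n.+1%:R.
  by field; rewrite gt_eqF.
rewrite ger0_norm; last by rewrite divr_ge0 ?subr_ge0// ltW.
rewrite (@le_trans _ _ n.+1%:R^-1)//.
  rewrite ler_pdivrMr// mulVf ?gt_eqF// lerBlDl ltW//.
  by move: h2; rewrite intrD.
by apply/ltW; near: n; exact: (near_infty_natSinv_lt (PosNum e0)).
Unshelve. all: by end_near. Qed.

(** Rounding the time down to the grid of mesh [1 / (n + 1)] gives countable unions of rectangles;
    path continuity passes to the limit. *)
Lemma measurable_continuous_paths d (T : measurableType d) (R : realType)
    (g : R -> T -> R) : (forall s, measurable_fun setT (g s)) ->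
  (forall w, continuous (g ^~ w)) ->
  measurable_fun setT (fun p : R * T => g p.1 p.2).
Proof.
move=> mg cg.
pose q n (s : R) : R := (Num.floor (n.+1%:R * s))%:~R / n.+1%:R.
pose h n (p : R * T) := g (q n p.1) p.2.
apply: (measurable_fun_cvg (h := h)).
  move=> n _ B mB; rewrite setTI.
  pose E (z : int) := ((fun s : R => n.+1%:R * s) @^-1` `[z%:~R, (z + 1)%:~R[) `*`
    (g (z%:~R / n.+1%:R) @^-1` B).
  have -> : h n @^-1` B = \bigcup_z E z.
    apply/seteqP; split => [[s w] /= hB|[s w] [z _ [/= + gB]]].
      exists (Num.floor (n.+1%:R * s)) => //; split => //=.
      by rewrite in_itv/= floor_itv.
    by rewrite in_itv/= /h /q /= => /floor_def ->.
  apply: countable_bigcupT_measurable => // z; apply: measurableX.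
    rewrite -[X in measurable X]setTI.
    by apply: measurable_funM => //; exact: measurable_itv.
  by rewrite -[X in measurable X]setTI; exact: mg.
move=> [s w] _ /=; rewrite /h /=.
exact: (cvg_comp _ _ (@cvg_floor_approx R s) (cg w s)).
Qed.

Section fast_convergence.
Context d (T : measurableType d) (R : realType).
Variable mu : {finite_measure set T -> \bar R}.
Variables (f : nat -> T -> R) (K : R).
Hypothesis mf : forall k, measurable_fun setT (f k).
Hypothesis fast : forall k,
  (\int[mu]_x ((f k.+1 x - f k x) ^+ 2)%:E <= (K * 4 ^- k)%:E)%E.

Let D k x := f k.+1 x - f k x.

Let mD k : measurable_fun setT (D k). Proof. exact: measurable_funB. Qed.

(* This turns summability of [2 ^ k * D k ^ 2] in mean into absolute
   convergence almost everywhere. *)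
Let D_le k x : `|D k x| <= 2 ^- k + 2 ^+ k * D k x ^+ 2.
Proof.
have p0 : 0 < 2 ^+ k :> R by rewrite exprn_gt0.
have [h|h] := leP `|D k x| (2 ^- k).
  by rewrite (le_trans h)// lerDl mulr_ge0 ?sqr_ge0// ltW.
rewrite (@le_trans _ _ (2 ^+ k * D k x ^+ 2))//; last by rewrite lerDr invr_ge0 ltW.
rewrite -real_normK ?num_real// expr2 mulrA ler_peMl//.
by rewrite -ler_pdivrMl// mulr1 ltW.
Qed.

(** The rate [4 ^- k] is chosen so that a summable [2 ^- k] survives the weight [2 ^+ k] of [D_le];
    the absolute value of [K] keeps the constant nonnegative. *)
Let int_D k : (\int[mu]_x `|D k x|%:E <=
  ((fine (mu setT) + `|K|) * 2 ^- k)%:E)%E.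
Proof.
apply: (@le_trans _ _ (\int[mu]_x ((2 ^- k)%:E + (2 ^+ k)%:E * (D k x ^+ 2)%:E))%E).
  apply: ge0_le_integral => //.
  - by apply/measurable_EFinP; exact: measurableT_comp.
  - apply: emeasurable_funD => //; apply: emeasurable_funM => //.
    by apply/measurable_EFinP; exact: measurable_funX.
  - by move=> x _; rewrite -EFinM -EFinD lee_fin D_le.
have mD2 : measurable_fun setT (fun x => (D k x ^+ 2)%:E).
  by apply/measurable_EFinP; exact: measurable_funX.
rewrite ge0_integralD//; last 2 first.
- move=> x _.
  have a1 : (0 <= ((2 : R) ^+ k)%:E)%E by rewrite lee_fin exprn_ge0.
  have a2 : (0 <= (D k x ^+ 2)%:E)%E by rewrite lee_fin sqr_ge0.
  exact: mule_ge0.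
- exact: emeasurable_funM.
rewrite integral_cst// ge0_integralZl//; last by move=> x _; rewrite lee_fin sqr_ge0.
rewrite mulrDl EFinD leeD//.
  by rewrite EFinM fineK ?fin_num_measure// muleC.
apply: (@le_trans _ _ ((2 ^+ k)%:E * (K * 4 ^- k)%:E)%E).
  by apply: lee_wpmul2l; [rewrite lee_fin exprn_ge0|exact: fast].
rewrite -EFinM lee_fin mulrCA (_ : 2 ^+ k * 4 ^- k = 2 ^- k :> R).
  by rewrite ler_wpM2r ?ler_norm// invr_ge0 exprn_ge0.
rewrite (_ : 4 = 2 * 2 :> R); last by ring.
by rewrite exprMn invfM mulrA divff ?mul1r// expf_neq0.
Qed.

Lemma fast_cvg_ae : {ae mu, forall x, cvgn (f ^~ x)}.
Proof.
pose S x := (\sum_(k <oo) `|D k x|%:E)%E.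
have mS : measurable_fun setT S.
  apply: ge0_emeasurable_sum => // k _.
  by apply/measurable_EFinP; exact: measurableT_comp.
have S0 x : (0 <= S x)%E by apply: nneseries_ge0.
have iS : mu.-integrable setT S.
  apply/integrableP; split=> //.
  under eq_integral do rewrite gee0_abs//.
  rewrite integral_nneseries//; last first.
    by move=> k; apply/measurable_EFinP; exact: measurableT_comp.
  pose c := fine (mu setT) + `|K|.
  have c0 : 0 <= c by rewrite addr_ge0 ?fine_ge0.
  apply: (@le_lt_trans _ _ (\sum_(k <oo) (c * 2 ^- k)%:E)%E).
    apply: lee_nneseries => [k _ _|k _].
      by apply: integral_ge0.
    exact: int_D.
  apply: (@le_lt_trans _ _ (c * 2)%:E); last by rewrite ltry.
  apply: lime_le.
    apply: is_cvg_nneseries => k _ _.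
    by rewrite lee_fin mulr_ge0// invr_ge0 exprn_ge0.
  apply: nearW => n; rewrite sumEFin lee_fin -mulr_sumr ler_wpM2l//.
  suff -> : \sum_(0 <= k < n) 2 ^- k = 2 - 2 * 2 ^- n :> R.
    by rewrite gerBl mulr_ge0// invr_ge0 exprn_ge0.
  elim: n => [|n IH]; first by rewrite big_geq// expr0 invr1 mulr1 subrr.
  rewrite big_nat_recr//= IH exprS invfM mulrA divff// mul1r; ring.
have := integrable_ae measurableT iS; apply: filterS => x /(_ Logic.I) Sx.
have cD : cvgn (series (D ^~ x)).
  apply: normed_cvg; apply: nondecreasing_is_cvgn.
    by apply/nondecreasing_seqP => n; rewrite /normed_series_of /series/= big_nat_recr//= lerDl.
  exists (fine (S x)) => _ [n _ <-] /=.
  rewrite -lee_fin fineK// /series/= -sumEFin.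
  by apply: nneseries_lim_ge.
have -> : f ^~ x = (fun n => f 0%N x + series (D ^~ x) n).
  by apply/funext => n; rewrite /series/= telescope_sumr// addrC subrK.
apply: is_cvgD => //; exact: is_cvg_cst.
Qed.

(* Measurable as it stands; a junk value where the sequence diverges. *)
Definition fast_lim x : R := fine (limn_esup (fun k => (f k x)%:E)).

Lemma measurable_fast_lim : measurable_fun setT fast_lim.
Proof.
apply: measurableT_comp => //; apply: measurable_fun_limn_esup => k.
exact/measurable_EFinP.
Qed.

Lemma fast_limE x : cvgn (f ^~ x) -> fast_lim x = limn (f ^~ x).
Proof.
move=> cf; rewrite /fast_lim.
have : (fun k => (f k x)%:E) @ \oo --> (limn (f ^~ x))%:E by apply: cvg_EFin; [exact: nearW|exact: cf].
by move/cvg_limn_einf_sup => [_ ->].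
Qed.

(** Fatou's lemma for the sequence without its first [n] terms. *)
Lemma fast_lim_le (g : T -> R) (M : \bar R) n : measurable_fun setT g ->
  (forall k, (n <= k)%N -> (\int[mu]_x ((f k x - g x) ^+ 2)%:E <= M)%E) ->
  (\int[mu]_x ((fast_lim x - g x) ^+ 2)%:E <= M)%E.
Proof.
move=> mg H.
pose h k x := ((f (k + n)%N x - g x) ^+ 2)%:E.
have mh k : measurable_fun setT (h k).
  by apply/measurable_EFinP; apply: measurable_funX; exact: measurable_funB.
have h0 k x : (0 <= h k x)%E by rewrite lee_fin sqr_ge0.
have hM k : (\int[mu]_x h k x <= M)%E by apply: H; rewrite leq_addl.
have -> : (\int[mu]_x ((fast_lim x - g x) ^+ 2)%:E = \int[mu]_x limn_einf (h ^~ x))%E.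
  apply: ae_eq_integral => //.
  - apply/measurable_EFinP; apply: measurable_funX; apply: measurable_funB => //.
    exact: measurable_fast_lim.
  - apply: measurableT_comp => //; apply: measurable_fun_limn_esup => k.
    exact: measurableT_comp.
  - apply: filterS fast_cvg_ae => x cx _; apply/esym.
    have : h ^~ x @ \oo --> ((fast_lim x - g x) ^+ 2)%:E.
      apply: cvg_EFin; first exact: nearW.
      rewrite fast_limE//; apply: cvgM; apply: cvgB; try exact: cvg_cst;
      by rewrite (cvg_shiftn n (f ^~ x)).
    by move/cvg_limn_einf_sup => [].
apply: (le_trans (fatou mu measurableT mh _)) => //.
rewrite limn_einf_lim; apply: lime_le; first exact: is_cvg_einfs.
by apply: nearW => k; apply: (le_trans _ (hM k)); apply: ereal_inf_lbound; exists k => /=.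
Qed.

End fast_convergence.

(** * Expansions of square-integrable fields *)

Section square_integrable.
Context d (T : measurableType d) (R : realType).

Lemma sq_integrable (mu : {finite_measure set T -> \bar R}) (f : T -> R) :
  measurable_fun setT f -> (\int[mu]_x (f x ^+ 2)%:E < +oo)%E ->
  mu.-integrable setT (EFin \o f).
Proof.
move=> mf if2; have mf2 : measurable_fun setT (EFin \o (fun x => f x ^+ 2)).
  by apply/measurable_EFinP; exact: measurable_funX.
have i2 : mu.-integrable setT (EFin \o (fun x => f x ^+ 2)).
  apply/integrableP; split => //; under eq_integral.
    by move=> x _; rewrite gee0_abs ?lee_fin ?sqr_ge0//; over.
  exact: if2.
have i1 : mu.-integrable setT (EFin \o (fun=> 1 : R)).
  by apply: bmfun_integrable; exact: bmfun_cst.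
apply: le_integrable (integrableD measurableT i1 i2) => //.
  exact/measurable_EFinP.
move=> x _; rewrite /= lee_fin (@ger0_norm _ (1 + _)); last by rewrite addr_ge0 ?sqr_ge0.
have := real_normK (num_real (f x)); have := sqr_ge0 (`|f x| - 1); nra.
Qed.

End square_integrable.

Lemma measurable_basis (R : realType) i : measurable_fun setT (@basis R i).
Proof. by have [] := bmfun_basis R i. Qed.

Section bessel.
Variable R : realType.
Local Notation mu := (@sphere_measure R).
Local Notation S2 := (sphere R).
Implicit Types (f g : S2 -> R) (s : seq (bool * nat * nat)).

Lemma coefB f g i : mu.-integrable setT (EFin \o f) ->
  mu.-integrable setT (EFin \o g) ->
  coef (fun x => f x - g x) i = coef f i - coef g i.
Proof.
move=> fi gi; rewrite /coef -RintegralB//; last 2 first.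
- by apply: bmfun_integrableM => //; exact: bmfun_basis.
- by apply: bmfun_integrableM => //; exact: bmfun_basis.
by apply: eq_Rintegral => x _; rewrite mulrBl.
Qed.

Lemma bessel s f : uniq s -> {in s, forall i, valid i} ->
  measurable_fun setT f ->
  ((\sum_(i <- s) coef f i ^+ 2)%:E <= \int[mu]_x (f x ^+ 2)%:E)%E.
Proof.
move=> us vs mf.
have [oo|fin] := leP +oo%E (\int[mu]_x (f x ^+ 2)%:E)%E.
  by rewrite (le_trans _ oo)// leey.
have fi := sq_integrable mf fin.
have mf2 : measurable_fun setT (EFin \o (fun x => f x ^+ 2)).
  by apply/measurable_EFinP; exact: measurable_funX.
have fi2 : mu.-integrable setT (EFin \o (fun x => f x ^+ 2)).
  apply/integrableP; split => //; under eq_integral.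
    by move=> x _; rewrite gee0_abs ?lee_fin ?sqr_ge0//; over.
  exact: fin.
pose g x : R := \sum_(i <- s) coef f i * basis i x.
have bg : bmfun g.
  by apply: bmfun_sum => i; apply: bmfunZ; exact: bmfun_basis.
have ifg : mu.-integrable setT (EFin \o (fun x => f x * g x)).
  exact: bmfun_integrableM.
have ig2 : mu.-integrable setT (EFin \o (fun x => g x ^+ 2)).
  by apply: bmfun_integrable; exact: bmfunX.
have fg : \int[mu]_x (f x * g x) = \sum_(i <- s) coef f i ^+ 2.
  transitivity (\int[mu]_x (\sum_(i <- s) coef f i * (f x * basis i x))).
    apply: eq_Rintegral => x _; rewrite /g mulr_sumr.
    by apply: eq_bigr => i _; rewrite mulrCA.
  have ib i : mu.-integrable setT (EFin \o (fun x => f x * basis i x)).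
    by apply: bmfun_integrableM => //; exact: bmfun_basis.
  have ic i : mu.-integrable setT (EFin \o (fun x => coef f i * (f x * basis i x))).
    have -> : (fun x => coef f i * (f x * basis i x)) =
        (fun x => f x * (coef f i * basis i x)) by apply/funext => x; rewrite mulrCA.
    by apply: bmfun_integrableM => //; apply: bmfunZ; exact: bmfun_basis.
  rewrite /Rintegral; under eq_integral do rewrite -sumEFin.
  rewrite integral_sum//.
  rewrite -sum_fine; last by move=> i _; exact: (integrable_fin_num measurableT (ic i)).
  apply: eq_bigr => i _; rewrite -[LHS]/(\int[mu]_x (coef f i * (f x * basis i x))).
  by rewrite RintegralZl// -expr2.
have : 0 <= \int[mu]_x ((f x - g x) ^+ 2).
  by apply: Rintegral_ge0 => x _; rewrite sqr_ge0.
have -> : \int[mu]_x ((f x - g x) ^+ 2) =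
    \int[mu]_x (f x ^+ 2) - \sum_(i <- s) coef f i ^+ 2.
  transitivity (\int[mu]_x ((f x ^+ 2 - f x * g x) + (g x ^+ 2 - f x * g x))).
    by apply: eq_Rintegral => x _; ring.
  have iB u v : mu.-integrable setT (EFin \o u) -> mu.-integrable setT (EFin \o v) ->
     mu.-integrable setT (EFin \o (fun x : S2 => u x - v x)).
    by move=> iu iv; exact: (integrableB measurableT iu iv).
  rewrite RintegralD//; [|exact: iB|exact: iB].
  rewrite RintegralB// RintegralB// fg parseval_sum//; ring.
rewrite subr_ge0 -lee_fin => /le_trans; apply.
by rewrite /Rintegral fineK//; exact: (integrable_fin_num measurableT fi2).
Qed.

End bessel.

Section levels.

(** The sine modes start at order 1, which leaves [2 l + 1] indices of degree [l]. *)
Definition lvl l : seq (bool * nat * nat) :=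
  [seq (false, l, m) | m <- iota 0 l.+1] ++ [seq (true, l, m) | m <- iota 1 l].

Definition lvls m n : seq (bool * nat * nat) :=
  flatten [seq lvl l | l <- index_iota m n].

Arguments lvl : simpl never.

Lemma mem_lvl i l : (i \in lvl l) = valid i && (i.1.2 == l).
Proof.
have h (b b' : bool) k m (s : seq nat) :
    ((b, k, m) \in [seq (b', l, j) | j <- s]) = [&& b == b', k == l & m \in s].
  by apply/mapP/and3P => [[j js [-> -> ->]]|[/eqP -> /eqP -> ms]]; [|exists m].
case: i => [[b k] m]; rewrite mem_cat !h !mem_iota /valid -[(b, k, m).1.2]/k.
by have [->|] := eqVneq k l; case: b => /=; lia.
Qed.

Lemma uniq_lvl l : uniq (lvl l).
Proof.
rewrite cat_uniq !map_inj_uniq; [|by move=> ? ? []|by move=> ? ? []].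
rewrite !iota_uniq andbT /=; apply/hasPn => _ /mapP[m _ ->].
by apply/mapP => -[].
Qed.

Lemma mem_lvls i m n : (i \in lvls m n) = valid i && (m <= i.1.2 < n)%N.
Proof.
apply/flatten_mapP/andP => [[l]|[vi li]].
  by rewrite mem_index_iota mem_lvl => ml /andP[vi /eqP ->].
by exists i.1.2; rewrite ?mem_index_iota// mem_lvl vi eqxx.
Qed.

Lemma uniq_lvls m n : uniq (lvls m n).
Proof.
rewrite /lvls /index_iota; move: (n - m)%N => k; elim: k m => // k IH m.
have -> : flatten [seq lvl l | l <- iota m k.+1] =
  lvl m ++ flatten [seq lvl l | l <- iota m.+1 k] by [].
rewrite cat_uniq uniq_lvl IH andbT /=; apply/hasPn => i /flatten_mapP[l].
rewrite mem_iota !mem_lvl => /andP[ml _] /andP[_ /eqP il]; rewrite il negb_and.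
by rewrite orbC gtn_eqF.
Qed.

Lemma lvls_valid m n : {in lvls m n, forall i, valid i}.
Proof. by move=> i; rewrite mem_lvls => /andP[]. Qed.

Lemma big_lvls (V : nmodType) (F : bool * nat * nat -> V) m n :
  \sum_(i <- lvls m n) F i = \sum_(m <= l < n) \sum_(i <- lvl l) F i.
Proof. by rewrite big_flatten big_map. Qed.

End levels.

Section L2_fields.
Context d (Omega : measurableType d) (R : realType) (P : probability Omega R).
Local Notation S2 := (sphere R).
Local Notation mu := (@sphere_measure R).
Implicit Types (f g : Omega -> S2 -> R) (c : bool * nat * nat -> Omega -> R).

Lemma field_section f w : random_field f -> measurable_fun setT (f w).
Proof. by move=> mf; exact: measurableT_comp mf (pair1_measurable w). Qed.

Lemma measurable_sq_field (h : Omega * S2 -> R) : measurable_fun setT h ->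
  measurable_fun setT (fun p => (h p ^+ 2)%:E).
Proof. by move=> mh; apply/measurable_EFinP; exact: measurable_funX. Qed.

Lemma measurable_coef f i : random_field f ->
  measurable_fun setT (fun w => coef (f w) i).
Proof.
move=> mf; apply: (@measurable_Rintegral_param _ _ _ _ _ mu
  (fun p : Omega * S2 => f p.1 p.2 * basis i p.2)).
apply: measurable_funM => //.
exact: (measurableT_comp (@measurable_basis R i)
  (@measurable_snd _ _ Omega (sphere R))).
Qed.

Lemma sq_field_fubini (h : Omega * S2 -> R) : measurable_fun setT h ->
  (\int[P \x mu]_p (h p ^+ 2)%:E = \int[P]_w \int[mu]_x (h (w, x) ^+ 2)%:E)%E.
Proof.
move=> mh; rewrite fubini_tonelli1//; first exact: measurable_sq_field.
by move=> p; rewrite lee_fin sqr_ge0.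
Qed.

Lemma measurable_int_sq_field (h : Omega * S2 -> R) : measurable_fun setT h ->
  measurable_fun setT (fun w => \int[mu]_x (h (w, x) ^+ 2)%:E)%E.
Proof.
move=> mh; apply: (@measurable_fun_fubini_tonelli_F _ _ _ _ _ mu
  (fun p => (h p ^+ 2)%:E)); first exact: measurable_sq_field.
by move=> p; rewrite lee_fin sqr_ge0.
Qed.

Lemma L2_field_section f : L2_field P f ->
  {ae P, forall w, mu.-integrable setT (EFin \o f w)}.
Proof.
move=> [mf f2].
pose F w := (\int[mu]_x (f w x ^+ 2)%:E)%E.
have mF : measurable_fun setT F.
  exact: (measurable_int_sq_field (h := fun p => f p.1 p.2)).
have F0 w : (0 <= F w)%E by apply: integral_ge0 => x _; rewrite lee_fin sqr_ge0.
have : P.-integrable setT F.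
  apply/integrableP; split=> //; under eq_integral do rewrite gee0_abs//.
  rewrite -(sq_field_fubini (h := fun p => f p.1 p.2))//.
  by under eq_integral do rewrite -real_normK ?num_real//.
move/(integrable_ae measurableT); apply: filterS => w /(_ Logic.I) Fw.
apply: sq_integrable; first exact: field_section.
by rewrite -/(F w) -ge0_fin_numE.
Qed.

Lemma int_bessel s (h : Omega -> S2 -> R) : uniq s ->
  {in s, forall i, valid i} -> random_field h ->
  (\sum_(i <- s) \int[P]_w (coef (h w) i ^+ 2)%:E <=
   \int[P \x mu]_p (h p.1 p.2 ^+ 2)%:E)%E.
Proof.
move=> us vs mh; rewrite sq_field_fubini// -ge0_integral_sum//; last 2 first.
- by move=> i; apply/measurable_EFinP/measurable_funX; exact: measurable_coef.
- by move=> i w _; rewrite lee_fin sqr_ge0.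
apply: ge0_le_integral => //.
- by move=> w _; apply: sume_ge0 => i _; rewrite lee_fin sqr_ge0.
- apply: emeasurable_sum => i; apply/measurable_EFinP/measurable_funX.
  exact: measurable_coef.
- exact: (measurable_int_sq_field (h := fun p => h p.1 p.2)).
- by move=> w _; rewrite sumEFin; apply: bessel => //; exact: field_section.
Qed.

Definition hsum c m n w (x : S2) : R := \sum_(i <- lvls m n) c i w * basis i x.

Lemma random_field_hsum c m n : (forall i, measurable_fun setT (c i)) ->
  random_field (hsum c m n).
Proof.
move=> mc; apply: measurable_sum => i; apply: measurable_funM.
  exact: measurableT_comp.
exact: (measurableT_comp (@measurable_basis R i)
  (@measurable_snd _ _ Omega (sphere R))).
Qed.

Lemma bmfun_hsum c m n w : bmfun (hsum c m n w).
Proof. by apply: bmfun_sum => i; apply: bmfunZ; exact: bmfun_basis. Qed.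

Lemma hsum_norm c m n : (forall i, measurable_fun setT (c i)) ->
  (\int[P \x mu]_p (hsum c m n p.1 p.2 ^+ 2)%:E =
   \sum_(i <- lvls m n) \int[P]_w (c i w ^+ 2)%:E)%E.
Proof.
move=> mc; rewrite sq_field_fubini; last exact: random_field_hsum.
rewrite -ge0_integral_sum//; last 2 first.
- by move=> i; apply/measurable_EFinP/measurable_funX.
- by move=> i w _; rewrite lee_fin sqr_ge0.
apply: eq_integral => w _; rewrite sumEFin.
rewrite -(@parseval_sum R _ (c ^~ w)) ?uniq_lvls//; last exact: lvls_valid.
rewrite /Rintegral fineK//; apply: (@integrable_fin_num _ _ _ mu) => //.
by apply: (@bmfun_integrable _ _ _ mu); apply: bmfunX; exact: bmfun_hsum.
Qed.

Lemma coef_hsum c n w i : valid i -> (i.1.2 < n)%N -> coef (hsum c 0 n w) i = c i w.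
Proof.
move=> vi ni; rewrite (@coef_basis_sum _ _ (c ^~ w)) ?uniq_lvls//; last exact: lvls_valid.
by rewrite mem_lvls vi ni mul1r.
Qed.

Lemma hsumB c n m : (n <= m)%N -> forall w x,
  hsum c 0 m w x - hsum c 0 n w x = hsum c n m w x.
Proof.
move=> nm w x; rewrite /hsum !big_lvls (@big_cat_nat _ _ _ n 0 m)//=.
by rewrite [X in X - _]addrC addrK.
Qed.

Definition L2_expansion c f := L2_field P f /\
  (\int[P \x mu]_p ((hsum c 0 n p.1 p.2 - f p.1 p.2) ^+ 2)%:E @[n --> \oo] --> 0)%E.

(** Bessel's inequality for the single index [i] bounds the mean square error of the coefficient by
    the truncation error as soon as [n] exceeds the degree of [i]. *)
Lemma L2_expansion_coef c f i : (forall i, measurable_fun setT (c i)) ->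
  L2_expansion c f -> valid i -> {ae P, forall w, coef (f w) i = c i w}.
Proof.
move=> mc [Lf cvf] vi.
have mD n : random_field (fun w x => hsum c 0 n w x - f w x).
  by apply: measurable_funB; [exact: random_field_hsum|exact: Lf.1].
have mE : measurable_fun setT (fun w => ((coef (f w) i - c i w) ^+ 2)%:E).
  apply/measurable_EFinP/measurable_funX/measurable_funB => //.
  exact: measurable_coef Lf.1.
suff : (\int[P]_w ((coef (f w) i - c i w) ^+ 2)%:E = 0)%E.
  move/(ge0_integral_eq0_ae mE) => /(_ _)[].
    by move=> w; rewrite lee_fin sqr_ge0.
  move=> N [mN PN sN]; exists N; split => // w /= nw; apply: sN => /= -[] /eqP.
  by rewrite sqrf_eq0 subr_eq0 => /eqP.
apply/eqP; rewrite eq_le; apply/andP; split; last first.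
  by apply: integral_ge0 => w _; rewrite lee_fin sqr_ge0.
rewrite -(cvg_lim _ cvf)//; apply: lime_ge; first by apply/cvg_ex; eexists; exact: cvf.
near=> n.
have ni : (i.1.2 < n)%N by near: n; exact: nbhs_infty_gt.
have := @int_bessel [:: i] _ _ _ (mD n).
rewrite big_seq1 => H; apply: le_trans (H _ _) => //; last first.
  by move=> j; rewrite inE => /eqP ->.
rewrite le_eqVlt; apply/orP; left; apply/eqP; apply: ae_eq_integral => //.
  apply/measurable_EFinP/measurable_funX; exact: measurable_coef.
apply: filterS (L2_field_section Lf) => w fw _.
rewrite coefB//; last by apply: bmfun_integrable; exact: bmfun_hsum.
by rewrite coef_hsum// -sqrrN opprB.
Unshelve. all: by end_near. Qed.

Lemma L2_field_unique f g : L2_field P f -> L2_field P g ->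
  (forall i, valid i -> {ae P, forall w, coef (f w) i = coef (g w) i}) ->
  (\int[P \x mu]_p ((f p.1 p.2 - g p.1 p.2) ^+ 2)%:E = 0)%E.
Proof.
move=> Lf Lg fg.
have mfg : random_field (fun w x => f w x - g w x).
  exact: measurable_funB Lf.1 Lg.1.
rewrite (sq_field_fubini (h := fun p => f p.1 p.2 - g p.1 p.2))//.
rewrite (ae_eq_integral (cst 0%E)) ?integral0//.
  exact: (measurable_int_sq_field (h := fun p => (f p.1 p.2 - g p.1 p.2))).
(* Enumerating the indices with [unpickle] merges their null sets into one. *)
have fgn (n : nat) : {ae P, forall w, forall i, unpickle n = Some i -> valid i ->
    coef (f w) i = coef (g w) i}.
  case: (unpickle n) => [i|]; last by apply: aeW.
  have [vi|/negP nvi] := boolP (valid i); last by apply: aeW => w j [<-].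
  by apply: filterS (fg i vi) => w e j [<-].
have all_fg : {ae P, forall w, forall n i, unpickle n = Some i -> valid i ->
    coef (f w) i = coef (g w) i} by apply: ae_foralln.
near=> w => _ /=.
have fw : mu.-integrable setT (EFin \o f w) by near: w; exact: L2_field_section.
have gw : mu.-integrable setT (EFin \o g w) by near: w; exact: L2_field_section.
have e i : valid i -> coef (f w) i = coef (g w) i.
  have H : forall n i, unpickle n = Some i -> valid i -> coef (f w) i = coef (g w) i.
    by near: w.
  by move=> vi; apply: (H (pickle i)) => //; exact: pickleK.
rewrite (ae_eq_integral (cst 0%E)) ?integral0//.
  by apply/measurable_EFinP/measurable_funX; exact: (field_section w mfg).
have ifg : mu.-integrable setT (EFin \o (fun x => f w x - g w x)).
  exact: (integrableB measurableT fw gw).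
apply: filterS (coef_eq0_ae ifg _) => [x /= -> _|i vi]; first by rewrite expr0n.
by rewrite coefB// e// subrr.
Unshelve. all: by end_near. Qed.

(** Completeness makes [f] and [g] equal almost everywhere on the product space, so their truncation
    errors coincide. *)
Lemma L2_expansion_transfer c f g : (forall i, measurable_fun setT (c i)) ->
  L2_field P f -> L2_expansion c g ->
  (forall i, valid i -> {ae P, forall w, coef (f w) i = c i w}) ->
  L2_expansion c f.
Proof.
move=> mc Lf Eg fc; have [Lg cvg_g] := Eg; split => //.
have fg : (\int[P \x mu]_p ((f p.1 p.2 - g p.1 p.2) ^+ 2)%:E = 0)%E.
  apply: L2_field_unique => // i vi; have := L2_expansion_coef mc Eg vi.
  by apply: filterS2 (fc i vi) => w -> ->.
have mfg : measurable_fun setT (fun p : Omega * S2 => ((f p.1 p.2 - g p.1 p.2) ^+ 2)%:E).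
  by apply: measurable_sq_field; exact: measurable_funB Lf.1 Lg.1.
have ae_fg := ge0_integral_eq0_ae mfg (fun p => _) fg.
suff -> : (fun n => \int[P \x mu]_p ((hsum c 0 n p.1 p.2 - f p.1 p.2) ^+ 2)%:E)%E =
    (fun n => \int[P \x mu]_p ((hsum c 0 n p.1 p.2 - g p.1 p.2) ^+ 2)%:E)%E by [].
apply/funext => n; apply: ae_eq_integral => //.
- by apply: measurable_sq_field; apply: measurable_funB Lf.1; exact: random_field_hsum.
- by apply: measurable_sq_field; apply: measurable_funB Lg.1; exact: random_field_hsum.
- apply: filterS (ae_fg _) => [[w x] /= [] /eqP|p]; last by rewrite lee_fin sqr_ge0.
  by rewrite sqrf_eq0 subr_eq0 => /eqP ->.
Qed.

End L2_fields.

(** * Jointly measurable fields with prescribed coefficients *)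

Section riesz_fischer.
Context d (Omega : measurableType d) (R : realType) (P : probability Omega R).
Local Notation S2 := (sphere R).
Local Notation mu := (@sphere_measure R).
Variables (c : bool * nat * nat -> R -> Omega -> R) (K : R -> R) (b : nat -> R).
Hypothesis mc : forall i, measurable_fun setT (fun p : R * Omega => c i p.1 p.2).
Hypothesis K0 : forall t, 0 <= K t.
Hypothesis b0 : forall l, 0 <= b l.
Hypothesis cvb : cvgn (series b).
Hypothesis c_le : forall t l,
  (\sum_(i <- lvl l) \int[P]_w (c i t w ^+ 2)%:E <= (K t * b l)%:E)%E.

Let tail n := limn (series b) - series b n.

Let tail_cvg : tail n @[n --> \oo] --> 0.
Proof.
by rewrite -(subrr (limn (series b))); apply: cvgB => //; exact: cvg_cst.
Qed.

Let nd_b : nondecreasing_seq (series b).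
Proof. by apply/nondecreasing_seqP => n; rewrite /series/= big_nat_recr//= lerDl. Qed.

Let sum_le_tail n m : \sum_(n <= l < m) b l <= tail n.
Proof.
have bm k : series b k <= limn (series b) by exact: nondecreasing_cvgn_le.
have [nm|mn] := leqP n m; last by rewrite big_geq ?(ltnW mn)// subr_ge0.
by rewrite /tail -sub_series_geq// lerB.
Qed.

Let nd_tail n m : (n <= m)%N -> tail m <= tail n.
Proof. by move=> nm; rewrite lerB// nd_b. Qed.

Let mct t i : measurable_fun setT (c i t).
Proof. exact: measurableT_comp (mc i) (pair1_measurable t). Qed.

Let hs t n m p := hsum (fun i => c i t) n m p.1 (p.2 : S2).

Let hs_norm t n m :
  (\int[P \x mu]_p (hs t n m p ^+ 2)%:E <= (K t * tail n)%:E)%E.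
Proof.
rewrite hsum_norm// big_lvls.
apply: (@le_trans _ _ (\sum_(n <= l < m) (K t * b l)%:E)%E).
  by apply: lee_sum => l _; exact: c_le.
by rewrite sumEFin -mulr_sumr lee_fin ler_wpM2l.
Qed.

Let fast_index : exists n_ : nat -> nat, [/\ forall k, (k <= n_ k)%N,
  forall k, (n_ k <= n_ k.+1)%N & forall k, tail (n_ k) <= 4 ^- k].
Proof.
have /choice[q qP] k : exists n, tail n <= 4 ^- k.
  have : 0 < 4 ^- k :> R by rewrite invr_gt0 exprn_gt0.
  move=> e0; have /cvgrPdist_le/(_ _ e0)[n _ /(_ n (leqnn n))] := tail_cvg.
  by rewrite /= sub0r normrN => /(le_trans (ler_norm _)); exists n.
(* Summing the [q j] makes the index nondecreasing, and the summand [k] makes it diverge. *)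
exists (fun k => k + \sum_(j < k.+1) q j)%N; split => k.
- exact: leq_addr.
- by rewrite leq_add// [leqRHS]big_ord_recr leq_addr.
- by apply: le_trans (qP k); apply: nd_tail; rewrite big_ord_recr/= addnA leq_addl.
Qed.

(** In [c_le] the time enters only through the factor [K t], so the subsequence is chosen from the
    tails of [b] alone and a single function of time, chance and position is measurable at once. *)
Lemma riesz_fischer : exists X : R -> Omega -> S2 -> R,
  measurable_fun setT (fun p : R * Omega * S2 => X p.1.1 p.1.2 p.2) /\
  forall t, L2_expansion P (fun i => c i t) (X t).
Proof.
have [n_ [n_ge n_nd n_tail]] := fast_index.
pose F k (p : R * Omega * S2) := hs p.1.1 0 (n_ k) (p.1.2, p.2).
have mF k : measurable_fun setT (F k).
  apply: measurable_sum => i; apply: measurable_funM.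
    exact: (measurableT_comp (mc i) (@measurable_fst _ _ (R * Omega)%type S2)).
  exact: (measurableT_comp (@measurable_basis R i) (@measurable_snd _ _ (R * Omega)%type S2)).
exists (fun t w x => fast_lim F (t, w, x)); split.
  have -> : (fun p : R * Omega * S2 => fast_lim F (p.1.1, p.1.2, p.2)) = fast_lim F.
    by apply/funext => -[[]].
  exact: measurable_fast_lim.
move=> t; pose f k (p : Omega * S2) := hs t 0 (n_ k) p.
have mhs n m : measurable_fun setT (hs t n m) by exact: random_field_hsum.
have mf k : measurable_fun setT (f k) by exact: mhs.
have hsub n k p : (n <= n_ k)%N -> f k p - hs t 0 n p = hs t n (n_ k) p.
  by move=> nk; exact: hsumB.
pose m2 := [the probability _ _ of (P \x mu)%E].
have fast k : (\int[m2]_p ((f k.+1 p - f k p) ^+ 2)%:E <= (K t * 4 ^- k)%:E)%E.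
  under eq_integral do rewrite hsub//.
  by apply: (le_trans (hs_norm t _ _)); rewrite lee_fin ler_wpM2l.
have XE w x : fast_lim F (t, w, x) = fast_lim f (w, x) by [].
have le_tail n : (\int[P \x mu]_p ((fast_lim f p - hs t 0 n p) ^+ 2)%:E <=
    (K t * tail n)%:E)%E.
  apply: (fast_lim_le (n := n) mf fast) => // k nk.
  under eq_integral do rewrite hsub ?(leq_trans nk)//.
  exact: hs_norm.
split.
  split; first by have := measurable_fast_lim mf; congr measurable_fun; apply/funext => -[].
  under eq_integral do rewrite XE -surjective_pairing real_normK ?num_real//.
  apply: (@le_lt_trans _ _ (K t * tail 0)%:E); last by rewrite ltry.
  have := le_tail 0%N; congr (_ <= _)%E; apply: eq_integral => p _.
  by rewrite /hs /hsum /lvls /index_iota/= big_nil subr0.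
apply: (@squeeze_cvge _ _ _ _ (cst 0%E) _ (fun n => (K t * tail n)%:E)).
- apply: nearW => n; apply/andP; split.
    by apply: integral_ge0 => p _; rewrite lee_fin sqr_ge0.
  have := le_tail n; congr (_ <= _)%E; apply: eq_integral => -[w x] _.
  by rewrite -sqrrN opprB.
- exact: cvg_cst.
- apply: cvg_EFin; first exact: nearW.
  by rewrite -(mulr0 (K t)); apply: cvgM; [exact: cvg_cst|exact: tail_cvg].
Qed.

End riesz_fischer.

(** * From complex to real expansions *)

Lemma sum_m_sym (V : nmodType) l (F : int -> V) :
  sum_m l F = F 0 + \sum_(1 <= m < l.+1) (F m%:Z + F (- m%:Z)).
Proof.
elim: l => [|l IH].
  by rewrite big_geq// addr0 /sum_m big_ord1.
rewrite big_nat_recr//= addrA -IH /sum_m doubleS big_ord_recl big_ord_recr/=.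
rewrite addrC -addrA; congr (_ + (_ + _)).
- apply: eq_bigr => k _; congr F; rewrite /bump/=; lia.
- by congr F; rewrite /bump/=; lia.
- by congr F; lia.
Qed.

Lemma sum_lvl (V : nmodType) l (F : bool * nat * nat -> V) :
  \sum_(i <- lvl l) F i = F (false, l, 0%N) +
    \sum_(1 <= m < l.+1) (F (false, l, m) + F (true, l, m)).
Proof.
by rewrite /lvl big_cat !big_map /index_iota subn1/= big_cons -addrA big_split.
Qed.

Section complex_series.
Variable R : realType.
Local Notation S2 := (sphere R).

Lemma Re_real_conj (a : R) (z : R[i]) : complex.Re (a%:C * conjc z) = a * complex.Re z.
Proof. by case: z => x y /=; rewrite mul0r subr0. Qed.

Lemma Im_real_conj (a : R) (z : R[i]) : complex.Im (a%:C * conjc z) = - (a * complex.Im z).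
Proof. by case: z => x y /=; rewrite mul0r addr0 mulrN. Qed.

Lemma coef_true0 (f : S2 -> R) l : coef f (true, l, 0%N) = 0.
Proof.
rewrite /coef; under eq_Rintegral do rewrite basis_true0 mulr0.
by rewrite Rintegral_cst// mul0r.
Qed.

Lemma fourier_coefE (f : S2 -> R) l (m : int) : measurable_fun setT f ->
  (absz m <= l)%N -> fourier_coef f l m =
  (harm_re R m * coef f (false, l, absz m)) +i*
  (- harm_im R m * coef f (true, l, absz m)).
Proof.
move=> mf ml; rewrite /fourier_coef /Cintegral.
have mfb i : measurable_fun setT (fun x => f x * basis i x).
  by apply: measurable_funM => //; exact: measurable_basis.
rewrite -!RintegralZl_measurable//; congr Complex; apply: congr1;
  apply: eq_integral => x _; congr EFin.
- by rewrite Re_real_conj sph_harmE//= mulrCA.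
- by rewrite Im_real_conj sph_harmE//= mulNr mulrCA.
Qed.

Lemma real_harmonicsE d (T : measurableType d) (A : nat -> R) (c1 c2 : nat -> nat -> T -> R)
    l w x :
  real_harmonics A c1 c2 l w x = (\sum_(i <- lvl l)
    (Num.sqrt (A l) * (if i.1.1 then c2 else c1) i.1.2 i.2 w) * basis i x)%:C.
Proof.
rewrite sum_lvl /real_harmonics sph_harmE// mulr_sumr.
have -> : (harm_re R 0 * basis (false, l, `|0|%N) x +i*
    (harm_im R 0 * basis (true, l, `|0|%N) x)) = (basis (false, l, 0%N) x)%:C.
  by rewrite basis_true0 mulr0 mul1r.
have -> : \sum_(1 <= m < l.+1) ((Num.sqrt 2)%:C *
      ((c1 l m w)%:C * (complex.Re (sph_harm l m x))%:C +
       (c2 l m w)%:C * (complex.Im (sph_harm l m x))%:C)) =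
    (\sum_(1 <= m < l.+1) (c1 l m w * basis (false, l, m) x +
                           c2 l m w * basis (true, l, m) x))%:C.
  rewrite rmorph_sum; apply: eq_big_nat => m /andP[m1 ml].
  rewrite sph_harmE//= -!rmorphM -rmorphD -rmorphM; congr _%:C.
  by rewrite gtn_eqF//=; have := sqrt2_neq0 R; move=> s2; field.
rewrite -rmorphM -rmorphD -rmorphM; congr _%:C.
rewrite mulrDr mulr_sumr mulrA; congr (_ + _); apply: eq_bigr => m _ /=.
by rewrite mulrDr !mulrA.
Qed.

(** Since [f] is real, the terms of orders [m] and [- m] are conjugate: the imaginary parts cancel
    and the real parts combine to the two real harmonics of order [m]. *)
Lemma cauchy_sumE (f : S2 -> R) (e : R) l x : measurable_fun setT f ->
  sum_m l (fun m => e%:C * fourier_coef f l m * sph_harm l m x) =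
  (\sum_(i <- lvl l) (e * coef f i) * basis i x)%:C.
Proof.
move=> mf; rewrite sum_m_sym sum_lvl rmorphD rmorph_sum; congr (_ + _).
  rewrite fourier_coefE// sph_harmE//= basis_true0 coef_true0; simpc.
  by [].
apply: eq_big_nat => m /andP[m1 ml].
rewrite !fourier_coefE ?abszN// !sph_harmE ?abszN//.
case: m m1 ml => [//|m] _ ml; rewrite -NegzE /=; simpc.
have r2 : (Num.sqrt 2)^-1 * (Num.sqrt 2)^-1 = 2^-1 :> R.
  by rewrite -invfM -expr2 sqr_sqrtr.
have sg2 : (-1) ^+ m.+1 * (-1) ^+ m.+1 = 1 :> R by rewrite -expr2 sqrr_sign.
move: ((-1) ^+ m.+1) (Num.sqrt 2)^-1 sg2 r2 => sg r sg2 r2.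
set C := coef f (false, l, m.+1); set D := coef f (true, l, m.+1).
set E := basis (false, l, m.+1) x; set G := basis (true, l, m.+1) x.
congr Complex.
  transitivity ((e * C * E + e * D * G) * (r * r) * (1 + sg * sg)); first by ring.
  by rewrite r2 sg2; field.
transitivity (e * (r * r) * (C * G - D * E) * (1 - sg * sg)); first by ring.
by rewrite sg2 subrr mulr0.
Qed.

Lemma normc_real_sq (a : R) : ComplexField.Normc.normc (a%:C) ^+ 2 = a ^+ 2.
Proof. by rewrite /= expr0n addr0 sqr_sqrtr// sqr_ge0. Qed.

End complex_series.

Section complex_L2.
Context d (Omega : measurableType d) (R : realType) (P : probability Omega R).
Local Notation S2 := (sphere R).
Local Notation mu := (@sphere_measure R).

(** The terms are prescribed only off [N], because the measurability of the Riemann-Stieltjes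
    integrals on [N] is not controlled; hence the use of [ge0_integral_eq_off]. *)
Lemma L2_sumE (N : set Omega) (F : nat -> Omega -> S2 -> R[i])
    (c : bool * nat * nat -> Omega -> R) (f : Omega -> S2 -> R) :
  measurable N -> P N = 0%E ->
  (forall l w x, ~ N w -> F l w x = (\sum_(i <- lvl l) c i w * basis i x)%:C) ->
  L2_sum P F f <-> L2_expansion P c f.
Proof.
move=> mN PN FE; rewrite /L2_sum /L2_expansion.
suff -> : (fun n => \int[P \x mu]_p
     (ComplexField.Normc.normc
        (\sum_(l < n) F l p.1 p.2 - (f p.1 p.2)%:C)%R ^+ 2)%:E)%E =
   (fun n => \int[P \x mu]_p ((hsum c 0 n p.1 p.2 - f p.1 p.2) ^+ 2)%:E)%E by [].
apply/funext => n; apply: (@ge0_integral_eq_off _ _ _ _ (N `*` setT)).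
- exact: measurableX.
- transitivity ((P \x mu)%E (N `*` setT)); first by [].
  by rewrite product_measure1E//= PN mul0e.
- by move=> p; rewrite lee_fin sqr_ge0.
- by move=> p; rewrite lee_fin sqr_ge0.
move=> [w x] /= nN; congr EFin.
have {}nN : ~ N w by move=> Nw; apply: nN.
rewrite (eq_bigr (fun l : 'I_n => (\sum_(i <- lvl l) c i w * basis i x)%:C)); last first.
  by move=> l _; rewrite FE.
rewrite -rmorph_sum -rmorphB normc_real_sq; congr ((_ - _) ^+ 2).
by rewrite /hsum big_lvls big_mkord.
Qed.

End complex_L2.

(** * Moments and measurability of the stochastic convolution *)

Section ou_paths.
Variable R : realType.
Local Notation leb := (@lebesgue_measure R).
Variables (a : R) (h : R -> R) (t : R).
Hypotheses (a0 : 0 <= a) (ch : continuous h) (t0 : 0 <= t).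

Definition ou_kernel s := a * expR (- a * (t - s)).

Lemma ou_kernel_ge0 s : 0 <= ou_kernel s.
Proof. by rewrite mulr_ge0// expR_ge0. Qed.

Lemma ou_kernelE s : ou_kernel s = a * expR (- a * t) * expR (a * s).
Proof. by rewrite /ou_kernel -mulrA -expRD; congr (_ * expR _); ring. Qed.

Lemma continuous_ou_kernel : continuous ou_kernel.
Proof.
have -> : ou_kernel = fun s => a * expR (- a * t) * expR (a * s).
  by apply/funext => s; rewrite ou_kernelE.
by move=> s; apply: cvgM; [exact: cvg_cst|exact: continuous_expR_lin].
Qed.

Lemma int_ou_kernel_le1 : \int[leb]_(s in `[0, t]) ou_kernel s <= 1.
Proof.
have dF (s : R) : is_derive s 1
    (fun s : R => expR (- a * t) *: expR (a * s) : R) (ou_kernel s).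
  have de := is_derive_expR_lin a s.
  apply: is_derive_eq; rewrite /GRing.scale/= ou_kernelE; ring.
rewrite (Rintegral_FTC2_itv t0 continuous_ou_kernel (fun s _ => dF s)).
rewrite /GRing.scale/= -expRD (_ : - a * t + a * t = 0) ?expR0; last by ring.
by rewrite gerBl mulr_ge0 ?expR_ge0.
Qed.

Lemma ouE : ou a h t = h t - \int[leb]_(s in `[0, t]) (ou_kernel s * h s).
Proof.
have ck : continuous (fun s => expR (a * s) * h s).
  by move=> s; apply: cvgM; [exact: continuous_expR_lin|exact: ch].
rewrite /ou primE// -RintegralZl//; last exact: continuous_integrable_itv.
by congr (_ - _); apply: eq_Rintegral => s _; rewrite ou_kernelE mulrA.
Qed.

(* Jensen's inequality for the kernel, whose mass is at most 1. *)
Lemma ou_sq_le : ou a h t ^+ 2 <=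
  2 * h t ^+ 2 + 2 * \int[leb]_(s in `[0, t]) (ou_kernel s * h s ^+ 2).
Proof.
set J := \int[leb]_(s in _) _; rewrite ouE.
set y := \int[leb]_(s in _) _.
have ck := continuous_ou_kernel.
have ckh : continuous (fun s => ou_kernel s * h s).
  by move=> s; apply: cvgM; [exact: ck|exact: ch].
have ckh2 : continuous (fun s => ou_kernel s * h s ^+ 2).
  by move=> s; apply: cvgM; [exact: ck|apply: cvgM; exact: ch].
(* Expanding the square gives [2 y^2 - m y^2 <= J], where [m <= 1] is the mass of the kernel, hence
   [y^2 <= J]. *)
have : 0 <= \int[leb]_(s in `[0, t]) (ou_kernel s * (h s - y) ^+ 2).
  by apply: Rintegral_ge0 => s _; rewrite mulr_ge0 ?sqr_ge0 ?ou_kernel_ge0.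
have -> : \int[leb]_(s in `[0, t]) (ou_kernel s * (h s - y) ^+ 2) =
    J - 2 * y * y + y ^+ 2 * \int[leb]_(s in `[0, t]) ou_kernel s.
  have cI (u : R -> R) : continuous u -> leb.-integrable `[0, t] (EFin \o u).
    exact: continuous_integrable_itv.
  have cZ (k : R) (u : R -> R) : continuous u -> continuous (fun s => k * u s).
    by move=> cu s; apply: cvgM; [exact: cvg_cst|exact: cu].
  transitivity (\int[leb]_(s in `[0, t]) (ou_kernel s * h s ^+ 2 -
      2 * y * (ou_kernel s * h s) + y ^+ 2 * ou_kernel s)).
    by apply: eq_Rintegral => s _; ring.
  rewrite RintegralD//; [|apply: cI|apply: cI; exact: cZ]; last first.
    by move=> s; apply: cvgB; [exact: ckh2|exact: (cZ (2 * y) _ ckh)].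
  rewrite RintegralB; [|by []|exact: cI|by apply: cI; exact: cZ].
  by rewrite (RintegralZl _ _ (cI _ ckh))// (RintegralZl _ _ (cI _ ck)).
have := int_ou_kernel_le1; set m := \int[leb]_(s in _) _ => m1.
have := sqr_ge0 (h t + y); have := sqr_ge0 y; nra.
Qed.

End ou_paths.

Section measurable_integrals.
Context d (T : measurableType d) (R : realType).
Local Notation leb := (@lebesgue_measure R).

Lemma measurable_Rintegral_in (D : set R) (f : T -> R -> R) : measurable D ->
  measurable_fun setT (fun p : T * R => f p.1 p.2) ->
  measurable_fun setT (fun x => \int[leb]_(y in D) f x y).
Proof.
move=> mD mf.
have -> : (fun x => \int[leb]_(y in D) f x y) = (fun x => \int[leb]_y (\1_D y * f x y)).
  apply/funext => x; rewrite /Rintegral integral_mkcond; congr fine.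
  apply: eq_integral => y _; rewrite patchE indicE.
  by case: ifP => _; rewrite ?mul1r ?mul0r.
apply: (@measurable_Rintegral_param _ _ _ _ _ leb (fun p : T * R => \1_D p.2 * f p.1 p.2)).
apply: measurable_funM => //.
exact: (measurableT_comp (measurable_indic mD) measurable_snd).
Qed.

(** The moving end point becomes the indicator of a measurable region, which leaves a parameter
    integral over a fixed domain. *)
Lemma measurable_Rintegral_upto (f : R -> T -> R) :
  measurable_fun setT (fun p : R * T => f p.1 p.2) ->
  measurable_fun setT (fun p : R * T => \int[leb]_(r in `[0, p.1]) f r p.2).
Proof.
move=> mf; pose D : set (R * T * R) := [set q | 0 <= q.2 <= q.1.1].
have mD : measurable D.
  have -> : D = [set q | 0 <= q.2] `&` [set q | q.2 <= q.1.1].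
    by apply/seteqP; split => q /= => [/andP[]|[a b]]; [|apply/andP].
  apply: measurableI.
    rewrite -[X in measurable X]setTI.
    have := @measurable_snd _ _ (R * T)%type R measurableT _ (measurable_itv `[(0 : R), +oo[).
    by congr measurable; apply/seteqP; split => q /=; rewrite in_itv/= andbT => // -[].
  rewrite -[X in measurable X]setTI.
  apply: (@measurable_fun_le _ _ _ setT (fun q : R * T * R => q.2) (fun q => q.1.1)) => //.
    exact: measurable_snd.
  exact: (measurableT_comp (@measurable_fst _ _ R T) (@measurable_fst _ _ (R * T)%type R)).
have -> : (fun p : R * T => \int[leb]_(r in `[0, p.1]) f r p.2) =
    (fun p => \int[leb]_r (\1_D (p, r) * f r p.2)).
  apply/funext => p; rewrite /Rintegral integral_mkcond; congr fine.
  apply: eq_integral => r _; rewrite patchE indicE /D.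
  have -> : ((p, r) \in [set q : R * T * R | 0 <= q.2 <= q.1.1]) = (r \in `[0, p.1]%classic).
    by apply/idP/idP => /set_mem/= h; apply/mem_set; move: h; rewrite /= in_itv.
  by case: ifP => _; rewrite ?mul1r ?mul0r.
apply: (@measurable_Rintegral_param _ _ _ _ _ leb (fun q : R * T * R => \1_D q * f q.2 q.1.2)).
apply: measurable_funM; first exact: measurable_indic.
have m2 : measurable_fun setT (fun q : R * T * R => (q.2, q.1.2)).
  apply: measurable_fun_pair; first exact: measurable_snd.
  exact: (measurableT_comp (@measurable_snd _ _ R T) (@measurable_fst _ _ (R * T)%type R)).
exact: (measurableT_comp mf m2).
Qed.

End measurable_integrals.

Section ou_random.
Context d (Omega : measurableType d) (R : realType) (P : probability Omega R).
Local Notation leb := (@lebesgue_measure R).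
Variables (a : R) (g : R -> Omega -> R).
Hypotheses (a0 : 0 <= a) (mg : forall t, measurable_fun setT (g t)).
Hypothesis cg : forall w, continuous (g ^~ w).

Let mg2 : measurable_fun setT (fun p : R * Omega => g p.1 p.2).
Proof. exact: measurable_continuous_paths. Qed.

Let mg2' : measurable_fun setT (fun p : Omega * R => g p.2 p.1).
Proof. exact: (measurableT_comp mg2 (@measurable_swap _ _ Omega R)). Qed.

Lemma measurable_ou t : measurable_fun setT (fun w => ou a (g ^~ w) t).
Proof.
have mp s : measurable_fun setT (fun w =>
    \int[leb]_(r in `[-1, s]) (expR (a * r) * g r w)).
  apply: (@measurable_Rintegral_in _ _ _ `[-1, s]%classic
    (fun w r => expR (a * r) * g r w)) => //.
  apply: measurable_funM => //.
    have mE : measurable_fun setT (fun r : R => expR (a * r)).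
      by apply: continuous_measurable_fun; exact: continuous_expR_lin.
    exact: (measurableT_comp mE (@measurable_snd _ _ Omega R)).
apply: measurable_funB; first exact: mg.
by apply: measurable_funM => //; exact: measurable_funB.
Qed.

Lemma measurable_ou_abs :
  measurable_fun setT (fun p : R * Omega => ou a (g ^~ p.2) `|p.1|).
Proof.
apply: (@measurable_continuous_paths _ _ _ (fun t w => ou a (g ^~ w) `|t|)).
  by move=> t; exact: measurable_ou.
by move=> w; exact: continuous_ou_abs.
Qed.

(** After [ou_sq_le] and Tonelli, the two summands contribute [2 M] each, the second because the
    kernel has mass at most 1. *)
Lemma ou_moment (M t : R) : 0 <= t ->
  (forall s, 0 <= s <= t -> (\int[P]_w (g s w ^+ 2)%:E <= M%:E)%E) ->
  (\int[P]_w (ou a (g ^~ w) t ^+ 2)%:E <= (4 * M)%:E)%E.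
Proof.
move=> t0 gM.
pose k := ou_kernel a t.
have k0 s : 0 <= k s by exact: ou_kernel_ge0.
have ck : continuous k by exact: continuous_ou_kernel.
have mk : measurable_fun setT k by exact: continuous_measurable_fun.
pose J w := (\int[leb]_(s in `[0%R, t]) (k s * g s w ^+ 2)%:E)%E.
have mkg : measurable_fun setT (fun p : Omega * R => k p.2 * g p.2 p.1 ^+ 2).
  apply: measurable_funM; first exact: (measurableT_comp mk (@measurable_snd _ _ Omega R)).
  exact: measurable_funX.
pose phi (p : Omega * R) := (\1_(`[0, t]%classic) p.2 * (k p.2 * g p.2 p.1 ^+ 2))%:E.
have mphi : measurable_fun setT phi.
  apply/measurable_EFinP; apply: measurable_funM => //.
  apply: (measurableT_comp _ (@measurable_snd _ _ Omega R)).
  exact: measurable_indic.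
have phi0 p : (0 <= phi p)%E by rewrite lee_fin mulr_ge0// mulr_ge0// sqr_ge0.
have JE w : (J w = \int[leb]_s phi (w, s))%E.
  rewrite /J integral_mkcond; apply: eq_integral => s _; rewrite patchE /phi indicE.
  by case: ifP => _; rewrite ?mul1r ?mul0r.
have mJ : measurable_fun setT J.
  have -> : J = fun w => (\int[leb]_s phi (w, s))%E by apply/funext.
  exact: (@measurable_fun_fubini_tonelli_F _ _ _ _ _ leb phi).
have J0 w : (0 <= J w)%E.
  by apply: integral_ge0 => s _; rewrite lee_fin mulr_ge0 ?sqr_ge0.
have M0 : 0 <= M.
  rewrite -lee_fin; apply: le_trans (gM 0 _); last by rewrite lexx.
  by apply: integral_ge0 => w _; rewrite lee_fin sqr_ge0.
have intJ : (\int[P]_w J w <= M%:E)%E.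
  under eq_integral do rewrite JE.
  rewrite (fubini_tonelli (m1 := P) (m2 := leb) phi)//.
  apply: (@le_trans _ _ (\int[leb]_s (\1_(`[0, t]%classic) s * (k s * M))%:E)%E).
    apply: ge0_le_integral => //.
    - by move=> s _; apply: integral_ge0.
    - exact: (@measurable_fun_fubini_tonelli_G _ _ _ _ _ P phi).
    - apply/measurable_EFinP; apply: measurable_funM; first exact: measurable_indic.
      exact: measurable_funM.
    move=> s _; rewrite /phi indicE; case: (boolP (s \in _)) => [|_] /=; last first.
      by rewrite mul0r; under eq_integral do rewrite mul0r; rewrite integral0.
    move=> /set_mem; rewrite /= in_itv/= => st.
    under eq_integral do rewrite mul1r EFinM.
    rewrite ge0_integralZl//.
    - rewrite (mul1r (k s * M)) (_ : (k s * M)%:E = ((k s)%:E * M%:E)%E)//.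
      apply: lee_wpmul2l; last exact: gM.
      by rewrite lee_fin; exact: k0.
    - by apply/measurable_EFinP; exact: measurable_funX.
    - by move=> w _; rewrite lee_fin sqr_ge0.
    - by rewrite lee_fin; exact: k0.
  have -> : (\int[leb]_s (\1_(`[0, t]%classic) s * (k s * M))%:E =
      \int[leb]_(s in `[0%R, t]) (M * k s)%:E)%E.
    rewrite [RHS]integral_mkcond; apply: eq_integral => s _; rewrite patchE indicE mulrC.
    by case: ifP => _; rewrite ?mulr1 ?mulr0// mulrC.
  under eq_integral do rewrite EFinM.
  have ik := continuous_integrable_itv 0 t ck.
  rewrite ge0_integralZl//; last 2 first.
  - by apply/measurable_EFinP; exact: measurable_funTS.
  - by move=> s _; rewrite lee_fin; exact: k0.
  rewrite -[leRHS]mule1; apply: lee_wpmul2l; first by rewrite lee_fin.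
  rewrite -[X in (X <= _)%E]fineK; last exact: integrable_fin_num ik.
  by rewrite lee_fin; exact: int_ou_kernel_le1.
apply: (@le_trans _ _ (\int[P]_w (2%:E * (g t w ^+ 2)%:E + 2%:E * J w))%E).
  apply: ge0_le_integral => //.
  - by move=> w _; rewrite lee_fin sqr_ge0.
  - by apply/measurable_EFinP/measurable_funX; exact: measurable_ou.
  - apply: emeasurable_funD; apply: emeasurable_funM => //.
    by apply/measurable_EFinP; exact: measurable_funX.
  move=> w _.
  have Jfin : J w \is a fin_num.
    apply: (integrable_fin_num (mu := leb)) => //.
    apply: (@continuous_integrable_itv R (fun s => k s * g s w ^+ 2)).
    by move=> s; apply: cvgM; [exact: ck|apply: cvgM; exact: cg].
  by rewrite -(fineK Jfin) -!EFinM -EFinD lee_fin; exact: ou_sq_le.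
rewrite ge0_integralD//; last 4 first.
- by move=> w _; rewrite mule_ge0// lee_fin sqr_ge0.
- by apply: emeasurable_funM => //; apply/measurable_EFinP; exact: measurable_funX.
- by move=> w _; rewrite mule_ge0.
- exact: emeasurable_funM.
rewrite !ge0_integralZl//; last 2 first.
- by apply/measurable_EFinP; exact: measurable_funX.
- by move=> w _; rewrite lee_fin sqr_ge0.
have -> : (4 * M)%:E = (2%:E * M%:E + 2%:E * M%:E)%E.
  by rewrite -EFinM -EFinD; congr EFin; ring.
apply: leeD; apply: lee_wpmul2l => //.
by apply: gM; rewrite t0 lexx.
Qed.

End ou_random.

Lemma integrable_ae_eq d (T : measurableType d) (R : realType)
    (mu : {measure set T -> \bar R}) (D : set T) (f g : T -> \bar R) :
  measurable D -> measurable_fun D f -> mu.-integrable D g -> ae_eq mu D f g ->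
  mu.-integrable D f.
Proof.
move=> mD mf /integrableP[mg gi] fg; apply/integrableP; split => //.
rewrite (ae_eq_integral (fun x => `|g x|)%E)//; try exact: measurableT_comp.
by apply: filterS fg => x h /h ->.
Qed.

(** * The equation on coefficients *)

Section coefficient_equation.
Variable R : realType.
Local Notation S2 := (sphere R).
Local Notation leb := (@lebesgue_measure R).

Definition coef_eqn (a t : R) (F : R -> S2 -> R) (f0 fB : S2 -> R) i :=
  leb.-integrable `[0, t] (EFin \o (fun s => coef (F s) i)) /\
  coef (F t) i =
    coef f0 i - a * (\int[leb]_(s in `[0, t]) coef (F s) i) + coef fB i.

Lemma complex_affine_eq (h k a p q p0 q0 pI qI pB qB : R) : h != 0 -> k != 0 ->
  (h * p) +i* (k * q) = (h * p0) +i* (k * q0) - a%:C * ((h * pI) +i* (k * qI)) +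
    (h * pB) +i* (k * qB) <-> p = p0 - a * pI + pB /\ q = q0 - a * qI + qB.
Proof.
move=> h0 k0; simpc; split=> [[e1 e2]|[-> ->]].
  split; first by apply: (mulfI h0); rewrite e1; ring.
  by apply: (mulfI k0); rewrite e2; ring.
by congr Complex; ring.
Qed.

(** Real and imaginary parts of a complex coefficient are nonzero multiples of two real
    coefficients, so the complex equation, integrability included, splits without loss. *)
Lemma fourier_eqnE (a t : R) (F : R -> S2 -> R) (f0 fB : S2 -> R) l (m : int) :
  (absz m <= l)%N -> 0 <= t -> (forall s, 0 <= s -> measurable_fun setT (F s)) ->
  measurable_fun setT f0 -> measurable_fun setT fB ->
  (Cintegrable leb `[0, t] (fun s => fourier_coef (F s) l m) /\
   fourier_coef (F t) l m = fourier_coef f0 l m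
     - a%:C * Cintegral leb `[0, t] (fun s => fourier_coef (F s) l m)
     + fourier_coef fB l m) <->
  coef_eqn a t F f0 fB (false, l, absz m) /\
  coef_eqn a t F f0 fB (true, l, absz m).
Proof.
move=> ml t0 mF mf0 mfB; rewrite /coef_eqn /Cintegrable.
set p := fun s => coef (F s) (false, l, absz m).
set q := fun s => coef (F s) (true, l, absz m).
set hr := harm_re R m; set hi := - harm_im R m.
have hr0 : hr != 0 by exact: harm_re_neq0.
have hi0 : hi != 0 by rewrite oppr_eq0 harm_im_neq0.
have FE s : 0 <= s -> fourier_coef (F s) l m = (hr * p s) +i* (hi * q s).
  by move=> s0; rewrite fourier_coefE//; exact: mF.
have D0 s : s \in `[0, t]%classic -> 0 <= s.
  by move/set_mem; rewrite /= in_itv/= => /andP[].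
have iRe : leb.-integrable `[0, t] (fun s => (complex.Re (fourier_coef (F s) l m))%:E) <->
    leb.-integrable `[0, t] (EFin \o p).
  rewrite -(integrableZ_iff leb p _ hr0)//.
  have e : {in `[0, t]%classic, (fun s => (complex.Re (fourier_coef (F s) l m))%:E) =1
      EFin \o (fun s => hr * p s)} by move=> s /D0 s0; rewrite /comp FE.
  by split; apply: eq_integrable => // s st; rewrite e.
have iIm : leb.-integrable `[0, t] (fun s => (complex.Im (fourier_coef (F s) l m))%:E) <->
    leb.-integrable `[0, t] (EFin \o q).
  rewrite -(integrableZ_iff leb q _ hi0)//.
  have e : {in `[0, t]%classic, (fun s => (complex.Im (fourier_coef (F s) l m))%:E) =1
      EFin \o (fun s => hi * q s)} by move=> s /D0 s0; rewrite /comp FE.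
  by split; apply: eq_integrable => // s st; rewrite e.
have IE : leb.-integrable `[0, t] (EFin \o p) -> leb.-integrable `[0, t] (EFin \o q) ->
    Cintegral leb `[0, t] (fun s => fourier_coef (F s) l m) =
    (hr * \int[leb]_(s in `[0, t]) p s) +i* (hi * \int[leb]_(s in `[0, t]) q s).
  move=> ip iq; rewrite -!RintegralZl// /Cintegral /Rintegral.
  by congr Complex; congr fine; apply: eq_integral => s /D0 s0; rewrite FE.
rewrite FE// !fourier_coefE// -/hr -/hi.
split=> [[[/iRe ip /iIm iq]]|[[ip ep] [iq eq]]].
  by rewrite IE// complex_affine_eq// => -[e1 e2]; split; split.
split; first by split; [exact/iRe|exact/iIm].
by rewrite IE// complex_affine_eq.
Qed.

End coefficient_equation.

Section solutions.
Context d (Omega : measurableType d) (R : realType) (P : probability Omega R).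
Local Notation S2 := (sphere R).
Local Notation leb := (@lebesgue_measure R).
Variables (alpha gamma : R) (U0 : Omega -> S2 -> R) (B : R -> Omega -> S2 -> R).
Hypothesis mU0 : random_field U0.
Hypothesis mB : forall t, 0 <= t -> random_field (B t).
Let a l := psi alpha gamma (lambda R l).

Lemma is_solutionE (X : R -> Omega -> S2 -> R) :
  (forall t, 0 <= t -> random_field (X t)) ->
  is_solution P alpha gamma U0 B X <->
  forall i t, valid i -> 0 <= t ->
    {ae P, forall w, coef_eqn (a i.1.2) t (X ^~ w) (U0 w) (B t w) i}.
Proof.
move=> mX; have mXw w s : 0 <= s -> measurable_fun setT (X s w).
  by move=> s0; exact: field_section (mX s s0).
have E l (m : int) t w : (absz m <= l)%N -> 0 <= t -> _ :=
  fun ml t0 => @fourier_eqnE R (a l) t (X ^~ w) (U0 w) (B t w) l m ml t0 (mXw w)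
    (field_section w mU0) (field_section w (mB t0)).
split=> [sol [[b l] m] t /andP[/= bm ml] t0|sol l m t ml t0].
  apply: filterS (sol l m%:Z t ml t0) => w /(E l m%:Z t w ml t0).1[e1 e2].
  by case: b bm.
have h1 := sol (false, l, absz m) t ml t0.
have h2 : {ae P, forall w, coef_eqn (a l) t (X ^~ w) (U0 w) (B t w) (true, l, absz m)}.
  have [/eqP m0|m0] := boolP (absz m == 0%N); last first.
    by apply: sol => //; rewrite /valid/= lt0n m0.
  (* At order 0 the sine index is not valid, but its coefficients vanish identically and the
     equation reads [0 = 0]. *)
  apply: aeW => w; rewrite m0 /coef_eqn !coef_true0.
  have -> : (fun s => coef (X s w) (true, l, 0%N)) = fun=> 0.
    by apply/funext => s; rewrite coef_true0.
  split; first exact: integrable0.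
  by rewrite Rintegral_cst// mul0r mulr0 subr0 addr0.
by apply: filterS2 h1 h2 => w e1 e2; apply/(E l m t w ml t0).
Qed.

End solutions.

Section linear_equation.
Context d (Omega : measurableType d) (R : realType) (P : probability Omega R).
Local Notation S2 := (sphere R).
Local Notation mu := (@sphere_measure R).
Local Notation leb := (@lebesgue_measure R).
Variables (a A : nat -> R) (U0 : Omega -> S2 -> R) (B : R -> Omega -> S2 -> R).
Variables (x0 : bool * nat * nat -> Omega -> R).
Variables (g : bool * nat * nat -> R -> Omega -> R) (M : R -> R).
Hypotheses (a0 : forall l, 0 <= a l) (A0 : forall l, 0 <= A l).
Hypothesis cvA : cvgn (series (fun l => l.*2.+1%:R * A l)).
Hypothesis mx0 : forall i, measurable_fun setT (x0 i).
Hypothesis mg : forall i t, measurable_fun setT (g i t).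
Hypothesis cg : forall i w, continuous (g i ^~ w).
Hypothesis gM : forall i s t, 0 <= s <= t -> (\int[P]_w (g i s w ^+ 2)%:E <= (M t)%:E)%E.
Hypothesis xU0 : L2_expansion P x0 U0.
Hypothesis gB : forall t, 0 <= t ->
  L2_expansion P (fun i w => Num.sqrt (A i.1.2) * g i t w) (B t).

Definition mode i t w := x0 i w * expR (- a i.1.2 * t) +
  Num.sqrt (A i.1.2) * ou (a i.1.2) (g i ^~ w) t.

(* The absolute value makes this jointly measurable on the whole line. *)
Let mode_abs i (t : R) w := mode i `|t| w.

Let m_mode i : measurable_fun setT (fun p : R * Omega => mode_abs i p.1 p.2).
Proof.
apply: measurable_funD; apply: measurable_funM => //.
- exact: (measurableT_comp (mx0 i) (@measurable_snd _ _ R Omega)).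
- have h : measurable_fun setT (fun t : R => expR (- a i.1.2 * `|t|)).
    by apply: measurableT_comp => //; apply: measurable_funM.
  exact: (measurableT_comp h (@measurable_fst _ _ R Omega)).
- by apply: measurable_ou_abs.
Qed.

Let absE (t s : R) : s \in `[0, t]%classic -> `|s| = s.
Proof. by move/set_mem; rewrite /= in_itv/= => /andP[s0 _]; rewrite ger0_norm. Qed.

Let mode_eqn i t w : 0 <= t ->
  leb.-integrable `[0, t] (EFin \o (fun s => mode_abs i s w)) /\
  mode i t w = x0 i w - a i.1.2 * (\int[leb]_(s in `[0, t]) mode_abs i s w) +
    Num.sqrt (A i.1.2) * g i t w.
Proof.
move=> t0; split.
  have io := ou_integrable (a i.1.2) (@cg i w) (x0 i w) (Num.sqrt (A i.1.2)) t.
  by apply: eq_integrable io => // s /absE st; rewrite /comp /mode_abs st.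
have -> : \int[leb]_(s in `[0, t]) mode_abs i s w = \int[leb]_(s in `[0, t])
    (x0 i w * expR (- a i.1.2 * s) + Num.sqrt (A i.1.2) * ou (a i.1.2) (g i ^~ w) s).
  by apply: eq_Rintegral => s /absE st; rewrite /mode_abs st.
exact: (ou_integral_equation (a i.1.2) (@cg i w)).
Qed.

Section process.
Variable X : R -> Omega -> S2 -> R.
Hypothesis LX : L2_process P X.
Variable i : bool * nat * nat.
Hypothesis vi : valid i.

(** [X] is measurable on nonnegative times; reflecting the time makes the coefficient jointly
    measurable on the whole line, as [ae_swap] requires. *)
Let y (s : R) w := coef (X `|s| w) i.

Let my : measurable_fun setT (fun p : R * Omega => y p.1 p.2).
Proof.
apply: (@measurable_Rintegral_param _ _ _ _ _ mu
  (fun p : R * Omega * S2 => X `|p.1.1| p.1.2 p.2 * basis i p.2)).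
apply: measurable_funM; last first.
  exact: (measurableT_comp (@measurable_basis R i) (@measurable_snd _ _ (R * Omega)%type S2)).
have mD : measurable [set p : R * Omega * S2 | 0 <= p.1.1].
  rewrite -[X in measurable X]setTI.
  apply: (@measurable_fun_le _ _ _ setT (fun=> 0) (fun p : R * Omega * S2 => p.1.1)) => //.
  exact: (measurableT_comp (@measurable_fst _ _ R Omega) (@measurable_fst _ _ (R * Omega)%type S2)).
apply: (@measurable_comp _ _ _ _ _ _ _ (fun p : R * Omega * S2 => X p.1.1 p.1.2 p.2) setT
   (fun p : R * Omega * S2 => (`|p.1.1|, p.1.2, p.2)) mD _ LX.1).
  by move=> _ [p _ <-] /=.
have m12 := @measurable_fst _ _ (R * Omega)%type S2.
have m1 : measurable_fun setT (fun p : R * Omega * S2 => `|p.1.1|).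
  exact: (measurableT_comp (@normr_measurable R setT)
    (measurableT_comp (@measurable_fst _ _ R Omega) m12)).
have m2 := measurableT_comp (@measurable_snd _ _ R Omega) m12.
exact: (measurable_fun_pair (measurable_fun_pair m1 m2)
  (@measurable_snd _ _ (R * Omega)%type S2)).
Qed.

Let y_eqn t w : 0 <= t -> coef_eqn (a i.1.2) t (X ^~ w) (U0 w) (B t w) i <->
  leb.-integrable `[0, t] (EFin \o (y ^~ w)) /\ y t w =
    coef (U0 w) i - a i.1.2 * (\int[leb]_(s in `[0, t]) y s w) + coef (B t w) i.
Proof.
move=> t0; rewrite /coef_eqn.
have -> : \int[leb]_(s in `[0, t]) coef (X s w) i = \int[leb]_(s in `[0, t]) y s w.
  by apply: eq_Rintegral => s /absE st; rewrite /y st.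
have -> : coef (X t w) i = y t w by rewrite /y ger0_norm.
split=> -[iy ->]; split => //; apply: eq_integrable iy => // s /absE st;
  by rewrite /= /y st.
Qed.

Let ae_data t : 0 <= t -> {ae P, forall w, coef (U0 w) i = x0 i w /\
  coef (B t w) i = Num.sqrt (A i.1.2) * g i t w}.
Proof.
move=> t0; apply: filterS2 (L2_expansion_coef mx0 xU0 vi)
  (L2_expansion_coef _ (gB t0) vi) => //.
by move=> j; exact: measurable_funM.
Qed.

(** The hypothesis is almost sure for each time, while the integral term sees all times of one path;
    [ae_swap] provides, almost surely, equality at almost every time. *)
Lemma coef_eqn_of_mode :
  (forall t, 0 <= t -> {ae P, forall w, coef (X t w) i = mode i t w}) ->
  forall t, 0 <= t -> {ae P, forall w, coef_eqn (a i.1.2) t (X ^~ w) (U0 w) (B t w) i}.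
Proof.
move=> Xc t t0.
have yc := @ae_swap _ _ _ _ _ leb P `[0, t]%classic _ _ (measurable_itv _) my (m_mode i).
have {}yc : {ae P, forall w, {ae leb, forall s, `[0, t]%classic s -> y s w = mode_abs i s w}}.
  apply: yc => s; rewrite /= in_itv/= => /andP[s0 _].
  by apply: filterS (Xc s s0) => w; rewrite /y /mode_abs ger0_norm.
apply: filterS3 yc (ae_data t0) (Xc t t0) => w yc [U0w Bw] Xt.
have [ic ec] := mode_eqn i w t0.
have myw : measurable_fun `[0, t]%classic (EFin \o (y ^~ w)).
  by apply/measurable_EFinP/measurable_funTS; exact: (measurableT_comp my (pair2_measurable w)).
have mcw := measurable_int _ ic.
apply/(y_eqn w t0); split.
  apply: (integrable_ae_eq _ _ ic) => //.
  move: yc; apply: filterS; first exact: (ae_filter_ringOfSetsType leb).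
  by move=> s ys /ys /= ->.
have -> : \int[leb]_(s in `[0, t]) y s w = \int[leb]_(s in `[0, t]) mode_abs i s w.
  rewrite /Rintegral; congr fine; apply: ae_eq_integral => //.
  move: yc; apply: filterS; first exact: (ae_filter_ringOfSetsType leb).
  by move=> s ys /ys /= ->.
by rewrite U0w Bw -ec -Xt /y ger0_norm.
Qed.

Lemma mode_of_coef_eqn :
  (forall t, 0 <= t -> {ae P, forall w, coef_eqn (a i.1.2) t (X ^~ w) (U0 w) (B t w) i}) ->
  forall t, 0 <= t -> {ae P, forall w, coef (X t w) i = mode i t w}.
Proof.
move=> sol t t0; pose D s w := y s w - mode_abs i s w.
have mD : measurable_fun setT (fun p : R * Omega => D p.1 p.2).
  exact: (measurable_funB my (m_mode i)).
have D_eqn s : 0 <= s -> {ae P, forall w, leb.-integrable `[0, s] (EFin \o (D ^~ w)) /\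
    D s w = - a i.1.2 * \int[leb]_(r in `[0, s]) D r w}.
  move=> s0; apply: filterS2 (sol s s0) (ae_data s0) => w /(y_eqn w s0)[iy ey] [U0w Bw].
  have [ic ec] := mode_eqn i w s0; split.
    by apply: (integrableB _ iy ic).
  rewrite RintegralB// /D ey /mode_abs ger0_norm// ec U0w Bw; ring.
have := @ae_swap _ _ _ _ _ leb P `[0, t]%classic _ (fun p : R * Omega =>
  - a i.1.2 * \int[leb]_(r in `[0, p.1]) D r p.2) (measurable_itv _) mD.
have mI := measurable_Rintegral_upto mD.
move=> /(_ (measurable_funM (measurable_cst _) mI)) H.
have {}H : {ae P, forall w, {ae leb, forall s, `[0, t]%classic s ->
    D s w = - a i.1.2 * \int[leb]_(r in `[0, s]) D r w}}.
  apply: H => s; rewrite /= in_itv/= => /andP[s0 _].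
  by apply: filterS (D_eqn s s0) => w [].
apply: filterS2 H (D_eqn t t0) => w Hw [iD Dt].
move: Dt; rewrite (@volterra_unique R (a i.1.2) t (D ^~ w))//.
by rewrite mulr0 /D /y /mode_abs ger0_norm// => /eqP; rewrite subr_eq0 => /eqP.
Qed.

End process.

Let x2 i := (\int[P]_w (x0 i w ^+ 2)%:E)%E.

Let x2_ge0 i : (0 <= x2 i)%E.
Proof. by apply: integral_ge0 => w _; rewrite lee_fin sqr_ge0. Qed.

Let U := (\int[P \x mu]_p (U0 p.1 p.2 ^+ 2)%:E)%E.

Let U_fin : U \is a fin_num.
Proof.
rewrite ge0_fin_numE; last by apply: integral_ge0 => p _; rewrite lee_fin sqr_ge0.
by have := xU0.1.2; under eq_integral do rewrite real_normK ?num_real//.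
Qed.

Let sum_x2 n : (\sum_(i <- lvls 0 n) x2 i <= U)%E.
Proof.
have := int_bessel P (uniq_lvls 0 n) (@lvls_valid 0 n) xU0.1.1.
apply: le_trans; rewrite le_eqVlt; apply/orP; left; apply/eqP.
rewrite big_seq [RHS]big_seq; apply: eq_bigr => i /lvls_valid vi.
apply: ae_eq_integral => //.
- by apply/measurable_EFinP/measurable_funX.
- by apply/measurable_EFinP/measurable_funX; exact: measurable_coef xU0.1.1.
- by apply: filterS (L2_expansion_coef mx0 xU0 vi) => w -> _.
Qed.

Let x2_fin l i : i \in lvl l -> x2 i \is a fin_num.
Proof.
move=> il; rewrite ge0_fin_numE//; apply: (@le_lt_trans _ _ U); last first.
  by rewrite -ge0_fin_numE// (le_trans _ (sum_x2 0))// sume_ge0.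
apply: le_trans (sum_x2 l.+1); rewrite (big_rem i)/=.
  by rewrite leeDl// sume_ge0.
by move: il; rewrite mem_lvls mem_lvl => /andP[-> /eqP ->]; rewrite leq0n ltnS leqnn.
Qed.

Let S l := \sum_(i <- lvl l) fine (x2 i).

Let S_ge0 l : 0 <= S l. Proof. by apply: sumr_ge0 => i _; rewrite fine_ge0. Qed.

Let S_E l : ((S l)%:E = \sum_(i <- lvl l) x2 i)%E.
Proof.
rewrite /S -sumEFin big_seq [RHS]big_seq; apply: eq_bigr => i il.
by rewrite fineK//; exact: x2_fin il.
Qed.

Let cvS : cvgn (series S).
Proof.
apply: nondecreasing_is_cvgn.
  by apply/nondecreasing_seqP => n; rewrite /series/= big_nat_recr//= lerDl.
exists (fine U) => _ [n _ <-]; rewrite -lee_fin fineK// /series/= -sumEFin.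
under eq_bigr do rewrite S_E.
by rewrite -big_lvls; exact: sum_x2.
Qed.

(** From [(p + q)^2 <= 2 p^2 + 2 q^2], an exponential at most 1, and the bound [4 M] of [ou_moment],
    which explains the 8. *)
Let mode_moment i t : x2 i \is a fin_num ->
  (\int[P]_w (mode_abs i t w ^+ 2)%:E <=
   (2 * fine (x2 i) + 8 * M `|t| * A i.1.2)%:E)%E.
Proof.
move=> xf; set o := fun w => ou (a i.1.2) (g i ^~ w) `|t|.
have mo : measurable_fun setT o by apply: measurable_ou => // w; exact: cg.
apply: (@le_trans _ _ (\int[P]_w (2%:E * (x0 i w ^+ 2)%:E +
    (2 * A i.1.2)%:E * (o w ^+ 2)%:E))%E).
  have m1 : measurable_fun setT (fun w => (x0 i w ^+ 2)%:E).
    by apply/measurable_EFinP/measurable_funX.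
  have m2 : measurable_fun setT (fun w => (o w ^+ 2)%:E).
    by apply/measurable_EFinP/measurable_funX.
  apply: ge0_le_integral => //.
  - by move=> w _; rewrite lee_fin sqr_ge0.
  - apply/measurable_EFinP/measurable_funX.
    exact: (measurableT_comp (m_mode i) (pair1_measurable t)).
  - by apply: emeasurable_funD; exact: emeasurable_funM.
  move=> w _; rewrite -!EFinM -EFinD lee_fin /mode_abs /mode -/(o w).
  set e := expR _; have e0 : 0 <= e by exact: expR_ge0.
  have e1 : e <= 1 by rewrite -expR0 ler_expR mulNr oppr_le0 mulr_ge0.
  have rA := sqr_sqrtr (A0 i.1.2); set r := Num.sqrt _ in rA *; rewrite -rA.
  have := sqr_ge0 (x0 i w * e - r * o w); have := sqr_ge0 (x0 i w) => q1 q2.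
  have q3 : e ^+ 2 <= 1 by rewrite expr_le1.
  have q4 : (x0 i w) ^+ 2 * e ^+ 2 <= (x0 i w) ^+ 2 by rewrite ler_piMr.
  have -> : (x0 i w * e + r * o w) ^+ 2 = 2 * (x0 i w ^+ 2 * e ^+ 2) +
      2 * r ^+ 2 * o w ^+ 2 - (x0 i w * e - r * o w) ^+ 2 by ring.
  by rewrite lerBlDr -addrA lerD ?ler_pM2l// ?lerDl.
rewrite ge0_integralD//; last 4 first.
- by move=> w _; rewrite mule_ge0// lee_fin sqr_ge0.
- by apply: emeasurable_funM => //; apply/measurable_EFinP; exact: measurable_funX.
- by move=> w _; rewrite mule_ge0// lee_fin ?sqr_ge0// mulr_ge0.
- by apply: emeasurable_funM => //; apply/measurable_EFinP; exact: measurable_funX.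
rewrite !ge0_integralZl//; last 5 first.
- by apply/measurable_EFinP; exact: measurable_funX.
- by move=> w _; rewrite lee_fin sqr_ge0.
- by rewrite lee_fin mulr_ge0.
- by apply/measurable_EFinP; exact: measurable_funX.
- by move=> w _; rewrite lee_fin sqr_ge0.
have -> : (2 * fine (x2 i) + 8 * M `|t| * A i.1.2)%:E =
    (2%:E * x2 i + (2 * A i.1.2)%:E * (4 * M `|t|)%:E)%E.
  by rewrite -[in RHS](fineK xf) -!EFinM -EFinD; congr EFin; ring.
apply: leeD => //; apply: lee_wpmul2l; first by rewrite lee_fin mulr_ge0.
apply: ou_moment => //.
by move=> s st; exact: gM.
Qed.

Let M_ge0 (t : R) : 0 <= M `|t|.
Proof.
rewrite -lee_fin; apply: le_trans (@gM (false, 0%N, 0%N) 0 `|t| _).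
  by apply: integral_ge0 => w _; rewrite lee_fin sqr_ge0.
by rewrite lexx normr_ge0.
Qed.

(** Factoring only adds nonnegative cross terms; the shape, a function of time multiplied by a
    summable function of the level, is the one that [riesz_fischer] expects. *)
Let mode_le t l : (\sum_(i <- lvl l) \int[P]_w (mode_abs i t w ^+ 2)%:E <=
  ((2 + 8 * M `|t|) * (S l + l.*2.+1%:R * A l))%:E)%E.
Proof.
apply: (@le_trans _ _ (\sum_(i <- lvl l) (2 * fine (x2 i) + 8 * M `|t| * A l)%:E)%E).
  rewrite big_seq [leRHS]big_seq; apply: lee_sum => i il.
  have := il; rewrite mem_lvl => /andP[_ /eqP <-].
  by apply: mode_moment; exact: x2_fin il.
rewrite sumEFin lee_fin big_split/= -mulr_sumr -/(S l) big_const_seq count_predT.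
have -> : size (lvl l) = l.*2.+1.
  by rewrite /lvl size_cat !size_map !size_iota addSn addnn.
rewrite iter_addr_0 -[X in _ + X <= _]mulr_natl.
have := S_ge0 l; have := M_ge0 t; have : 0 <= l.*2.+1%:R * A l by rewrite mulr_ge0.
move: (S l) (M _) (l.*2.+1%:R) => s m n q1 q2 q3.
have -> : n * (8 * m * A l) = 8 * m * (n * A l) by ring.
move: (n * A l) q1 => v q1; nra.
Qed.

Lemma mode_expansion_exists : exists X : R -> Omega -> S2 -> R,
  L2_process P X /\ forall t, 0 <= t -> L2_expansion P (fun i => mode i t) (X t).
Proof.
have cvb : cvgn (series (fun l => S l + l.*2.+1%:R * A l)).
  have -> : series (fun l => S l + l.*2.+1%:R * A l) =
      (fun n => series S n + series (fun l => l.*2.+1%:R * A l) n).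
    by apply/funext => n; rewrite /series/= big_split.
  exact: is_cvgD.
have K0 (t : R) : 0 <= 2 + 8 * M `|t| by rewrite addr_ge0// mulr_ge0.
have b0 l : 0 <= S l + l.*2.+1%:R * A l by rewrite addr_ge0// mulr_ge0.
have [X [mX EX]] := riesz_fischer m_mode K0 b0 cvb mode_le.
exists X; split; first split.
- exact: measurable_funTS.
- by move=> t t0; have [] := EX t.
- by move=> t t0; have := EX t; rewrite /mode_abs ger0_norm.
Qed.

Lemma linear_equationP (X : R -> Omega -> S2 -> R) : L2_process P X ->
  (forall i t, valid i -> 0 <= t ->
     {ae P, forall w, coef_eqn (a i.1.2) t (X ^~ w) (U0 w) (B t w) i}) <->
  forall t, 0 <= t -> L2_expansion P (fun i => mode i t) (X t).
Proof.
move=> LX; have mm (t : R) i : 0 <= t -> measurable_fun setT (mode i t).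
  move=> t0; have := measurableT_comp (m_mode i) (pair1_measurable t).
  by rewrite /comp/= /mode_abs ger0_norm.
split=> [sol t t0|EX i t vi t0].
  (* A reference process with the required expansion: [X] turns out to have the same coefficients
     and inherits the expansion. *)
  have [Y [_ EY]] := mode_expansion_exists.
  apply: (L2_expansion_transfer _ (LX.2 t t0) (EY t t0)) => [i|i vi].
    exact: mm.
  by apply: (mode_of_coef_eqn LX vi) => // s s0; exact: sol.
apply: coef_eqn_of_mode => // s s0; apply: (L2_expansion_coef _ (EX s s0) vi) => j.
exact: mm.
Qed.

End linear_equation.

(** * Regular paths of the fractional Brownian motions *)

Lemma RS_integral_ext (R : realType) (f g h : R -> R) (a b : R) :
  (forall x, a <= x <= b -> g x = h x) -> RS_integral f g a b = RS_integral f h a b.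
Proof.
move=> gh; rewrite /RS_integral; congr get; apply/seteqP; split => z /=.
  exact: is_RS_integral_ext.
by apply: is_RS_integral_ext => x xab; rewrite gh.
Qed.

Lemma within_half_line_abs (R : realType) (h : R -> R) :
  {within @half_line R, continuous h} -> continuous (fun t : R => h `|t|).
Proof.
move/subspace_continuousP => ch t; have := ch `|t| (normr_ge0 t).
move=> ht; apply: cvg_trans ht => /= V hV.
have nt : {for t, continuous (fun s : R => `|s|)} by exact: norm_continuous.
have : nbhs t ((fun s : R => `|s|) @^-1` [set s | half_line s -> V (h s)]) := nt _ hV.
by apply: filterS => s; apply; exact: normr_ge0.
Qed.

Section brownian_modification.
Context d (Omega : measurableType d) (R : realType) (P : probability Omega R).

Lemma fbm_measurable (H s2 : R) (b : R -> Omega -> R) t : is_fbm P H s2 b -> 0 <= t ->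
  measurable_fun setT (b t).
Proof.
move=> [gb _ _ _ _] t0.
have [+ _] := gb 1%N (fun=> t) (fun=> 1) (fun=> t0).
by congr measurable_fun; apply/funext => w; rewrite big_ord1 mul1r.
Qed.

Lemma fbm_moment (H : R) (b : R -> Omega -> R) (t : R) : is_fbm P H 1 b -> 0 <= t ->
  (\int[P]_w (b t w ^+ 2)%:E = (t `^ (2 * H))%:E)%E.
Proof.
move=> fb t0; have [_ _ b0 inc _] := fb.
have := inc 0 t (lexx 0) t0; rewrite subr0 ger0_norm// mulr1 unlock => <-.
have m0 := fbm_measurable fb (lexx 0); have mt := fbm_measurable fb t0.
apply: ae_eq_integral => //.
- by apply/measurable_EFinP/measurable_funX.
- apply/measurable_EFinP/measurable_funX; apply: measurableT_comp => //.
  exact: measurable_funB.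
by apply: filterS b0 => w bw _; rewrite bw subr0 real_normK ?num_real.
Qed.

(** The indices are countable, so one null set serves them all; it is taken measurable because its
    indicator will truncate the paths. *)
Lemma fbm_null_set (H : R) (b : bool * nat * nat -> R -> Omega -> R) :
  (forall i, valid i -> is_fbm P H 1 (b i)) ->
  exists N, [/\ measurable N, P N = 0%E & forall i w, valid i -> ~ N w ->
    b i 0 w = 0 /\ continuous (fun t : R => b i `|t| w)].
Proof.
move=> fb.
have : {ae P, forall w, forall n i, unpickle n = Some i -> valid i ->
    b i 0 w = 0 /\ continuous (fun t : R => b i `|t| w)}.
  apply: ae_foralln => n; case: (unpickle n) => [i|]; last by apply: aeW.
  have [vi|/negP nvi] := boolP (valid i); last by apply: aeW => w j [<-].
  have [_ _ b0 _ cb] := fb i vi.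
  apply: filterS2 b0 cb => w bw cw j [<-] _; split=> //.
  exact: within_half_line_abs cw.
move=> [N [mN PN sN]]; exists N; split => // i w vi Nw.
have : ~ (~` [set w | forall n i, unpickle n = Some i -> valid i ->
    b i 0 w = 0 /\ continuous (fun t : R => b i `|t| w)]) w by move/sN.
by rewrite /setC/= not_notE => /(_ (pickle i) i); apply => //; exact: pickleK.
Qed.

End brownian_modification.

Lemma psi_ge0 (R : realType) (alpha gamma t : R) : 0 <= psi alpha gamma t.
Proof. by rewrite mulr_ge0// powR_ge0. Qed.

(** * Translation of the theorem into the linear equation for the modes *)

Section proof_of_theorem.
Context d (Omega : measurableType d) (R : realType) (P : probability Omega R).
Local Notation S2 := (sphere R).
Variables (H alpha gamma : R) (A : nat -> R).
Variables (beta1 beta2 : nat -> nat -> R -> Omega -> R).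
Variables (B : R -> Omega -> S2 -> R) (T0 : Omega -> S2 -> R).
Variables (u : R -> Omega -> S2 -> R) (t0 : R).
Hypothesis H0 : 0 <= H.
Hypothesis fbmB : is_sphere_fbm P H A beta1 beta2 B.
Hypothesis mT0 : random_field T0.
Hypothesis hu : L2_sum P (cauchy_term alpha gamma T0 t0) (u t0).

Let a l := psi alpha gamma (lambda R l).
Let x0 i w := expR (- a i.1.2 * t0) * coef (T0 w) i.
Let beta (i : bool * nat * nat) := (if i.1.1 then beta2 else beta1) i.1.2 i.2.

Let A_gt0 l : 0 < A l. Proof. by have [] := fbmB. Qed.

Let fbm_beta i : valid i -> is_fbm P H 1 (beta i).
Proof. by have [_ _ + _ _] := fbmB; apply. Qed.

Variable N : set Omega.
Hypotheses (mN : measurable N) (PN : P N = 0%E).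
Hypothesis regular : forall i w, valid i -> ~ N w ->
  beta i 0 w = 0 /\ continuous (fun t : R => beta i `|t| w).

(* A modification of [beta] all of whose paths are continuous, on all of R. *)
Let g i (t : R) w := if valid i then \1_(~` N) w * beta i `|t| w else 0.

Let gT i : valid i -> g i = fun t w => \1_(~` N) w * beta i `|t| w.
Proof. by rewrite /g => ->. Qed.

Let gF i : ~~ valid i -> g i = fun _ _ => 0.
Proof. by rewrite /g => /negbTE ->. Qed.

Let gE i t w : valid i -> ~ N w -> 0 <= t -> g i t w = beta i t w.
Proof.
by move=> vi Nw t_ge0; rewrite /g vi indicE mem_set// mul1r ger0_norm.
Qed.

Let mg i t : measurable_fun setT (g i t).
Proof.
have [vi|/gF ->//] := boolP (valid i); rewrite gT//; apply: measurable_funM.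
  by apply: measurable_indic; exact: measurableC.
exact: fbm_measurable (fbm_beta vi) _.
Qed.

Let cg i w : continuous (g i ^~ w).
Proof.
have [vi|/gF ->] := boolP (valid i); last by move=> t; exact: cvg_cst.
rewrite gT//.
have [Nw|Nw] := pselect (N w).
  have -> : (fun t : R => \1_(~` N) w * beta i `|t| w) = fun=> 0.
    by apply/funext => t; rewrite indicE memNset ?mul0r// => /(_ Nw).
  by move=> t; exact: cvg_cst.
have [_ cb] := regular vi Nw.
by move=> t; apply: cvgM; [exact: cvg_cst|exact: cb].
Qed.

Let g0 i w : g i 0 w = 0.
Proof.
have [vi|/gF ->//] := boolP (valid i); rewrite gT//.
have [Nw|Nw] := pselect (N w).
  by rewrite indicE memNset ?mul0r// => /(_ Nw).
by rewrite normr0 (regular vi Nw).1 mulr0.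
Qed.

Let gM i s t : 0 <= s <= t ->
  (\int[P]_w (g i s w ^+ 2)%:E <= (t `^ (2 * H))%:E)%E.
Proof.
move=> /andP[s0 st]; have [vi|/gF ->] := boolP (valid i); last first.
  under eq_integral do rewrite expr0n.
  by rewrite integral0 lee_fin powR_ge0.
rewrite gT//; apply: (@le_trans _ _ (\int[P]_w (beta i s w ^+ 2)%:E)%E).
  have mb := fbm_measurable (fbm_beta vi) s0.
  apply: ge0_le_integral => //.
  - by move=> w _; rewrite lee_fin sqr_ge0.
  - apply/measurable_EFinP/measurable_funX; apply: measurable_funM.
      by apply: measurable_indic; exact: measurableC.
    by rewrite ger0_norm.
  - by apply/measurable_EFinP/measurable_funX.
  move=> w _; rewrite lee_fin ger0_norm// indicE.
  by case: (w \in _); rewrite ?mul1r// mul0r expr0n sqr_ge0.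
rewrite (fbm_moment (fbm_beta vi))// lee_fin ge0_ler_powR ?mulr_ge0// nnegrE//.
exact: le_trans st.
Qed.

Let mx0 i : measurable_fun setT (x0 i).
Proof. by apply: measurable_funM => //; exact: measurable_coef. Qed.

Let xU0 : L2_expansion P x0 (u t0).
Proof.
apply: ((L2_sumE (c := x0) (u t0) measurable0 (measure0 P) _).1 hu) => l w x _.
rewrite /cauchy_term cauchy_sumE; last exact: field_section.
apply: (congr1 (fun z : R => z%:C)); rewrite big_seq [RHS]big_seq; apply: eq_bigr => i.
by rewrite mem_lvl => /andP[_ /eqP <-].
Qed.

Let gB t : 0 <= t ->
  L2_expansion P (fun i w => Num.sqrt (A i.1.2) * g i t w) (B t).
Proof.
move=> t_ge0; have [_ _ _ _ /(_ t t_ge0) hB] := fbmB.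
apply: ((L2_sumE (B t) mN PN _).1 hB) => l w x Nw; rewrite real_harmonicsE.
apply: (congr1 (fun z : R => z%:C)); rewrite big_seq [RHS]big_seq; apply: eq_bigr => i.
rewrite mem_lvl => /andP[vi /eqP il]; rewrite gE// /beta il.
by case: (i.1.1).
Qed.

Let m i t w := mode a A x0 g i t w.

Let solution_termE t l w x : 0 <= t -> ~ N w ->
  solution_term alpha gamma A beta1 beta2 T0 t0 t l w x =
  (\sum_(i <- lvl l) m i t w * basis i x)%:C.
Proof.
move=> t_ge0 Nw; rewrite /solution_term real_harmonicsE cauchy_sumE; last exact: field_section.
rewrite -rmorphD -big_split; apply: (congr1 (fun z : R => z%:C)).
rewrite big_seq [RHS]big_seq.
apply: eq_bigr => i; rewrite mem_lvl => /andP[vi /eqP il] /=.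
rewrite -mulrDl /m /mode /x0 il; congr ((_ + _ * _) * _).
  by rewrite mulrAC -expRD; congr (expR _ * _); rewrite /a; ring.
rewrite -(RS_integral_ou (a := a l) (g := g i ^~ w) _ _ _ t_ge0)//.
- rewrite /ou_integral /a.
  transitivity (RS_integral (fun s => expR (- psi alpha gamma (lambda R l) * (t - s)))
      (beta i ^~ w) 0 t); first by rewrite /beta il; case: (i.1.1).
  (* The sums see only times in [[0, t]], where the modification agrees with the original path off
     [N]. *)
  by apply: RS_integral_ext => s /andP[s0 _]; rewrite gE.
- exact: psi_ge0.
Qed.

Let L2_sum_solution X t : 0 <= t ->
  L2_sum P (solution_term alpha gamma A beta1 beta2 T0 t0 t) (X t) <->
  L2_expansion P (fun i => m i t) (X t).
Proof.
by move=> t_ge0; apply: (L2_sumE _ mN PN) => l w x Nw; exact: solution_termE.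
Qed.

Let mB t : 0 <= t -> random_field (B t).
Proof. by move=> t_ge0; have [[]] := gB t_ge0. Qed.

Let cvA : cvgn (series (fun l => l.*2.+1%:R * A l)).
Proof. by have [] := fbmB. Qed.

Lemma solution_exists_and_unique :
  (exists X : R -> Omega -> S2 -> R,
     L2_process P X /\ is_solution P alpha gamma (u t0) B X) /\
  (forall X : R -> Omega -> S2 -> R, L2_process P X ->
     (is_solution P alpha gamma (u t0) B X <->
      forall t : R, 0 <= t ->
        L2_sum P (solution_term alpha gamma A beta1 beta2 T0 t0 t) (X t))).
Proof.
have a0 l : 0 <= a l by exact: psi_ge0.
have A0 l : 0 <= A l by exact: ltW.
have solP X : L2_process P X -> is_solution P alpha gamma (u t0) B X <->
    forall t, 0 <= t -> L2_expansion P (fun i => m i t) (X t).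
  move=> LX; rewrite is_solutionE//; last 2 first.
  - by case: xU0.1.
  - by move=> t /LX.2[].
  exact: (@linear_equationP _ _ _ P a A (u t0) B x0 g (fun t => t `^ (2 * H))).
split.
  have [X [LX EX]] := @mode_expansion_exists _ _ _ P a A (u t0) x0 g (fun t => t `^ (2 * H))
    a0 A0 cvA mx0 mg cg gM xU0.
  by exists X; split => //; apply/(solP X LX).
move=> X LX; split=> [h t t_ge0|h].
  exact: (L2_sum_solution X t_ge0).2 ((solP X LX).1 h t t_ge0).
by apply: (solP X LX).2 => t t_ge0; exact: (L2_sum_solution X t_ge0).1 (h t t_ge0).
Qed.

End proof_of_theorem.

Theorem theorem4p2 (R : realType) (d : measure_display)
    (Omega : measurableType d) (P : probability Omega R)
    (H alpha gamma : R) (A : nat -> R)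
    (beta1 beta2 : nat -> nat -> R -> Omega -> R)
    (B : R -> Omega -> sphere R -> R)
    (T0 : Omega -> sphere R -> R) (u : R -> Omega -> sphere R -> R) (t0 : R)
    (hH : 2^-1 <= H < 1) (halpha : 0 <= alpha) (hgamma : 0 < gamma)
    (hB : is_sphere_fbm P H A beta1 beta2 B)
    (hT0 : random_field T0) (hcent : centered P T0)
    (hiso : weakly_isotropic2 P T0) (hgauss : gaussian_field P T0)
    (hu : is_cauchy_solution P alpha gamma T0 u) (ht0 : 0 <= t0) :
  (exists X : R -> Omega -> sphere R -> R,
     L2_process P X /\ is_solution P alpha gamma (u t0) B X) /\
  (forall X : R -> Omega -> sphere R -> R, L2_process P X ->
     (is_solution P alpha gamma (u t0) B X <->
      forall t : R, 0 <= t ->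
        L2_sum P (solution_term alpha gamma A beta1 beta2 T0 t0 t) (X t))).
Proof.
have H0 : 0 <= H.
  by case/andP: hH => + _; apply: le_trans; rewrite invr_ge0.
have [N [mN PN regular]] := @fbm_null_set _ _ _ P H
  (fun i => (if i.1.1 then beta2 else beta1) i.1.2 i.2)
  (let: And5 _ _ fb _ _ := hB in fb).
exact: (solution_exists_and_unique H0 hB hT0 (hu t0 ht0) mN PN regular).
Qed.
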